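(* Let $d,p\ge 1$ be integers, let $y=(y_1,\dots,y_d)$ be a vector of i.i.d. random variables uniformly distributed so that $y$ takes values in $\Gamma:=[-1,1]^d$, and let $u(y)$ be an essentially bounded function of $y$. Let $P:=\frac{(p+d)!}{p!\,d!}$, let $N\ge 1$ be the number of samples, and define $$c_{p,d}:=\frac{\ln 3}{2}\,\frac{p}{\ln\left(\frac{(p+d)!}{p!\,d!}\right)},\qquad S_{\max}:=\frac{N}{64\,P^{4c_{p,d}}\,(\ln P)}.$$ Let $u_p^{1,\delta}(y):=\sum_{\alpha\in\Lambda_{p,d}}c_\alpha^{1,\delta}\psi_\alpha(y)$ be the Legendre polynomial chaos (PC) approximation of $u$ whose coefficient vector $c^{1,\delta}$ is computed from the $\ell_1$-minimization problem $(P_{1,\delta})$ with $\delta\ge 0$, built from $N$ i.i.d. samples $y^{(1)},\dots,y^{(N)}$ of $y$ and the values $u(y^{(1)}),\dots,u(y^{(N)})$. Suppose there exists a Legendre PC expansion $u_p^0(y):=\sum_{\alpha\in\Lambda_{p,d}^{\epsilon}}c_\alpha^0\psi_\alpha(y)$, for some index set $\Lambda_{p,d}^{\epsilon}\subseteq\Lambda_{p,d}$, such that $\|u-u_p^0\|_{L^\infty(\Gamma)}\le\epsilon$ and $$S<S_{\max},\qquad S:=|\Lambda_{p,d}^{\epsilon}|.$$ Then, with probability (over the $N$ samples) at least $$1-4P^{2-2S_{\max}}-P^{-8S_{\max}}-P^{-8S_{\max}P^{4c_{p,d}}},$$ and for some constants $c_1$ and $c_2$, the solution $u_p^{1,\delta}$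 obeys $$\|u-u_p^{1,\delta}\|_{L^2(\Gamma)}\le c_1\,\epsilon+c_2\,\frac{\delta}{\sqrt N}.$$
   Context: $\Gamma=[-1,1]^d$ carries the uniform probability measure $2^{-d}dy$ (the law of $y$), and $L^2(\Gamma)$ is taken with respect to it, i.e. $\|v\|_{L^2(\Gamma)}^2=\mathbb E[v(y)^2]$. Legendre PC basis: for $k\ge 0$, $\psi_k$ is the univariate Legendre polynomial of degree $k$ on $[-1,1]$ normalized so that $\int_{-1}^1\psi_k(t)^2\,\tfrac12\,dt=1$. For $\alpha=(\alpha_1,\dots,\alpha_d)\in\mathbb N_0^d$, $\psi_\alpha(y)=\prod_{i=1}^d\psi_{\alpha_i}(y_i)$. The index set is $\Lambda_{p,d}=\{\alpha\in\mathbb N_0^d:\ \|\alpha\|_1=\sum_i\alpha_i\le p\}$, of cardinality $P=\frac{(p+d)!}{p!\,d!}$; enumerate it as $\alpha_1,\dots,\alpha_P$. Measurement matrix: given i.i.d. samples $y^{(1)},\dots,y^{(N)}$ of $y$, $\Psi\in\mathbb R^{N\times P}$ has entries $\Psi[i,j]=\psi_{\alpha_j}(y^{(i)})$, and $\mathbf u=(u(y^{(1)}),\dots,u(y^{(N)}))\in\mathbb R^N$. Problem $(P_{1,\delta})$: $\min_{c\in\mathbb R^P}\|Wc\|_1$ subject to $\|\Psi c-\mathbf u\|_2\le\delta$, where $W$ is the diagonal $P\times P$ matrix whose $[j,j]$ entry is the $\ell_2$-norm of the $j$th column of $\Psi$. *)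

(* Defs.v *)
From HB Require Import structures.
From mathcomp Require Import all_boot all_order all_algebra.
From mathcomp Require Import all_classical all_reals all_analysis.

Set Implicit Arguments.
Unset Strict Implicit.
Unset Printing Implicit Defensive.

Import Order.TTheory GRing.Theory Num.Theory.
Import numFieldNormedType.Exports.

Local Open Scope classical_set_scope.
Local Open Scope ring_scope.

Definition mutually_independent (I : finType) (d d' : measure_display)
    (T : measurableType d) (T' : measurableType d') (R : realType)
    (Pr : probability T R) (X : I -> T -> T') : Prop :=
  forall (J : {set I}) (A : I -> set T'), (forall i, measurable (A i)) ->
    Pr (\bigcap_(i in [set i | i \in J]) (X i @^-1` A i))
      = (\prod_(i in J) Pr (X i @^-1` A i))%E.

Lemma ltN11 (R : realType) : -1 < 1 :> R.
Proof. exact: lt_trans (ltrN10 R) ltr01. Qed.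

(* The coordinates of y are i.i.d. and uniformly distributed on [-1, 1]. *)
Definition iid_uniform (n : nat) (d : measure_display) (T : measurableType d)
    (R : realType) (Pr : probability T R) (y : T -> n.-tuple R) : Prop :=
  mutually_independent Pr (fun (i : 'I_n) w => tnth (y w) i) /\
  forall (i : 'I_n) (A : set (measurableTypeR R)), measurable A ->
    Pr ((fun w => tnth (y w) i) @^-1` A) = uniform_prob (ltN11 R) A.

(* The Y_i, possibly living on another probability space, are i.i.d. copies
   of y. *)
Definition iid_samples (N : nat) (d0 d d' : measure_display)
    (T0 : measurableType d0) (T : measurableType d) (T' : measurableType d')
    (R : realType) (Pr0 : probability T0 R) (y : T0 -> T')
    (Pr : probability T R) (Y : 'I_N -> T -> T') : Prop :=
  mutually_independent Pr Y /\
  forall (i : 'I_N) (A : set T'), measurable A ->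
    Pr (Y i @^-1` A) = Pr0 (y @^-1` A).

(* Rodrigues' formula: P_k = (2^k k!)^-1 (d/dt)^k (t^2 - 1)^k. *)
Definition legendre (R : realType) (k : nat) : {poly R} :=
  (2 ^+ k * k`!%:R)^-1 *: (('X ^+ 2 - 1) ^+ k)^`(k).

Definition psi (R : realType) (k : nat) : {poly R} :=
  (Num.sqrt (\int[@lebesgue_measure R]_(t in `[-1, 1])
               ((legendre R k).[t] ^+ 2 / 2)))^-1 *: legendre R k.

(* Degrees at most p are enough to describe all the indices of Lambda_{p,d}. *)
Definition multi_index (p d : nat) : finType := d.-tuple 'I_p.+1.

Definition Lambda (p d : nat) : {set multi_index p d} :=
  [set a : d.-tuple 'I_p.+1 | (\sum_(i <- a) i <= p)%N]%SET.

Definition num_pc (p d : nat) : nat := (p + d)`! %/ (p`! * d`!).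

Lemma card_Lambda (p d : nat) : #|Lambda p d| = num_pc p d.
Proof.
rewrite card_partial_ord_partitions /num_pc addnC.
rewrite -(@bin_fact (p + d) d) ?leq_addl // addnK [(d`! * _)%N]mulnC.
by rewrite mulnK // muln_gt0 !fact_gt0.
Qed.

Definition Psi_alpha (R : realType) (p d : nat) (a : multi_index p d)
    (y : d.-tuple R) : R :=
  \prod_(i < d) (psi R (tnth a i)).[tnth y i].

Definition l1norm (R : realType) (n : nat) (v : 'cV[R]_n) : R :=
  \sum_(i < n) `|v i 0|.

Definition l2norm (R : realType) (n : nat) (v : 'cV[R]_n) : R :=
  Num.sqrt (\sum_(i < n) v i 0 ^+ 2).

(* The enumeration alpha_1, ..., alpha_P of Lambda is that of enum_val. *)
Definition measurement_matrix (R : realType) (p d N : nat)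
    (ys : 'I_N -> d.-tuple R) : 'M[R]_(N, #|Lambda p d|) :=
  \matrix_(i, j) Psi_alpha (enum_val j : multi_index p d) (ys i).

Definition column_weights (R : realType) (m n : nat) (M : 'M[R]_(m, n))
    : 'M[R]_n :=
  diag_mx (\row_j l2norm (col j M)).

Definition feasible (R : realType) (m n : nat) (M : 'M[R]_(m, n))
    (b : 'cV[R]_m) (delta : R) (c : 'cV[R]_n) : Prop :=
  l2norm (M *m c - b) <= delta.

(* Minimizers of (P_{1,delta}); they need not be unique. *)
Definition l1_solution (R : realType) (m n : nat) (M : 'M[R]_(m, n))
    (b : 'cV[R]_m) (delta : R) (c : 'cV[R]_n) : Prop :=
  feasible M b delta c /\
  forall c', feasible M b delta c' ->
    l1norm (column_weights M *m c) <= l1norm (column_weights M *m c').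

Definition pc_expansion (R : realType) (p d : nat)
    (c : 'cV[R]_#|Lambda p d|) (y : d.-tuple R) : R :=
  \sum_(j < #|Lambda p d|) c j 0 * Psi_alpha (enum_val j : multi_index p d) y.

Definition pc_expansion_on (R : realType) (p d : nat)
    (L : {set multi_index p d}) (c : multi_index p d -> R)
    (y : d.-tuple R) : R :=
  \sum_(a in L) c a * Psi_alpha a y.

Definition c_pd (R : realType) (p d : nat) : R :=
  ln 3 / 2 * (p%:R / ln (num_pc p d)%:R).

Definition S_max (R : realType) (p d N : nat) : R :=
  N%:R / (64 * (num_pc p d)%:R `^ (4 * c_pd R p d) * ln (num_pc p d)%:R).

Definition success_bound (R : realType) (p d N : nat) : R :=
  let P : R := (num_pc p d)%:R in
  let S := S_max R p d N in
  1 - 4 * P `^ (2 - 2 * S) - P `^ (- 8 * S)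
    - P `^ (- 8 * S * P `^ (4 * c_pd R p d)).

(* Main.v *)
Require Import Defs.
From HB Require Import structures.
From mathcomp Require Import all_boot all_order all_algebra.
From mathcomp Require Import all_classical all_reals all_analysis.
From mathcomp Require Import measurable_realfun ess_sup_inf.
From mathcomp Require Import perm ring lra zify.

Set Implicit Arguments.
Unset Strict Implicit.
Unset Printing Implicit Defensive.

Import Order.TTheory GRing.Theory Num.Theory.
Import numFieldNormedType.Exports.

Local Open Scope classical_set_scope.
Local Open Scope ring_scope.

(** The constants may depend on d and p, and 9 ^ p = P ^ (4 c_{p,d}).

    The cells of the dyadic partition of [-1, 1]^d have equal probability.
    For n large the samples can thus be replaced by the centres of their cells:
    the success event is a union of products of cells, and its probability is
    an average over a finite grid.  On the grid a polynomial f of degree at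
    most p is a polynomial of degree at most p in the binary digits of the
    coordinates, so that Bonami's inequality gives E f^4 <= 9^p (E f^2)^2, hence
    a lower tail bound for the sum of f^2 over the samples with variance proxy
    9^p.  The recovery error c - c0 is then controlled in three regimes:
    - if N is large, Psi is well conditioned, by the lower tail on a net;
    - if P <= N for one of the finitely many other N, the determinant of a
      P x P block of Psi is a nonzero polynomial in the samples, hence bounded
      below outside a set of probability at most exp(-N/8), which is the last
      term of the success bound;
    - if N < P, an N x N block of Psi is invertible with bounded inverse for
      the same reason, so that residuals can be cancelled exactly; a null space
      property for Psi and S follows from the lower tail on finitely many test
      vectors, provided by Maurey's empirical method. *)

(** * Polynomial functions and Bonami's inequality *)

(** The two main failure terms act as budgets, and the constants are tuned to them. The term 4 P^2
    exp(-N / (32 * 9^p)) pays for tail events: a relative deviation 1/4 of a squared column norm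
    costs exp(-N / (32 * 9^p)), while deviation 3/4 costs exp(-9 N / (32 * 9^p)), which leaves room
    for exp(N / (4 * 9^p)) test vectors; the factor 64 in [S_max] admits P^(16 S) of them. A net of
    sparse vectors would not do: a kernel vector violating the null space property is only bounded
    in l1-norm off [S]. Maurey averages approximate it with 13 S terms. The term exp(-N / 8) pays
    for the determinants. Their lower bounds are not explicit and depend on [N], so they may enter
    the constants only for finitely many [N]; this is why large [N] needs the net. Minimizers need
    not be unique and may depend on the samples in a non-measurable way. Good events are therefore
    described by cells, and recovery is deterministic: it holds for all points of a good product of
    cells and all minimizers. *)

Section PolynomialFunctions.
Context {R : realType}.

Definition upd (I : eqType) (x : I -> R) (i : I) (t : R) : I -> R :=
  fun j => if j == i then t else x j.

(** A predicate on functions rather than a type of multivariate polynomials: degree facts become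
    inductions on these three rules, over any type of variables. *)
Inductive polyfun (I : eqType) : nat -> ((I -> R) -> R) -> Prop :=
| polyfun_cst k c : polyfun k (fun=> c)
| polyfun_add k f g : polyfun k f -> polyfun k g ->
    polyfun k (fun x => f x + g x)
| polyfun_mulX k i f : polyfun k f -> polyfun k.+1 (fun x => x i * f x).

Lemma polyfun_ext (I : eqType) k (f g : (I -> R) -> R) :
  (forall x, f x = g x) -> polyfun k f -> polyfun k g.
Proof. by move=> /funext ->. Qed.

Lemma polyfunW (I : eqType) k l (f : (I -> R) -> R) :
  (k <= l)%N -> polyfun k f -> polyfun l f.
Proof.
move=> kl pf; elim: pf l kl => {k f} [k c|k f g _ IHf _ IHg|k i f _ IHf] l kl.
- exact: polyfun_cst.
- by apply: polyfun_add; [apply: IHf | apply: IHg].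
- by case: l kl => // l kl; apply: polyfun_mulX; apply: IHf.
Qed.

Lemma polyfun_scale (I : eqType) k c (f : (I -> R) -> R) :
  polyfun k f -> polyfun k (fun x => c * f x).
Proof.
elim=> {k f} [k a|k f g _ IHf _ IHg|k i f _ IHf].
- exact: polyfun_cst.
- by apply: polyfun_ext (polyfun_add IHf IHg) => x; rewrite mulrDr.
- by apply: polyfun_ext (polyfun_mulX i IHf) => x; rewrite mulrCA.
Qed.

Lemma polyfun_mul (I : eqType) k l (f g : (I -> R) -> R) :
  polyfun k f -> polyfun l g -> polyfun (k + l) (fun x => f x * g x).
Proof.
elim=> {k f} [k c|k f h _ IHf _ IHh|k i f _ IHf] pg.
- by apply: polyfunW (polyfun_scale c pg); rewrite leq_addl.
- by apply: polyfun_ext (polyfun_add (IHf pg) (IHh pg)) => x; rewrite mulrDl.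
- by apply: polyfun_ext (polyfun_mulX i (IHf pg)) => x; rewrite mulrA.
Qed.

Lemma polyfun_sum (I : eqType) (J : Type) k (r : seq J) (P : pred J)
    (f : J -> (I -> R) -> R) :
  (forall j, P j -> polyfun k (f j)) ->
  polyfun k (fun x => \sum_(j <- r | P j) f j x).
Proof.
move=> pf; elim: r => [|j r IHr].
  by apply: polyfun_ext (polyfun_cst _ k 0) => x; rewrite big_nil.
case Pj: (P j); last by apply: polyfun_ext IHr => x; rewrite big_cons Pj.
by apply: polyfun_ext (polyfun_add (pf _ Pj) IHr) => x; rewrite big_cons Pj.
Qed.

Lemma polyfun_prod (I : eqType) (J : Type) (r : seq J)
    (k : J -> nat) (f : J -> (I -> R) -> R) :
  (forall j, polyfun (k j) (f j)) ->
  polyfun (\sum_(j <- r) k j) (fun x => \prod_(j <- r) f j x).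
Proof.
move=> pf; elim: r => [|j r IHr].
  by apply: polyfun_ext (polyfun_cst _ _ 1) => x; rewrite big_nil.
rewrite big_cons.
by apply: polyfun_ext (polyfun_mul (pf j) IHr) => x; rewrite big_cons.
Qed.

Lemma polyfun_horner (I : eqType) k (q : {poly R}) (i : I) :
  (size q <= k.+1)%N -> polyfun k (fun x => q.[x i]).
Proof.
elim/poly_ind: q k => [|q c IHq] k sq.
  by apply: polyfun_ext (polyfun_cst _ _ 0) => x; rewrite horner0.
have [q0|qn0] := eqVneq q 0.
  by apply: polyfun_ext (polyfun_cst _ _ c) => x; rewrite q0 hornerMXaddC horner0 mul0r add0r.
move: sq; rewrite size_MXaddC (negbTE qn0) /= ltnS => sq.
case: k sq => [|k] sq; first by rewrite leqn0 size_poly_eq0 (negbTE qn0) in sq.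
apply: polyfun_ext (polyfun_add (polyfun_mulX i (IHq _ sq)) (polyfun_cst _ _ c)) => x.
by rewrite hornerMXaddC mulrC.
Qed.

Lemma polyfun_reindex (I J : eqType) (m : I -> J) k (f : (I -> R) -> R) :
  polyfun k f -> polyfun k (fun x : J -> R => f (x \o m)).
Proof.
elim=> {k f} [k a|k f g _ IHf _ IHg|k i f _ IHf].
- exact: polyfun_cst.
- exact: polyfun_add.
- exact: (polyfun_mulX (m i)).
Qed.

Lemma polyfun_bounded (I : eqType) k (f : (I -> R) -> R) : polyfun k f ->
  exists2 C : R, 0 <= C & forall x, (forall i, `|x i| <= 1) -> `|f x| <= C.
Proof.
elim=> {k f} [k a|k f g _ [C C0 Cf] _ [D D0 Dg]|k i f _ [C C0 Cf]].
- by exists `|a|.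
- exists (C + D); first exact: addr_ge0.
  by move=> x x1; rewrite (le_trans (ler_normD _ _))// lerD// ?Cf ?Dg.
- exists C => // x x1; rewrite normrM -[leRHS]mul1r.
  by rewrite ler_pM// Cf.
Qed.

Lemma polyfun_lipschitz (I : eqType) k (f : (I -> R) -> R) : polyfun k f ->
  exists2 C : R, 0 <= C & forall x y h,
    (forall i, `|x i| <= 1) -> (forall i, `|y i| <= 1) ->
    (forall i, `|x i - y i| <= h) -> `|f x - f y| <= C * h.
Proof.
elim=> {k f} [k a|k f g _ [C C0 Cf] _ [D D0 Dg]|k i f pf [C C0 Cf]].
- by exists 0 => // x y h _ _ _; rewrite subrr normr0 mul0r.
- exists (C + D); first exact: addr_ge0.
  move=> x y h x1 y1 xy.
  rewrite opprD addrACA mulrDl (le_trans (ler_normD _ _))//.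
  by rewrite lerD// ?Cf ?Dg.
- have [D D0 Df] := polyfun_bounded pf.
  exists (C + D); first exact: addr_ge0.
  move=> x y h x1 y1 xy.
  have -> : x i * f x - y i * f y = x i * (f x - f y) + (x i - y i) * f y.
    by ring.
  rewrite (le_trans (ler_normD _ _))// !normrM mulrDl lerD//.
    by rewrite -[leRHS]mul1r ler_pM// Cf.
  by rewrite mulrC ler_pM// Df.
Qed.

(* Rademacher decomposition in the direction i: the dyadic substitution
   x_i := (x_i + e) / 2 with a random sign e costs one degree in the odd part. *)
Lemma polyfun_split (I : eqType) k i (f : (I -> R) -> R) : polyfun k f ->
  exists fe fo : (I -> R) -> R,
    [/\ polyfun k fe, polyfun k.-1 fo, k = 0%N -> forall x, fo x = 0 &
        forall x e, e ^+ 2 = 1 ->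
          f (upd x i ((x i + e) / 2)) = fe x + e * fo x].
Proof.
elim=> {k f} [k a|k f g _ [fe [fo [pe po f0 fE]]] _ [ge [go [qe qo g0 gE]]]
             |k j f pf [fe [fo [pe po f0 fE]]]].
- exists (fun=> a), (fun=> 0); split=> //; try exact: polyfun_cst.
  by move=> x e _; rewrite mulr0 addr0.
- exists (fun x => fe x + ge x), (fun x => fo x + go x); split.
  + exact: polyfun_add.
  + exact: polyfun_add.
  + by move=> k0 x; rewrite f0// g0// addr0.
  + by move=> x e e1; rewrite fE// gE//; ring.
- have pow : polyfun k fo by apply: polyfunW po; exact: leq_pred.
  have [<-{j}|ji] := eqVneq i j.
    (* Expansion of (x_i + e) (fe + e fo) / 2 with e^2 = 1. *)
    exists (fun x => 2^-1 * (x i * fe x + fo x)),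
           (fun x => 2^-1 * (fe x + x i * fo x)); split=> //.
    + apply: polyfun_scale; apply: polyfun_add; first exact: polyfun_mulX.
      by apply: polyfunW pow.
    + apply: polyfun_scale; apply: polyfun_add => //.
      (* At [k = 0] the truncated predecessor hides a loss: [x i * fo x] would have degree 1, and
         only [fo = 0] keeps the degree at 0. *)
      case: k {pf fE pe pow} f0 po => [f0 _|k _ po]; last exact: polyfun_mulX.
      by apply: polyfun_ext (polyfun_cst _ _ 0) => x; rewrite f0// mulr0.
    + move=> x e e1; rewrite fE// /upd eqxx.
      rewrite [in RHS]mulrCA -mulrDr mulrAC mulrC; congr (_ * _).
      rewrite !mulrDl !mulrDr.
      have -> : e * (e * fo x) = fo x by rewrite mulrA -expr2 e1 mul1r.
      by ring.
  exists (fun x => x j * fe x), (fun x => x j * fo x); split => //.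
  + exact: polyfun_mulX.
  + case: k {pf fE pe pow} f0 po => [f0 _|k _ po]; last exact: polyfun_mulX.
    by apply: polyfun_ext (polyfun_cst _ _ 0) => x; rewrite f0// mulr0.
  + move=> x e e1; rewrite fE// /upd eq_sym (negbTE ji); ring.
Qed.

End PolynomialFunctions.

Section Bonami.
Context {R : realType} {I : eqType}.
Implicit Types (f g : (I -> R) -> R) (l : seq I).

(* Each occurrence of i in l substitutes (x_i + e) / 2 for x_i, with a fresh
   random sign e: repeating every coordinate n times yields the uniform
   measure on the midpoints of the 2 ^ n dyadic cells. *)
Fixpoint dyadic_mean l f : R :=
  if l is i :: l' then
    (dyadic_mean l' (fun x => f (upd x i ((x i + 1) / 2)))
     + dyadic_mean l' (fun x => f (upd x i ((x i - 1) / 2)))) / 2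
  else f (fun=> 0).

Lemma eq_dyadic_mean l f g : f =1 g -> dyadic_mean l f = dyadic_mean l g.
Proof. by move=> /funext ->. Qed.

Lemma dyadic_meanD l f g :
  dyadic_mean l (fun x => f x + g x) = dyadic_mean l f + dyadic_mean l g.
Proof.
elim: l f g => [//|i l IHl] f g /=.
by rewrite !IHl -mulrDl; congr (_ / _); rewrite addrACA.
Qed.

Lemma dyadic_meanZ l c f :
  dyadic_mean l (fun x => c * f x) = c * dyadic_mean l f.
Proof. by elim: l f => [//|i l IHl] f /=; rewrite !IHl -mulrDr mulrA. Qed.

Lemma dyadic_mean_ge0 l f : (forall x, 0 <= f x) -> 0 <= dyadic_mean l f.
Proof.
elim: l f => [|i l IHl] f f0 /=; first exact: f0.
by rewrite mulr_ge0 ?invr_ge0// addr_ge0// IHl.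
Qed.

Lemma dyadic_mean_CS l f g :
  dyadic_mean l (fun x => f x * g x) ^+ 2 <=
  dyadic_mean l (fun x => f x ^+ 2) * dyadic_mean l (fun x => g x ^+ 2).
Proof.
set a := dyadic_mean l (fun x => f x ^+ 2).
set b := dyadic_mean l (fun x => f x * g x).
set c := dyadic_mean l (fun x => g x ^+ 2).
have a0 : 0 <= a by apply: dyadic_mean_ge0 => x; exact: sqr_ge0.
have c0 : 0 <= c by apply: dyadic_mean_ge0 => x; exact: sqr_ge0.
have quad s t : 0 <= s ^+ 2 * a + 2 * s * t * b + t ^+ 2 * c.
  rewrite /a /b /c -!dyadic_meanZ -!dyadic_meanD.
  apply: dyadic_mean_ge0 => x.
  rewrite (_ : _ + _ = (s * f x + t * g x) ^+ 2) ?sqr_ge0//.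
  by ring.
have [a_eq0|a_neq0] := eqVneq a 0.
  have [->|b0] := eqVneq b 0; first by rewrite expr0n mulr_ge0.
  (* With [a = 0] the form is affine in [s]; this choice gives it the negative value - 2 (c + 1) +
     c. *)
  have := quad (- (c + 1) / b) 1; rewrite a_eq0 mulr0 add0r mulr1 expr1n mul1r.
  rewrite (_ : 2 * _ * b = - 2 * (c + 1)); last by field.
  lra.
have := quad (- b) a.
have -> : (- b) ^+ 2 * a + 2 * - b * a * b + a ^+ 2 * c = a * (a * c - b ^+ 2).
  by ring.
by rewrite pmulr_rge0 ?subr_ge0// lt_neqAle eq_sym a_neq0.
Qed.

(** With f = fe + e fo, the second moment is a + b and the fourth a4 + 6 ab + b4. The odd part has
    one degree less, which gains a factor 9 for b4 and, by Cauchy-Schwarz, a factor 3 for the cross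
    term: 6 * 3 = 2 * 9 completes the square. *)
Lemma bonami l k f : polyfun k f ->
  dyadic_mean l (fun x => f x ^+ 4) <=
  9 ^+ k * dyadic_mean l (fun x => f x ^+ 2) ^+ 2.
Proof.
elim: l k f => [|i l IHl] k f pf /=.
  by rewrite -exprM ler_peMl ?exprn_even_ge0// exprn_ege1// ler1n.
have [fe [fo [pe po f0 fE]]] := polyfun_split i pf.
set a := dyadic_mean l (fun x => fe x ^+ 2).
set b := dyadic_mean l (fun x => fo x ^+ 2).
set a4 := dyadic_mean l (fun x => fe x ^+ 4).
set b4 := dyadic_mean l (fun x => fo x ^+ 4).
set ab := dyadic_mean l (fun x => fe x ^+ 2 * fo x ^+ 2).
have a0 : 0 <= a by apply: dyadic_mean_ge0 => x; exact: sqr_ge0.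
have b0 : 0 <= b by apply: dyadic_mean_ge0 => x; exact: sqr_ge0.
have E1 x : f (upd x i ((x i + 1) / 2)) = fe x + fo x.
  by rewrite fE ?expr1n// mul1r.
have E2 x : f (upd x i ((x i - 1) / 2)) = fe x - fo x.
  by rewrite fE ?sqrrN ?expr1n// mulN1r.
have -> : (dyadic_mean l (fun x => f (upd x i ((x i + 1) / 2)) ^+ 2)
     + dyadic_mean l (fun x => f (upd x i ((x i - 1) / 2)) ^+ 2)) / 2 = a + b.
  rewrite -dyadic_meanD mulrC -dyadic_meanZ /a /b -dyadic_meanD.
  by apply: eq_dyadic_mean => x; rewrite E1 E2; field.
have -> : (dyadic_mean l (fun x => f (upd x i ((x i + 1) / 2)) ^+ 4)
     + dyadic_mean l (fun x => f (upd x i ((x i - 1) / 2)) ^+ 4)) / 2 =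
     a4 + 6 * ab + b4.
  rewrite -dyadic_meanD mulrC -dyadic_meanZ /a4 /b4 /ab -dyadic_meanZ.
  rewrite -!dyadic_meanD.
  by apply: eq_dyadic_mean => x; rewrite E1 E2; field.
have ha4 : a4 <= 9 ^+ k * a ^+ 2 by exact: IHl.
have hb4 : b4 <= 9 ^+ k.-1 * b ^+ 2 by exact: IHl.
have hab : ab ^+ 2 <= a4 * b4.
  rewrite (le_trans (dyadic_mean_CS _ _ _))//.
  by rewrite le_eqVlt /a4 /b4; apply/orP; left; apply/eqP; congr (_ * _);
     apply: eq_dyadic_mean => x; ring.
have ab0 : 0 <= ab by apply: dyadic_mean_ge0 => x; rewrite mulr_ge0 ?sqr_ge0.
case: k {pf po pe fE} f0 ha4 hb4 => [|k] f0 ha4 hb4.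
  have b_eq0 : b = 0.
    rewrite /b (@eq_dyadic_mean l _ (fun=> 0 * 0)) ?dyadic_meanZ ?mul0r// => x.
    by rewrite f0// expr0n ?mulr0.
  have b4_eq0 : b4 = 0.
    rewrite /b4 (@eq_dyadic_mean l _ (fun=> 0 * 0)) ?dyadic_meanZ ?mul0r// => x.
    by rewrite f0// expr0n ?mulr0.
  have ab_eq0 : ab = 0.
    by apply/eqP; move: hab; rewrite b4_eq0 mulr0 -sqrf_eq0 le_eqVlt ltNge sqr_ge0 orbF.
  by rewrite b_eq0 b4_eq0 ab_eq0 mulr0 !addr0.
rewrite /= in hb4.
have q0 : 0 < 9 ^+ k :> R by rewrite exprn_gt0.
set q : R := 9 ^+ k in q0 hb4 *.
rewrite exprS -/q in ha4 *.
have habq : ab <= 3 * q * a * b.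
  have b40 : 0 <= b4 by apply: dyadic_mean_ge0 => x; exact: exprn_even_ge0.
  have a40 : 0 <= a4 by apply: dyadic_mean_ge0 => x; exact: exprn_even_ge0.
  rewrite -ler_sqr ?nnegrE ?mulr_ge0// ?(ltW q0)//.
  rewrite (le_trans hab)// (le_trans (ler_pM _ _ ha4 hb4))//.
  by rewrite le_eqVlt; apply/orP; left; apply/eqP; ring.
have -> : 9 * q * (a + b) ^+ 2 = 9 * q * a ^+ 2 + 18 * q * a * b + 9 * q * b ^+ 2.
  by ring.
have : 0 <= q * b ^+ 2 by rewrite mulr_ge0 ?sqr_ge0 ?ltW.
lra.
Qed.

End Bonami.

(** * Averages over the dyadic grid *)

Section Averages.
Context {R : realType}.

Definition avg (T : finType) (f : T -> R) : R := #|T|%:R^-1 * \sum_x f x.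

Lemma eq_avg (T : finType) (f g : T -> R) : f =1 g -> avg f = avg g.
Proof. by move=> fg; congr (_ * _); apply: eq_bigr => x _. Qed.

Lemma avgD (T : finType) (f g : T -> R) :
  avg (fun x => f x + g x) = avg f + avg g.
Proof. by rewrite /avg big_split mulrDr. Qed.

Lemma avgZ (T : finType) c (f : T -> R) : avg (fun x => c * f x) = c * avg f.
Proof. by rewrite /avg -big_distrr/= mulrCA. Qed.

Lemma avg_sum (T J : finType) (f : J -> T -> R) :
  avg (fun x => \sum_j f j x) = \sum_j avg (f j).
Proof. by rewrite /avg exchange_big/= mulr_sumr. Qed.

Lemma avg_le (T : finType) (f g : T -> R) :
  (forall x, f x <= g x) -> avg f <= avg g.
Proof. by move=> fg; rewrite ler_wpM2l ?invr_ge0// ler_sum. Qed.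

Lemma avg_ge0 (T : finType) (f : T -> R) : (forall x, 0 <= f x) -> 0 <= avg f.
Proof. by move=> f0; rewrite mulr_ge0 ?invr_ge0// sumr_ge0. Qed.

Lemma avg_cst (T : finType) (c : R) : (0 < #|T|)%N -> avg (fun _ : T => c) = c.
Proof.
move=> T0; rewrite /avg sumr_const -[c *+ _]mulr_natl mulrA mulVf ?mul1r//.
by rewrite pnatr_eq0 -lt0n.
Qed.

Lemma avg_bij (S T : finType) (h : S -> T) (f : T -> R) :
  bijective h -> avg f = avg (f \o h).
Proof.
move=> bh; rewrite /avg (bij_eq_card bh); congr (_ * _).
by rewrite (reindex h)//=; exact: onW_bij.
Qed.

Lemma avg_ord n (f : nat -> R) :
  avg (fun j : 'I_n => f j) = n%:R^-1 * \sum_(0 <= j < n) f j.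
Proof. by rewrite /avg card_ord big_mkord. Qed.

Lemma avg_prod (I T : finType) (F : I -> T -> R) :
  avg (fun g : {ffun I -> T} => \prod_i F i (g i)) = \prod_i avg (F i).
Proof.
rewrite /avg card_ffun big_split/= prodr_const -bigA_distr_bigA/=.
by rewrite natrX exprVn.
Qed.

End Averages.

Section Grid.
Context {R : realType}.

(* Midpoints of the 2 ^ n dyadic cells of [-1, 1]. *)
Definition pt n (j : nat) : R := (2 * j + 1)%:R / 2 ^+ n - 1.

Definition gpt (I : finType) n (g : {ffun I -> 'I_(2 ^ n)}) : I -> R :=
  fun i => pt n (g i).

Lemma pt_bound n (j : 'I_(2 ^ n)) : `|pt n j| <= 1.
Proof.
have p2 : 0 < 2 ^+ n :> R by rewrite exprn_gt0.
rewrite /pt ler_norml lerBrDl subrr divr_ge0 ?(ltW p2)//=.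
rewrite lerBlDr natrD natrM ler_pdivrMr// mulrDl !mul1r.
have : (j.+1%:R : R) <= 2 ^+ n by rewrite -natrX ler_nat.
rewrite -natr1; lra.
Qed.

Lemma pt_low n j : (pt n j - 1) / 2 = pt n.+1 j.
Proof. by rewrite /pt exprS; field; rewrite expf_neq0. Qed.

Lemma pt_high n j : (pt n j + 1) / 2 = pt n.+1 (2 ^ n + j).
Proof.
have e m : (2 * m + 1)%:R = 2 * m%:R + 1 :> R by rewrite natrD natrM.
rewrite /pt exprS !e natrD natrX; field.
by rewrite expf_neq0.
Qed.

Lemma grid_gt0 (I : finType) n : (0 < #|{ffun I -> 'I_(2 ^ n)}|)%N.
Proof. by rewrite card_ffun card_ord !expn_gt0. Qed.

Section Operators.
Variable (I : finType).
Implicit Types (f : (I -> R) -> R) (l : seq I).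

Definition grid_op n i f : (I -> R) -> R :=
  fun x => avg (fun j : 'I_(2 ^ n) => f (upd x i (pt n j))).

Definition grid_ops n l f : (I -> R) -> R := foldl (fun g i => grid_op n i g) f l.

Lemma upd_upd (x : I -> R) i s t : upd (upd x i s) i t = upd x i t.
Proof. by apply/funext => j; rewrite /upd; case: eqP. Qed.

Lemma avg_ord_double n (F : nat -> R) :
  avg (fun j : 'I_(2 ^ n.+1) => F j) =
  2^-1 * (avg (fun j : 'I_(2 ^ n) => F j)
          + avg (fun j : 'I_(2 ^ n) => F (2 ^ n + j)%N)).
Proof.
rewrite avg_ord expnS natrM invfM mulSn mul1n -mulrA; congr (_ * _).
rewrite (@big_cat_nat _ _ _ (2 ^ n)%N) ?leq_addr//= -{3}[(2 ^ n)%N]add0n.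
rewrite big_addn addnK mulrDr avg_ord; congr (_ + _).
rewrite (avg_ord _ (fun j => F (2 ^ n + j)%N)); congr (_ * _).
by apply: eq_bigr => j _; rewrite addnC.
Qed.

(** The [n] halvings place the remaining value [x i], scaled by 2^-n, around a midpoint; this
    residue disappears once [x i = 0]. *)
Lemma dyadic_mean_cell n i l f :
  dyadic_mean (nseq n i ++ l) f =
  dyadic_mean l (fun x => avg (fun j : 'I_(2 ^ n) =>
    f (upd x i (pt n j + x i / 2 ^+ n)))).
Proof.
elim: n f => [|n IHn] f /=.
  apply: eq_dyadic_mean => x; rewrite /avg card_ord invr1 mul1r.
  rewrite big_ord1; congr f; apply/funext => j; rewrite /upd /pt.
  by case: eqP => // ->; rewrite expr0 !divr1 muln0 add0n mulr1; ring.
rewrite !IHn -dyadic_meanD mulrC -dyadic_meanZ; apply: eq_dyadic_mean => x.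
rewrite (avg_ord_double n (fun j => f (upd x i (pt n.+1 j + x i / 2 ^+ n.+1)))).
have p2 : (2 ^+ n : R) != 0 by rewrite expf_neq0.
congr (_ * _); rewrite addrC; congr (_ + _); apply: eq_avg => j;
  congr f; rewrite upd_upd; congr upd; rewrite /upd eqxx.
- by rewrite -pt_low exprS; field.
- by rewrite -pt_high exprS; field.
Qed.

(** The recursion ends at the origin, so a coordinate that [l] never substitutes keeps the value
    0. *)
Lemma dyadic_mean_local i l f (g : (I -> R) -> R) : i \notin l ->
  (forall x, x i = 0 -> f x = g x) -> dyadic_mean l f = dyadic_mean l g.
Proof.
elim: l f g => [|j l IHl] f g /=; first by move=> _; exact.
rewrite inE negb_or => /andP[ij il] fg.
by congr (_ / _); congr (_ + _); apply: IHl => // x x0;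
   apply: fg; rewrite /upd (negbTE ij).
Qed.

Lemma dyadic_mean_grid n l f : uniq l ->
  dyadic_mean (flatten [seq nseq n i | i <- l]) f = grid_ops n l f (fun=> 0).
Proof.
elim: l f => [//|i l IHl] f /= /andP[il ul].
rewrite dyadic_mean_cell -IHl//.
apply: (@dyadic_mean_local i).
  apply: contra il => /flattenP[s /mapP[j jl ->]].
  by rewrite mem_nseq => /andP[_ /eqP ->].
by move=> x x0; rewrite x0; apply: eq_avg => j; rewrite mul0r addr0.
Qed.

Lemma avg_grid_op n i f :
  avg (fun g : {ffun I -> 'I_(2 ^ n)} => grid_op n i f (gpt g)) =
  avg (fun g : {ffun I -> 'I_(2 ^ n)} => f (gpt g)).
Proof.
pose put (g : {ffun I -> 'I_(2 ^ n)}) (a : 'I_(2 ^ n)) :=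
  [ffun k => if k == i then a else g k].
(* Exchanging the value at [i] with the auxiliary index is an involution of the pairs, so the double
   average collapses to one over the grid. *)
pose swap (c : {ffun I -> 'I_(2 ^ n)} * 'I_(2 ^ n)) := (put c.1 c.2, c.1 i).
have swapK : involutive swap.
  case=> g a; rewrite /swap /=; congr pair; last by rewrite ffunE eqxx.
  by apply/ffunP => k; rewrite !ffunE; case: eqP => // ->.
congr (_ * _).
rewrite /grid_op /avg -mulr_sumr.
rewrite (eq_bigr (fun g => \sum_j f (gpt (put g j)))); last first.
  move=> g _; apply: eq_bigr => j _; congr f.
  by apply/funext => k; rewrite /upd /gpt /put ffunE; case: eqP.
rewrite pair_big/= (reindex_inj (inv_inj swapK))/=.
rewrite (eq_bigr (fun c => f (gpt c.1))); last first.
  by move=> c _; rewrite -[put _ _]/(swap (swap c)).1 swapK.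
rewrite -(pair_big predT predT (fun g (_ : 'I_(2 ^ n)) => f (gpt g)))/=.
rewrite mulr_sumr; apply: eq_bigr => g _.
by rewrite sumr_const card_ord -[f _ *+ _]mulr_natl mulrA mulVf ?mul1r//.
Qed.

Lemma avg_grid_ops n l f :
  avg (fun g : {ffun I -> 'I_(2 ^ n)} => grid_ops n l f (gpt g)) =
  avg (fun g : {ffun I -> 'I_(2 ^ n)} => f (gpt g)).
Proof. by elim: l f => [//|i l IHl] f; rewrite /= IHl avg_grid_op. Qed.

(** Averaging over a coordinate removes the dependence on it; [Z] collects the coordinates already
    removed. Once all are removed the result is constant, hence equal to its value at the origin. *)
Lemma grid_ops_local n l (Z : pred I) f :
  (forall x y, (forall j, ~~ Z j -> x j = y j) -> f x = f y) ->
  forall x y, (forall j, ~~ (Z j || (j \in l)) -> x j = y j) ->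
  grid_ops n l f x = grid_ops n l f y.
Proof.
elim: l Z f => [|i l IHl] Z f fZ x y xy /=.
  by apply: fZ => j Zj; apply: xy; rewrite in_nil orbF.
apply: (IHl [pred j | Z j || (j == i)]) => [{xy}x {}y xy|j /=].
  apply: eq_avg => a; apply: fZ => j Zj; rewrite /upd; case: eqP => // /eqP ji.
  by apply: xy => /=; rewrite negb_or Zj.
by rewrite -orbA => H; apply: xy; rewrite inE.
Qed.

Lemma avg_grid n f :
  avg (fun g : {ffun I -> 'I_(2 ^ n)} => f (gpt g)) =
  dyadic_mean (flatten [seq nseq n i | i <- enum I]) f.
Proof.
rewrite dyadic_mean_grid ?enum_uniq// -(avg_grid_ops n (enum I)).
rewrite -[RHS](@avg_cst R {ffun I -> 'I_(2 ^ n)}) ?grid_gt0//.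
apply: eq_avg => g; apply: (@grid_ops_local _ _ pred0).
  by move=> x y xy; congr f; apply/funext => j; exact: xy.
by move=> j; rewrite /= mem_enum.
Qed.

Lemma bonami_grid n k f : polyfun k f ->
  avg (fun g : {ffun I -> 'I_(2 ^ n)} => f (gpt g) ^+ 4) <=
  9 ^+ k * avg (fun g : {ffun I -> 'I_(2 ^ n)} => f (gpt g) ^+ 2) ^+ 2.
Proof.
move=> pf; rewrite (avg_grid n (fun x => f x ^+ 4)).
by rewrite (avg_grid n (fun x => f x ^+ 2)); exact: bonami.
Qed.

Lemma grid_ops_le n l f (g : (I -> R) -> R) : (forall x, f x <= g x) ->
  forall x, grid_ops n l f x <= grid_ops n l g x.
Proof.
elim: l f g => [//|i l IHl] f g fg /=.
by apply: IHl => x; apply: avg_le => j.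
Qed.

Lemma grid_opsD n l f c x :
  grid_ops n l (fun x => f x + c) x = grid_ops n l f x + c.
Proof.
elim: l f => [//|i l IHl] f /=; rewrite -IHl; congr (grid_ops _ _ _ _).
apply/funext => y; rewrite /grid_op avgD avg_cst//.
by rewrite card_ord expn_gt0.
Qed.

End Operators.
End Grid.

(** * Small values of polynomials *)

Section SmallBall.
Context {R : realType}.

Lemma avg_bool (T : finType) (b : pred T) :
  avg (fun x => (b x)%:R : R) = #|b|%:R / #|T|%:R.
Proof.
rewrite /avg mulrC -natr_sum -sum1_card; congr (_%:R * _).
by rewrite [RHS]big_mkcond/=; apply: eq_bigr => x _; rewrite unfold_in; case: (b x).
Qed.

Lemma pow2_inv_small (e : R) : 0 < e ->
  exists n0, forall n, (n0 <= n)%N -> (2 ^+ n)^-1 <= e.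
Proof.
move=> e0; exists (Num.truncn e^-1).+1 => n nn.
rewrite -[leRHS]invrK lef_pV2 ?posrE ?exprn_gt0 ?invr_gt0//.
rewrite (le_trans (ltW (truncnS_gt _)))// -natrX ler_nat (leq_trans nn)//.
by rewrite ltnW// ltn_expl.
Qed.

Lemma avg_pt_near n (j0 : 'I_(2 ^ n)) (r : R) : 0 <= r ->
  avg (fun j : 'I_(2 ^ n) => (`|pt n j - pt n j0| < r)%R%:R : R) <= r + (2 ^+ n)^-1.
Proof.
move=> r0; have p2 : 0 < 2 ^+ n :> R by rewrite exprn_gt0.
rewrite avg_bool card_ord natrX ler_pdivrMr// mulrDl mulVf ?gt_eqF//.
(* Midpoints are 2 / 2^n apart, so at most [T] of them lie on each side of [pt n j0]. *)
pose T := Num.truncn (r * 2 ^+ n / 2).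
have rT : (2 * T + 1)%:R <= r * 2 ^+ n + 1 :> R.
  rewrite natrD natrM lerD2r mulrC -ler_pdivlMr//.
  by rewrite /T truncn_le// divr_ge0// mulr_ge0// ltW.
rewrite (le_trans _ rT)// ler_nat.
have <- : size (iota (j0 - T) (2 * T + 1)) = (2 * T + 1)%N by rewrite size_iota.
rewrite cardE -(size_map val); apply: uniq_leq_size.
  by rewrite map_inj_uniq ?enum_uniq//; exact: val_inj.
move=> a /mapP[j]; rewrite mem_enum unfold_in => jr ->{a}.
rewrite mem_iota /=.
have rS : r * 2 ^+ n / 2 < T.+1%:R by exact: truncnS_gt.
have near a b : pt n a - pt n b < r :> R -> (a < b + T.+1)%N.
  move=> abr; rewrite -(ltr_nat R) natrD -ltrBlDl (le_lt_trans _ rS)//.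
  rewrite ler_pdivlMr// -ler_pdivrMr// (le_trans _ (ltW abr))//.
  rewrite le_eqVlt; apply/orP; left; apply/eqP.
  have eN m : (2 * m + 1)%:R = 2 * m%:R + 1 :> R by rewrite natrD natrM.
  by rewrite /pt !eN; field; rewrite gt_eqF.
have {}jr : `|pt n j - pt n j0 : R| < r by [].
move: jr; rewrite ltr_norml => /andP[jr1 jr2].
have h1 := near _ _ jr2.
have h2 : (j0 < j + T.+1)%N by apply: near; lra.
by apply/andP; split; lia.
Qed.

(** Induction on the degree. If [q] is small at a grid point x0, divide q - q(x0) by X - x0: the
    quotient keeps the top coefficient, so it is rarely small, and [q] is small only near x0 or
    where the quotient is. Only the top coefficient enters, so [h] is uniform over [q]. *)
Lemma poly_small_values K (c e : R) : 0 < c -> 0 < e ->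
  exists2 h : R, 0 < h & exists n0, forall n, (n0 <= n)%N ->
    forall q : {poly R}, (size q <= K.+1)%N -> c <= `|q`_K| ->
      avg (fun j : 'I_(2 ^ n) => (`|q.[pt n j]| <= h)%R%:R : R) <= e.
Proof.
elim: K c e => [|K IHK] c e c0 e0.
  exists (c / 2); first exact: divr_gt0.
  exists 0%N => n _ q /size1_polyC -> cq.
  rewrite [X in X <= _](_ : _ = 0) ?ltW// /avg big1 ?mulr0// => j _.
  rewrite hornerC; rewrite coefC /= in cq.
  by case: lerP => //= cq2; lra.
have [h h0 [n0 hn]] := IHK c (e / 2) c0 (divr_gt0 e0 (ltr0Sn R 1)).
have [n1 hn1] := @pow2_inv_small (e / 4) (divr_gt0 e0 (ltr0Sn R 3)).
exists (h * (e / 4) / 2); first by rewrite !mulr_gt0.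
exists (maxn n0 n1) => n; rewrite geq_max => /andP[nn0 nn1] q sq cq.
set k := h * (e / 4) / 2.
have [/existsP[j0 qj0]|] := boolP [exists j : 'I_(2 ^ n), `|q.[pt n j]| <= k];
    last first.
  rewrite negb_exists => /forallP small.
  rewrite [X in X <= _](_ : _ = 0) ?ltW// /avg big1 ?mulr0// => j _.
  by rewrite (negbTE (small j)).
have : root (q - q.[pt n j0]%:P) (pt n j0).
  by rewrite /root hornerD hornerN hornerC subrr.
move=> /factor_theorem[q1 qE].
have {qE} qE : q = q1 * ('X - (pt n j0)%:P) + q.[pt n j0]%:P by rewrite -qE subrK.
have sq1 : (size q1 <= K.+1)%N.
  have [->|q10] := eqVneq q1 0; first by rewrite size_poly0.
  move: sq; rewrite qE size_polyDl size_Mmonic ?monicXsubC// size_XsubC addn2//=.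
  by rewrite (leq_ltn_trans (size_polyC_leq1 _))// !ltnS lt0n size_poly_eq0.
have cq1 : c <= `|q1`_K|.
  move: cq; rewrite {1}qE coefD coefC /= addr0 mulrBr coefB coefMX /= coefMC.
  by rewrite (nth_default _ sq1) mul0r subr0.
have := hn n nn0 q1 sq1 cq1; have := @avg_pt_near n j0 (e / 4) (ltW (divr_gt0 e0 (ltr0Sn R 3))).
have := hn1 n nn1 => h1 h2 h3.
suff : avg (fun j : 'I_(2 ^ n) => (`|q.[pt n j]| <= k)%R%:R : R) <=
    avg (fun j : 'I_(2 ^ n) => (`|pt n j - pt n j0| < e / 4)%R%:R : R) +
    avg (fun j : 'I_(2 ^ n) => (`|q1.[pt n j]| <= h)%R%:R : R) by lra.
rewrite -avgD; apply: avg_le => j.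
have [qj|_] := boolP (`|q.[pt n j]| <= k); last by rewrite addr_ge0.
have [//|far] := ltP; first by rewrite lerDl.
rewrite add0r; suff -> : `|q1.[pt n j]| <= h by [].
have : `|q1.[pt n j]| * (e / 4) <= h * (e / 4).
  rewrite (le_trans (ler_wpM2l _ far))//.
  have -> : h * (e / 4) = k + k by rewrite /k; field.
  rewrite -normrM (_ : _ * _ = q.[pt n j] - q.[pt n j0]); last first.
    by rewrite {1}qE hornerD hornerM hornerXsubC hornerC addrK.
  by rewrite (le_trans (ler_normB _ _))// lerD.
by rewrite ler_pM2r// divr_gt0.
Qed.

Lemma polyfun_coefs (I : eqType) k i (f : (I -> R) -> R) : polyfun k f ->
  exists F : (I -> R) -> {poly R},
    [/\ forall m, polyfun k (fun x => (F x)`_m),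
        forall x, (size (F x) <= k.+1)%N &
        forall x t, f (upd x i t) = (F x).[t]].
Proof.
elim=> {k f} [k a|k f g _ [F [pF sF fF]] _ [G [pG sG gG]]|k j f _ [F [pF sF fF]]].
- exists (fun=> a%:P); split=> [m|x|x t].
  + exact: polyfun_cst.
  + by rewrite (leq_trans (size_polyC_leq1 _)).
  + by rewrite hornerC.
- exists (fun x => F x + G x); split=> [m|x|x t].
  + by apply: polyfun_ext (polyfun_add (pF m) (pG m)) => x; rewrite coefD.
  + by rewrite (leq_trans (size_polyD _ _))// geq_max sF sG.
  + by rewrite hornerD fF gG.
- have [ji|ji] := eqVneq j i.
    exists (fun x => F x * 'X); split=> [[|m]|x|x t].
    + by apply: polyfun_ext (polyfun_cst _ _ 0) => x; rewrite coefMX.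
    + by apply: polyfun_ext (polyfunW (leqnSn k) (pF m)) => x; rewrite coefMX.
    + by rewrite (leq_trans (size_polyMleq _ _))// size_polyX addn2 /= ltnS.
    + by rewrite hornerMX fF /upd ji eqxx mulrC.
  exists (fun x => x j *: F x); split=> [m|x|x t].
  + by apply: polyfun_ext (polyfun_mulX j (pF m)) => x; rewrite coefZ.
  + by rewrite (leq_trans (size_scale_leq _ _))// (leq_trans (sF x)).
  + by rewrite hornerZ fF /upd (negbTE ji).
Qed.

Lemma poly_ext (p q : {poly R}) : (forall t, p.[t] = q.[t]) -> p = q.
Proof.
move=> pq; apply/eqP; rewrite -subr_eq0; apply/eqP.
apply: (@roots_geq_poly_eq0 _ _ [seq i%:R | i <- iota 0 (size (p - q))]).
- by apply/allP => t _; rewrite rootE hornerD hornerN pq subrr.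
- by rewrite map_inj_uniq ?iota_uniq// => a b /eqP; rewrite eqr_nat => /eqP.
- by rewrite size_map size_iota.
Qed.

(** Induction on the coordinates. In coordinate [i], the highest coefficient that is not identically
    0 is a polynomial function of the others: by induction it exceeds some [c] outside mass e / 2,
    and there the one-variable bound costs another e / 2. *)
Lemma polyfun_small_values (I : finType) k (f : (I -> R) -> R) :
  polyfun k f -> (exists x, f x != 0) -> forall e : R, 0 < e ->
  exists2 h : R, 0 < h & exists n0, forall n, (n0 <= n)%N ->
    avg (fun g : {ffun I -> 'I_(2 ^ n)} => (`|f (gpt g)| <= h)%R%:R : R) <= e.
Proof.
move=> pf f0 e e0.
suff [h h0 [n0 hn]] : exists2 h : R, 0 < h & exists n0, forall n, (n0 <= n)%N ->
    forall x, grid_ops n (enum I) (fun x => (`|f x| <= h)%R%:R) x <= e.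
  exists h => //; exists n0 => n nn.
  rewrite -(avg_grid_ops n (enum I) (fun x => (`|f x| <= h)%R%:R)).
  rewrite (le_trans (avg_le (fun g => hn n nn (gpt g))))//.
  by rewrite avg_cst// grid_gt0.
(* The induction needs a bound at every [x], for a function depending only on the coordinates of the
   list. *)
have : forall x y, (forall j, j \in enum I -> x j = y j) -> f x = f y.
  by move=> x y xy; congr f; apply/funext => j; apply: xy; rewrite mem_enum.
elim: (enum I) k f pf f0 e e0 => [|i l IHl] k f pf [x0 f0] e e0 fl.
  exists (`|f x0| / 2); first by rewrite divr_gt0// normr_gt0.
  exists 0%N => n _ x /=; rewrite (fl x x0)//.
  suff /negbTE -> : ~~ (`|f x0| <= `|f x0| / 2) by exact: ltW.
  by rewrite -ltNge; have : 0 < `|f x0| by [rewrite normr_gt0]; lra.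
have [F [pF sF fF]] := polyfun_coefs i pf.
have F_ext x y : (forall j, j \in l -> x j = y j) -> F x = F y.
  move=> xy; apply: poly_ext => t; rewrite -!fF; apply: fl => j.
  by rewrite inE /upd; case: eqP => //= _; exact: xy.
pose top m := `[< exists x, (F x)`_m != 0 >].
have ex_top : exists m, top m.
  have : F x0 != 0.
    apply: contra f0 => /eqP F0; rewrite -(fl (upd x0 i (x0 i))).
      by rewrite fF F0 horner0.
    by move=> j _; rewrite /upd; case: eqP => // ->.
  by rewrite -lead_coef_eq0 => Fx0; exists (size (F x0)).-1; apply/asboolP; exists x0.
have top_le m : top m -> (m <= k)%N.
  move=> /asboolP[x Fx]; rewrite -ltnS (leq_trans _ (sF x))// ltnNge.
  by apply: contra Fx => /(nth_default 0)/eqP.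
case: (ex_maxnP ex_top top_le) => K /asboolP ntop max_top.
have sFK x : (size (F x) <= K.+1)%N.
  apply/leq_sizeP => m Km; apply/eqP; apply: contraLR Km => Fxm.
  by rewrite -ltnNge ltnS; apply: max_top; apply/asboolP; exists x.
have FK_ext x y : (forall j, j \in l -> x j = y j) -> (F x)`_K = (F y)`_K.
  by move=> xy; rewrite (F_ext x y).
have [c c0 [n0 hn0]] := IHl _ _ (pF K) ntop (e / 2) (divr_gt0 e0 (ltr0Sn R 1)) FK_ext.
have [h h0 [n1 hn1]] := @poly_small_values K c (e / 2) c0 (divr_gt0 e0 (ltr0Sn R 1)).
exists h => //; exists (maxn n0 n1) => n; rewrite geq_max => /andP[nn0 nn1] x /=.
have step y : grid_op n i (fun x => (`|f x| <= h)%R%:R) y <=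
    (`|(F y)`_K| <= c)%R%:R + e / 2.
  case: (lerP `|(F y)`_K| c) => [_|cF] /=.

    apply: (@le_trans _ _ (1 : R)); last by rewrite lerDl divr_ge0 ?ltW.
    rewrite -[leRHS](@avg_cst R 'I_(2 ^ n)) ?card_ord ?expn_gt0//.
    by apply: avg_le => j; rewrite lern1 leq_b1.
  rewrite add0r (le_trans _ (hn1 n nn1 (F y) (sFK y) (ltW cF)))//.
  by apply: avg_le => j; rewrite fF.
rewrite (le_trans (grid_ops_le n l step x))// grid_opsD.
by have := hn0 n nn0 x; lra.
Qed.

End SmallBall.

(** * The Legendre system *)

Section HalfIntegral.
Context {R : realType}.
Implicit Types (p q r : {poly R}).

Definition prim q : {poly R} := \poly_(i < (size q).+1) (q`_i.-1 / i%:R).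

(* The mean of q over [-1, 1], computed from a primitive. *)
Definition half_int q : R := ((prim q).[1] - (prim q).[-1]) / 2.

Lemma coef_prim q i : (prim q)`_i = q`_i.-1 / i%:R.
Proof.
rewrite coef_poly; case: ltnP => // qi.
by rewrite nth_default ?mul0r//; case: i qi.
Qed.

Lemma deriv_prim q : (prim q)^`() = q.
Proof.
apply/polyP => i; by rewrite coef_deriv coef_prim /= -[_ *+ i.+1]mulr_natr mulfVK.
Qed.

Lemma prim_deriv q : prim q^`() = q - (q`_0)%:P.
Proof.
apply/polyP => -[|i]; rewrite coef_prim coefB coefC/=.
  by rewrite invr0 mulr0 subrr.
by rewrite coef_deriv subr0 -[_ *+ i.+1]mulr_natr mulfK.
Qed.

Lemma half_intD p q : half_int (p + q) = half_int p + half_int q.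
Proof.
rewrite /half_int (_ : prim (p + q) = prim p + prim q); last first.
  by apply/polyP => i; rewrite coefD !coef_prim coefD mulrDl.
by rewrite !hornerD; field.
Qed.

Lemma half_intZ c q : half_int (c *: q) = c * half_int q.
Proof.
rewrite /half_int (_ : prim (c *: q) = c *: prim q); last first.
  by apply/polyP => i; rewrite coefZ !coef_prim coefZ mulrA.
by rewrite !hornerZ; field.
Qed.

Lemma half_int_deriv q : half_int q^`() = (q.[1] - q.[-1]) / 2.
Proof. by rewrite /half_int prim_deriv !hornerD !hornerN !hornerC; field. Qed.

Lemma half_int_by_parts p q : half_int (p^`() * q) =
  (p.[1] * q.[1] - p.[-1] * q.[-1]) / 2 - half_int (p * q^`()).
Proof. by rewrite -!hornerM -half_int_deriv derivM half_intD addrK. Qed.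

Lemma Rintegral_half_int q :
  (\int[@lebesgue_measure R]_(t in `[-1, 1]) (q.[t] / 2))%R = half_int q.
Proof.
rewrite /Rintegral.
rewrite (@continuous_FTC2 R (fun t => q.[t] / 2) (fun t => (2^-1 *: prim q).[t]) (-1) 1).
- by rewrite -EFinB/= !hornerZ /half_int; field.
- exact: ltN11.
- apply: continuous_subspaceT => x; apply: cvgM; last exact: cvg_cst.
  exact: continuous_horner.
- split=> /=.
  + by move=> x _; exact: derivable_horner.
  + by apply: cvg_at_right_filter; exact: continuous_horner.
  + by apply: cvg_at_left_filter; exact: continuous_horner.
- move=> x _; rewrite -derivE derivZ deriv_prim hornerZ.
  by rewrite mulrC.
Qed.

Lemma horner_taylor1 p : exists2 C : R, 0 <= C & forall t h,
  `|t| <= 1 -> `|h| <= 1 -> `|p.[t + h] - p.[t] - h * p^`().[t]| <= C * h ^+ 2.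
Proof.
elim/poly_ind: p => [|p c [C C0 Cp]].
  by exists 0 => // t h _ _; rewrite deriv0 !horner0 mulr0 !subrr normr0 mul0r.
have [D D0 Dp] := polyfun_bounded (polyfun_horner tt (leqnSn (size p^`()))).
exists (2 * C + D); first by rewrite addr_ge0// mulr_ge0.
move=> t h t1 h1.
rewrite derivMXaddC !hornerMXaddC hornerD hornerMX.
have -> : p.[t + h] * (t + h) + c - (p.[t] * t + c) - h * (p.[t] + p^`().[t] * t)
  = (t + h) * (p.[t + h] - p.[t] - h * p^`().[t]) + h ^+ 2 * p^`().[t] by ring.
rewrite (le_trans (ler_normD _ _))// (normrM (t + h)) (normrM (h ^+ 2)).
rewrite (mulrDl (2 * C) D) lerD//.
  rewrite -mulrA ler_pM// ?Cp// (le_trans (ler_normD _ _))//.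
  by rewrite -[2]/(1 + 1) lerD.
rewrite mulrC (ger0_norm (sqr_ge0 h)) ler_wpM2r ?sqr_ge0//.
exact: (Dp (fun=> t)).
Qed.

(** The midpoint rule. The primitive telescopes over the cells, and its Taylor expansion at each
    midpoint leaves an error of order h^2 per cell, hence h in total, where [h] is half the width of
    a cell. *)
Lemma avg_pt_half_int q : exists2 C : R, 0 <= C & forall n,
  `|avg (fun j : 'I_(2 ^ n) => q.[pt n j]) - half_int q| <= C * (2 ^+ n)^-1.
Proof.
have [C C0 CQ] := horner_taylor1 (prim q).
exists C => // n; set h : R := (2 ^+ n)^-1.
have p2 : 0 < 2 ^+ n :> R by rewrite exprn_gt0.
have h0 : 0 < h by rewrite invr_gt0.
have h1 : h <= 1 by rewrite invf_le1// exprn_ege1// ler1n.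
pose a (j : nat) : R := 2 * j%:R * h - 1.
have aE (j : nat) : pt n j - h = a j.
  by rewrite /pt /a natrD natrM -/h mulrDl mul1r; ring.
have aSE (j : nat) : pt n j + h = a j.+1.
  by rewrite /pt /a -natr1 natrD natrM -/h; ring.
have -> : half_int q = 2^-1 * \sum_(j < 2 ^ n) ((prim q).[pt n j + h] - (prim q).[pt n j - h]).
  rewrite /half_int mulrC; congr (_ * _).
  under eq_bigr do rewrite aE aSE.
  rewrite -(big_mkord predT (fun j => (prim q).[a j.+1] - (prim q).[a j])).
  rewrite telescope_sumr// /a mulr0 mul0r sub0r natrX mulfK ?gt_eqF//.
  by congr (_.[_] - _); ring.
rewrite /avg card_ord natrX -/h.
have -> : h * (\sum_(j < 2 ^ n) q.[pt n j]) - 2^-1 *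
   (\sum_(j < 2 ^ n) ((prim q).[pt n j + h] - (prim q).[pt n j - h])) =
  2^-1 * \sum_(j < 2 ^ n) (2 * h * q.[pt n j]
     - ((prim q).[pt n j + h] - (prim q).[pt n j - h])).
  by rewrite [in RHS]sumrB -mulr_sumr; field.
rewrite normrM ger0_norm ?invr_ge0//.
rewrite (le_trans (ler_wpM2l _ (ler_norm_sum _ _ _))) ?invr_ge0//.
rewrite (@le_trans _ _ (2^-1 * \sum_(j < 2 ^ n) (2 * (C * h ^+ 2))))//.
  rewrite ler_wpM2l ?invr_ge0// ler_sum// => j _.
  have t1 := CQ (pt n j) h (pt_bound j).
  have t2 := CQ (pt n j) (- h) (pt_bound j).
  rewrite deriv_prim normrN ger0_norm ?(ltW h0)// in t1 t2.
  have {}t1 := t1 h1; have {}t2 := t2 h1; rewrite sqrrN in t2.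
  set u := _ - _ - _ in t1; set v := _ - _ - _ in t2.
  have -> : 2 * h * q.[pt n j] - ((prim q).[pt n j + h] - (prim q).[pt n j - h])
     = v - u by rewrite /u /v; ring.
  by rewrite (le_trans (ler_normB _ _))//; lra.
rewrite sumr_const card_ord -[_ *+ (2 ^ n)]mulr_natl natrX.
rewrite le_eqVlt; apply/orP; left; apply/eqP.
by rewrite /h; field; rewrite gt_eqF.
Qed.

End HalfIntegral.

(** * Legendre polynomials: orthogonality, norms and sup bounds *)

Section Legendre.
Context {R : realType}.
Implicit Types (p q : {poly R}).

Lemma derivn_mul p q n :
  (p * q)^`(n) = \sum_(i < n.+1) (p^`(i) * q^`(n - i)) *+ 'C(n, i).
Proof.
elim: n => [|n IHn]; first by rewrite big_ord1 bin0 mulr1n.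
rewrite derivnS IHn linear_sum /=.
rewrite (eq_bigr (fun i : 'I_n.+1 => (p^`(i.+1) * q^`(n.+1 - i.+1)) *+ 'C(n, i)
   + (p^`(i) * q^`(n.+1 - i)) *+ 'C(n, i))); last first.
  move=> i _; rewrite derivMn derivM mulrnDl -!derivnS subSS.
  by rewrite subSn// -ltnS.
rewrite big_split/= [in RHS]big_ord_recl.
rewrite [in X in _ + X]big_ord_recl/= !bin0 addrCA; congr (_ + _).
rewrite [X in _ = X](eq_bigr (fun i : 'I_n.+1 =>
    (p^`(i.+1) * q^`(n.+1 - i.+1)) *+ 'C(n, i) +
    (p^`(i.+1) * q^`(n.+1 - i.+1)) *+ 'C(n, i.+1))); last first.
  by move=> i _; rewrite /bump /= add1n binS mulrnDr addrC.
rewrite big_split/=; congr (_ + _).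
rewrite [in RHS]big_ord_recr/= bin_small// mulr0n addr0.
by apply: eq_bigr => i _; rewrite /bump /= add1n.
Qed.

Lemma derivn_XsubC_exp (a : R) k n :
  (('X - a%:P) ^+ k)^`(n) = ('X - a%:P) ^+ (k - n) *+ k ^_ n.
Proof.
elim: n => [|n IHn]; first by rewrite subn0 ffactn0.
rewrite derivnS IHn derivMn deriv_exp derivXsubC mul1r -mulrnA -subnS.
by congr (_ *+ _); rewrite ffactnSr mulnC.
Qed.

Lemma legendre_weightE k : ('X ^+ 2 - 1) ^+ k =
  ('X - 1%:P) ^+ k * ('X - (-1)%:P) ^+ k :> {poly R}.
Proof. by rewrite -exprMn; congr (_ ^+ _); rewrite polyCN; ring. Qed.

Lemma root_legendre_weight k n a : (n < k)%N -> a \in [:: 1; -1] ->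
  (('X ^+ 2 - 1) ^+ k)^`(n).[a] = 0 :> R.
Proof.
move=> nk a1; rewrite legendre_weightE derivn_mul horner_sum big1// => i _.
rewrite hornerMn hornerM !derivn_XsubC_exp !hornerMn !horner_exp !hornerXsubC.
move: a1; rewrite !inE => /orP[]/eqP->.
  have ik : (i < k)%N by rewrite (leq_ltn_trans _ nk)// -ltnS.
  by rewrite subrr expr0n subn_eq0 leqNgt ik /= !mul0rn mul0r mul0rn.
rewrite subrr [_ ^+ (k - (n - i))]expr0n subn_eq0 leqNgt.
by rewrite (leq_ltn_trans (leq_subr _ _) nk)/= mul0rn mulr0 mul0rn.
Qed.

(** The Leibniz rule in Rodrigues' formula, with (X - 1)^k (X + 1)^k; the falling factorials and the
    binomial combine to k! C(k, i)^2. *)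
Lemma legendre_horner k t : (legendre R k).[t] =
  (2 ^+ k)^-1 * \sum_(i < k.+1) 'C(k, i)%:R ^+ 2 * ((t - 1) ^+ (k - i) * (t + 1) ^+ i).
Proof.
rewrite /legendre hornerZ legendre_weightE derivn_mul horner_sum.
rewrite invfM -mulrA; congr (_ * _); rewrite mulr_sumr; apply: eq_bigr => i _.
rewrite hornerMn hornerM !derivn_XsubC_exp !hornerMn !horner_exp !hornerXsubC.
have ik : (i <= k)%N by rewrite -ltnS.
have mulE (A B : R) a b c : (A *+ a) * (B *+ b) *+ c = (a * b * c)%:R * (A * B).
  by rewrite !natrM -(mulr_natr A) -(mulr_natr B) -[_ *+ c]mulr_natr; ring.
rewrite subKn// opprK mulE [LHS]mulrA; congr (_ * _).
have kf : k`!%:R != 0 :> R by rewrite pnatr_eq0 -lt0n fact_gt0.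
apply: (mulfI kf); rewrite mulrA divff// mul1r -natrX -natrM; congr (_%:R).
rewrite -!bin_ffact bin_sub// -(bin_fact ik); ring.
Qed.

Lemma legendre1 k : (legendre R k).[1] = 1.
Proof.
rewrite legendre_horner big_ord_recr/= big1 ?add0r => [|i _].
  by rewrite binn subnn expr1n !mul1r mulVf// expf_neq0.
by rewrite subrr expr0n subn_eq0 leqNgt ltn_ord mul0r mulr0.
Qed.

Lemma legendreN1 k : (legendre R k).[-1] ^+ 2 = 1.
Proof.
rewrite legendre_horner big_ord_recl/= big1 ?addr0 => [|i _].
  rewrite bin0 subn0 expr1n mul1r mulr1 -opprD exprNn -[1 + 1]/(2 : R).
  by rewrite mulrCA mulVf ?expf_neq0// mulr1 sqrr_sign.
by rewrite addNr [_ ^+ bump _ _]expr0n/= !mulr0.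
Qed.

Lemma bin_le_pow2 n i : ('C(n.+1, i) <= 2 ^ n)%N.
Proof.
elim: n i => [|n IHn] [|i]; rewrite ?bin0 ?expn_gt0//; first by case: i => [|[]].
by rewrite binS expnS mul2n -addnn leq_add.
Qed.

(** One factor of C(k+1, i)^2 is at most 2^k, and the binomial theorem for (1 - t) + (t + 1) = 2
    cancels the prefactor 2^-(k+1). Cruder than the sharp bound 1, but enough for
    [psi_sqr_bound]. *)
Lemma legendre_bound k t : `|t| <= 1 -> `|(legendre R k.+1).[t]| <= 2 ^+ k.
Proof.
rewrite ler_norml => /andP[t1 t2]; rewrite legendre_horner normrM.
rewrite ger0_norm ?invr_ge0 ?exprn_ge0// mulrC ler_pdivrMr ?exprn_gt0//.
rewrite (le_trans (ler_norm_sum _ _ _))//.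
apply: (@le_trans _ _ (\sum_(i < k.+2) 2 ^+ k *
    ((1 - t) ^+ (k.+1 - i) * (t + 1) ^+ i *+ 'C(k.+1, i)))); last first.
  by rewrite -mulr_sumr -exprDn ler_wpM2l ?exprn_ge0//; rewrite le_eqVlt;
     apply/orP; left; apply/eqP; congr (_ ^+ _); ring.
apply: ler_sum => i _; rewrite !normrM !normrX distrC.
rewrite (ger0_norm (_ : 0 <= 1 - t)) ?subr_ge0//.
rewrite (ger0_norm (_ : 0 <= t + 1)); last by rewrite -lerBlDr sub0r.
rewrite normr_nat -[(_ * _) *+ _]mulr_natl [leRHS]mulrA.
rewrite ler_wpM2r ?mulr_ge0 ?exprn_ge0 ?subr_ge0// -?lerBlDr ?sub0r//.
by rewrite ler_wpM2r// -natrX ler_nat bin_le_pow2.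
Qed.

Lemma size_legendre k : (size (legendre R k) <= k.+1)%N.
Proof.
rewrite (leq_trans (size_scale_leq _ _))//; apply/leq_sizeP => j kj.
rewrite coef_derivn nth_default ?mul0rn// legendre_weightE -exprMn.
rewrite (leq_trans (size_poly_exp_leq _ _))//.
by rewrite size_Mmonic ?monicXsubC ?polyXsubC_eq0// !size_XsubC /=; lia.
Qed.

Lemma half_int_by_parts_iter (w : {poly R}) k j q : (j <= k)%N ->
  (forall n, (n < k)%N -> w^`(n).[1] = 0 /\ w^`(n).[-1] = 0) ->
  half_int (w^`(k) * q) = (-1) ^+ j * half_int (w^`(k - j) * q^`(j)).
Proof.
move=> jk w0; elim: j jk => [|j IHj] jk; first by rewrite expr0 mul1r subn0.
have [w1 wN1] : w^`(k - j.+1).[1] = 0 /\ w^`(k - j.+1).[-1] = 0.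
  by apply: w0; rewrite ltn_subrL (leq_ltn_trans _ jk).
rewrite (IHj (ltnW jk)) -(subnSK jk) (derivnS w) half_int_by_parts w1 wN1.
by rewrite !mul0r subrr mul0r sub0r exprS mulN1r mulrN mulNr (derivnS q).
Qed.

Lemma half_int_legendre_ortho k q : (size q <= k)%N ->
  half_int (legendre R k * q) = 0.
Proof.
move=> sq; rewrite /legendre -scalerAl half_intZ.
rewrite (half_int_by_parts_iter _ (leqnn k)); last first.
  by move=> n nk; rewrite !root_legendre_weight ?inE ?eqxx ?orbT.
by rewrite (derivn_poly0 sq) mulr0 -(scale0r 0) half_intZ mul0r !mulr0.
Qed.

(** The mean of (t P^2)' = P^2 + 2 P t P' is 1, because P(1)^2 = P(-1)^2 = 1. As t P' - k P has
    degree below k, orthogonality turns this mean into (2 k + 1) times that of P^2. *)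
Lemma half_int_legendre_sqr k : half_int (legendre R k * legendre R k) = (2 * k + 1)%:R^-1.
Proof.
move: (legendre1 k) (legendreN1 k) (size_legendre k) (@half_int_legendre_ortho k).
move: (legendre R k) => P P1 PN1 sP orthoP.
have kn0 : (2 * k + 1)%:R != 0 :> R by rewrite addn1 pnatr_eq0.
apply: (mulfI kn0); rewrite divff//.
have := half_int_deriv ('X * (P * P)).
rewrite !hornerM !hornerX P1 (_ : P.[-1] * P.[-1] = 1); last first.
  by rewrite -expr2 PN1.
rewrite (_ : ('X * (P * P))^`() = P * P + (2%:R : R) *: (P * ('X * P^`()))); last first.
  by rewrite !derivM derivX scaler_nat; ring.
pose r := 'X * P^`() - k%:R *: P.
have sr : (size r <= k)%N.
  apply/leq_sizeP => j kj; rewrite coefB coefXM coefZ.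
  case: j kj => [|j] kj.
    by move: kj; rewrite leqn0 => /eqP k0; rewrite /= k0 mul0r subrr.
  rewrite /= coef_deriv -[_ *+ j.+1]mulr_natl -mulrBl.
  move: kj; rewrite leq_eqVlt => /orP[/eqP->|kj]; first by rewrite subrr mul0r.
  by rewrite (nth_default 0 (leq_trans sP kj)) mulr0.
have -> : 'X * P^`() = r + k%:R *: P by rewrite subrK.
rewrite mulrDr half_intD half_intZ half_intD (orthoP _ sr) add0r.
rewrite -(scalerAr k%:R P P) half_intZ => h.
by rewrite natrD natrM mulrDl mul1r addrC -mulrA h; field.
Qed.

Lemma psiE k : psi R k = Num.sqrt (2 * k + 1)%:R *: legendre R k.
Proof.
rewrite /psi; congr (_ *: _).
under eq_Rintegral do rewrite -horner_exp.
rewrite Rintegral_half_int expr2 half_int_legendre_sqr sqrtrV ?invrK//.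
Qed.

Lemma size_psi k : (size (psi R k) <= k.+1)%N.
Proof. by rewrite (leq_trans (size_scale_leq _ _))// size_legendre. Qed.

Lemma half_int_psi j k : half_int (psi R j * psi R k) = (j == k)%:R.
Proof.
rewrite !psiE -scalerAl -scalerAr !half_intZ.
case: (ltngtP j k) => [jk|kj|->].
- rewrite (mulrC (legendre R j)) half_int_legendre_ortho ?mulr0//.
  exact: leq_trans (size_legendre j) jk.
- rewrite half_int_legendre_ortho ?mulr0//.
  exact: leq_trans (size_legendre k) kj.
- by rewrite half_int_legendre_sqr mulrA -expr2 sqr_sqrtr// divff//.
Qed.

(** By (2 k + 3) 4^k <= 9^(k+1). The resulting sup bound 9^p for squared basis functions equals the
    Bonami constant, so both tails have exponents of the same form. *)
Lemma psi_sqr_bound k t : `|t| <= 1 -> (psi R k).[t] ^+ 2 <= 9 ^+ k.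
Proof.
move=> t1; rewrite psiE hornerZ exprMn sqr_sqrtr//.
case: k => [|k].
  by rewrite legendre_horner big_ord1 bin0 subn0 !expr0 invr1 !mulr1 expr1n.
have := legendre_bound k t1; rewrite -ler_sqr ?nnegrE ?exprn_ge0// real_normK ?num_real// => h.
rewrite (le_trans (ler_wpM2l _ h))//.
rewrite -exprM mulnC exprM -!natrX -natrM ler_nat.
elim: k {h} => // k IHk; rewrite (expnS 9 k.+1) (expnS _ k).
rewrite (leq_trans _ (leq_mul (leqnn 9) IHk))// !mulnA leq_mul2r.
by apply/orP; right; lia.
Qed.

End Legendre.

Section LegendreSystem.
Context {R : realType} (p d : nat).

Definition phi (j : 'I_#|Lambda p d|) (x : 'I_d -> R) : R :=
  \prod_(i < d) (psi R (tnth (enum_val j : multi_index p d) i)).[x i].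

Lemma sum_Lambda (j : 'I_#|Lambda p d|) :
  (\sum_(i < d) tnth (enum_val j : multi_index p d) i <= p)%N.
Proof. by have := enum_valP j; rewrite inE big_tuple. Qed.

Lemma polyfun_phi j : polyfun p (phi j).
Proof.
apply: polyfunW (sum_Lambda j) _; apply: polyfun_prod => i.
exact: polyfun_horner (size_psi _).
Qed.

Lemma phi_sqr_bound j x : (forall i, `|x i| <= 1) -> phi j x ^+ 2 <= 9 ^+ p.
Proof.
move=> x1; rewrite /phi -prodrXl.
rewrite (@le_trans _ _ (\prod_(i < d) 9 ^+ tnth (enum_val j : multi_index p d) i))//.
  by apply: ler_prod => i _; rewrite sqr_ge0 psi_sqr_bound.
by rewrite prodrXr ler_eXn2l ?ltr1n// sum_Lambda.
Qed.

(** Grid averages of products over the coordinates factor, so the midpoint rule in each coordinate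
    carries orthonormality over, up to an error vanishing with the mesh. *)
Lemma phi_gram (e : R) : 0 < e -> \forall n \near \oo, forall j k,
  `|avg (fun g : {ffun 'I_d -> 'I_(2 ^ n)} => phi j (gpt g) * phi k (gpt g))
    - (j == k)%:R| <= e.
Proof.
move=> e0; apply: filter_forall => j; apply: filter_forall => k.
have cvg1 q : avg (fun i : 'I_(2 ^ n) => q.[pt n i] : R) @[n --> \oo] --> half_int q.
  have [C C0 qC] := avg_pt_half_int q.
  apply/cvgrPdist_le => /= h h0.
  have [n0 hn0] := @pow2_inv_small R (h / (C + 1)) (divr_gt0 h0 (ltr_wpDl C0 ltr01)).
  exists n0 => // n /= nn; rewrite distrC (le_trans (qC n))//.
  rewrite (le_trans (ler_wpM2l C0 (hn0 n nn)))//.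
  rewrite mulrCA ger_pMr// ler_pdivrMr ?mul1r ?lerDl ?ltr_wpDl//.
pose q i := psi R (tnth (enum_val j : multi_index p d) i) *
            psi R (tnth (enum_val k : multi_index p d) i).
have avgE n : avg (fun g : {ffun 'I_d -> 'I_(2 ^ n)} => phi j (gpt g) * phi k (gpt g))
    = \prod_(i < d) avg (fun a : 'I_(2 ^ n) => (q i).[pt n a]).
  rewrite -(avg_prod (fun i (a : 'I_(2 ^ n)) => (q i).[pt n a])).
  apply: eq_avg => g; rewrite /phi -big_split; apply: eq_bigr => i _.
  by rewrite /q hornerM.
have limE : \prod_(i < d) half_int (q i) = (j == k)%:R.
  rewrite /q; under eq_bigr do rewrite half_int_psi.
  have [->|jk] := eqVneq j k; first by rewrite big1// => i _; rewrite eqxx.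
  have /existsP[i ji] : [exists i, tnth (enum_val j : multi_index p d) i !=
                                   tnth (enum_val k : multi_index p d) i].
    rewrite -negb_forall; apply: contra jk => /forallP jk; apply/eqP.
    by apply: enum_val_inj; apply: eq_from_tnth => i; apply/eqP; exact: jk.
  by rewrite (bigD1 i)//= (negbTE (ji : nat_of_ord _ != nat_of_ord _)) mul0r.
have cvgP : \prod_(i < d) avg (fun a : 'I_(2 ^ n) => (q i).[pt n a] : R) @[n --> \oo]
   --> \prod_(i < d) half_int (q i).
  by apply: cvg_big => [|i _]; [exact: mul_continuous | exact: cvg1].
move/cvgrPdist_le : cvgP => /(_ e e0); apply: filterS => n.
by rewrite limE avgE distrC.
Qed.

End LegendreSystem.

(** * Tail bounds *)

Section Tails.
Context {R : realType}.

Lemma expR_ge_quadratic (x : R) : 0 <= x -> 1 + x + x ^+ 2 / 2 <= expR x.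
Proof.
move=> x0; have -> : 1 + x + x ^+ 2 / 2 = series (exp_coeff x) 3%N.
  rewrite /series /= big_mkord !big_ord_recr big_ord0 /exp_coeff /=.
  by rewrite expr0 expr1 !divr1 add0r.
apply: nondecreasing_cvgn_le; last exact: is_cvg_series_exp_coeff.
apply/nondecreasing_seqP => n; rewrite /series /= !big_mkord big_ord_recr/=.
by rewrite lerDl exp_coeff_ge0.
Qed.

Lemma expRN_le_quadratic (x : R) : 0 <= x -> expR (- x) <= 1 - x + x ^+ 2 / 2.
Proof.
move=> x0; rewrite expRN -[leRHS]invrK lef_pV2 ?posrE ?expR_gt0//; last first.
  by rewrite invr_gt0; nra.
apply: le_trans (expR_ge_quadratic x0).
rewrite -div1r ler_pdivrMr; nra.
Qed.

(** From 1 - x / 2 <= exp(-x / 2), squared; what remains is 1 - 3 x + x^2 >= 0. *)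
Lemma expR_le_quadratic (x : R) : 0 <= x -> x <= 3^-1 -> expR x <= 1 + x + x ^+ 2.
Proof.
move=> x0 x1; rewrite -[leLHS]invrK -expRN -[leRHS]invrK lef_pV2 ?posrE ?invr_gt0 ?expR_gt0//; last nra.
have -> : - x = - (x / 2) + - (x / 2) by field.
rewrite expRD.
have h : 1 - x / 2 <= expR (- (x / 2)) by exact: expR_ge1Dx.
apply: (@le_trans _ _ ((1 - x / 2) * (1 - x / 2))); last by apply: ler_pM => //; lra.
rewrite -div1r ler_pdivrMr; nra.
Qed.

Lemma chernoff (T : finType) N (h : T -> R) (b l : R) : 0 <= l ->
  avg (fun g : {ffun 'I_N -> T} => (N%:R * b <= \sum_i h (g i))%R%:R : R) <=
  avg (fun x => expR (l * (h x - b))) ^+ N.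
Proof.
move=> l0; rewrite -[X in _ ^+ X]card_ord -prodr_const -avg_prod.
apply: avg_le => g; rewrite -expR_sum.
case: (lerP (N%:R * b) _) => [hb|_]; last exact: expR_ge0.
rewrite -mulr_sumr sumrB sumr_const card_ord.
rewrite -[b *+ _]mulr_natl (le_trans _ (expR_ge1Dx _))//.
by rewrite lerDl mulr_ge0// subr_ge0.
Qed.

(** The quadratic bound on exp(-x) holds for all x >= 0, so nonnegativity and a second moment
    suffice, which is what Bonami provides for h = f^2. *)
Lemma lower_tail (T : finType) N (h : T -> R) (m B t : R) :
  (0 < #|T|)%N -> (forall x, 0 <= h x) -> 0 < m -> 0 < B -> 0 <= t <= 1 ->
  m <= avg h -> avg (fun x => h x ^+ 2) <= B * avg h ^+ 2 ->
  avg (fun g : {ffun 'I_N -> T} => (\sum_i h (g i) <= N%:R * ((1 - t) * m))%R%:R : R)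
  <= expR (- (N%:R * t ^+ 2 / (2 * B))).
Proof.
move=> T0 h0 m0 B0 /andP[t0 t1] mh h2; set a := avg h in mh h2.
have a0 : 0 < a by exact: lt_le_trans mh.
(* This [l] minimises the exponent - l t a + l^2 B a^2 / 2. *)
pose l := t / (B * a); have l0 : 0 <= l by rewrite divr_ge0// mulr_ge0 ?ltW.
have := @chernoff T N (fun x => - h x) (- ((1 - t) * m)) l l0.
have -> : (fun g : {ffun 'I_N -> T} => (N%:R * - ((1 - t) * m) <= \sum_i - h (g i))%R%:R : R)
   = (fun g => (\sum_i h (g i) <= N%:R * ((1 - t) * m))%R%:R).
  by apply/funext => g; rewrite sumrN mulrN lerN2.
move=> /le_trans; apply.
have -> : - (N%:R * t ^+ 2 / (2 * B)) = N%:R * - (t ^+ 2 / (2 * B)) by ring.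
rewrite expRM_natl lerXn2r ?nnegrE ?expR_ge0//.
  by apply: avg_ge0 => x; exact: expR_ge0.
apply: (@le_trans _ _ (avg (fun x => expR (l * ((1 - t) * a)) *
    (1 + (- l * h x + l ^+ 2 / 2 * h x ^+ 2))))).
  apply: avg_le => x; rewrite mulrDr opprK addrC expRD ler_pM ?expR_ge0//.
    by rewrite ler_expR ler_wpM2l// ler_wpM2l// subr_ge0.
  rewrite mulrN (le_trans (expRN_le_quadratic _)) ?(mulr_ge0 l0)//.
  by rewrite le_eqVlt; apply/orP; left; apply/eqP; field.
rewrite avgZ avgD avg_cst// avgD !avgZ -/a.
apply: (@le_trans _ _ (expR (l * ((1 - t) * a)) *
    expR (- l * a + l ^+ 2 / 2 * (B * a ^+ 2)))).
  rewrite ler_wpM2l ?expR_ge0// (le_trans _ (expR_ge1Dx _))// lerD2l lerD2l.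
  by rewrite ler_wpM2l// divr_ge0// sqr_ge0.
rewrite -expRD ler_expR le_eqVlt; apply/orP; left; apply/eqP.
by rewrite /l; field; rewrite !gt_eqF.
Qed.

Lemma upper_tail (T : finType) N (h : T -> R) (B : R) :
  (0 < #|T|)%N -> (forall x, 0 <= h x) -> (forall x, h x <= B) -> 0 < B ->
  avg h <= 101 / 100 -> avg (fun x => h x ^+ 2) <= B * avg h ^+ 2 ->
  avg (fun g : {ffun 'I_N -> T} => (N%:R * (277 / 200) <= \sum_i h (g i))%R%:R : R)
  <= expR (- (N%:R / (32 * B))).
Proof.
move=> T0 h0 hB B0 h1 h2; set a := avg h in h1 h2.
have a0 : 0 <= a by exact: avg_ge0.
(* With l B = 3 / 16 the quadratic bound on exp applies. At mean 1.01 and threshold 1.385 the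
   exponent times [B] is about -0.0344, just below -1 / 32. *)
pose l := 3 / (16 * B); have l0 : 0 <= l by rewrite divr_ge0// mulr_ge0 ?ltW.
apply: le_trans (@chernoff T N h _ l l0) _.
have -> : - (N%:R / (32 * B)) = N%:R * - (32 * B)^-1 by ring.
rewrite expRM_natl lerXn2r ?nnegrE ?expR_ge0//.
  by apply: avg_ge0 => x; exact: expR_ge0.
apply: (@le_trans _ _ (avg (fun x => expR (- (l * (277 / 200))) *
    (1 + (l * h x + l ^+ 2 * h x ^+ 2))))).
  apply: avg_le => x; rewrite mulrBr addrC expRD ler_wpM2l ?expR_ge0//.
  rewrite addrA -exprMn expR_le_quadratic ?(mulr_ge0 l0)//.
  rewrite (le_trans (ler_wpM2l l0 (hB x)))// /l.
  by rewrite (_ : 3 / (16 * B) * B = 3 / 16); [lra|field; rewrite gt_eqF].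
rewrite avgZ avgD avg_cst// avgD !avgZ -/a.
apply: (@le_trans _ _ (expR (- (l * (277 / 200))) * expR (l * a + l ^+ 2 * (B * a ^+ 2)))).
  rewrite ler_wpM2l ?expR_ge0// (le_trans _ (expR_ge1Dx _))// lerD2l lerD2l.
  by rewrite ler_wpM2l// sqr_ge0.
rewrite -expRD ler_expR.
have -> : - (l * (277 / 200)) + (l * a + l ^+ 2 * (B * a ^+ 2)) =
   B^-1 * (- (3 / 16) * (277 / 200) + 3 / 16 * a + 9 / 256 * a ^+ 2).
  by rewrite /l; field; rewrite gt_eqF.
have -> : - (32 * B)^-1 = B^-1 * - (32^-1) by field; rewrite gt_eqF.
rewrite ler_wpM2l ?invr_ge0 ?ltW//; nra.
Qed.

End Tails.

(** * The null space property *)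

Section NullSpace.
Context {R : realType}.

Definition sq (N : nat) (v : 'cV[R]_N) : R := \sum_i v i 0 ^+ 2.

Lemma sq_ge0 N (v : 'cV[R]_N) : 0 <= sq v.
Proof. by apply: sumr_ge0 => i _; exact: sqr_ge0. Qed.

Lemma sqZ N c (v : 'cV[R]_N) : sq (c *: v) = c ^+ 2 * sq v.
Proof. by rewrite /sq mulr_sumr; apply: eq_bigr => i _; rewrite mxE exprMn. Qed.

(** Young's inequality with weights 10 and 1 / 10: [u] will be a small error, while [v] must keep a
    factor close to 1. *)
Lemma sqD_le N (u v : 'cV[R]_N) :
  sq (u + v) <= 101 * sq u + 101 / 100 * sq v.
Proof.
rewrite /sq !mulr_sumr -big_split/=; apply: ler_sum => i _; rewrite mxE.
have := sqr_ge0 (10 * u i 0 - 10^-1 * v i 0); nra.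
Qed.

(** Lagrange's identity: twice the defect is a sum of squares. *)
Lemma sum_CS (J : finType) (P : pred J) (a b : J -> R) :
  (\sum_(j | P j) a j * b j) ^+ 2 <=
  (\sum_(j | P j) a j ^+ 2) * (\sum_(j | P j) b j ^+ 2).
Proof.
rewrite -subr_ge0 -(pmulr_rge0 _ (ltr0Sn R 1)).
have -> : 2%:R * ((\sum_(j | P j) a j ^+ 2) * (\sum_(j | P j) b j ^+ 2) -
   (\sum_(j | P j) a j * b j) ^+ 2) =
   \sum_(j | P j) \sum_(k | P k) (a j * b k - a k * b j) ^+ 2.
  under [RHS]eq_bigr => j _.
    rewrite (eq_bigr (fun k => a j ^+ 2 * b k ^+ 2 + b j ^+ 2 * a k ^+ 2
      + (- 2 * (a j * b j)) * (a k * b k))); last by move=> k _; ring.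
    rewrite !big_split/= -!mulr_sumr; over.
  rewrite !big_split/= -!mulr_suml.
  have -> : \sum_(j | P j) (- 2 * (a j * b j)) = -2 * \sum_(j | P j) a j * b j.
    by rewrite mulr_sumr.
  by ring.
by apply: sumr_ge0 => j _; apply: sumr_ge0 => k _; exact: sqr_ge0.
Qed.

Lemma exists_le_mean (J : finType) (p f : J -> R) (c : R) :
  (forall j, 0 <= p j) -> \sum_j p j = 1 -> \sum_j p j * f j <= c ->
  exists j, f j <= c.
Proof.
move=> p0 p1 pf; apply/not_existsP => h.
have fc j : c < f j by have := h j; rewrite ltNge => /negP.
suff : 0 < \sum_j p j * (f j - c).
  by under eq_bigr do rewrite mulrBr; rewrite sumrB -mulr_suml p1 mul1r; lra.
have [j pj] : exists j, 0 < p j.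
  apply/not_existsP => pn; have := @ltr01 R; rewrite -p1 big1 ?ltxx// => j _.
  by apply/eqP; rewrite eq_le p0 andbT leNgt; apply/negP; exact: pn.
rewrite (bigD1 j)//= ltr_wpDr ?mulr_gt0 ?subr_gt0//.
by apply: sumr_ge0 => i _; rewrite mulr_ge0// subr_ge0 ltW.
Qed.

(* Maurey's empirical method, derandomised: each new sample can be chosen so
   that the squared distance grows by at most the second moment D. *)
Lemma maurey (J : finType) N (x : J -> 'cV[R]_N) (p : J -> R) (D : R) m :
  (forall j, 0 <= p j) -> \sum_j p j = 1 -> (forall j, sq (x j) <= D) ->
  exists s : m.-tuple J,
    sq (\sum_(j <- s) x j - m%:R *: \sum_j p j *: x j) <= m%:R * D.
Proof.
move=> p0 p1 xD; set mu := \sum_j p j *: x j.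
elim: m => [|m [s IHs]].
  by exists [tuple]; rewrite big_nil scale0r subr0 /sq big1 ?mul0r// => i _; rewrite mxE expr0n.
set y := _ - _ in IHs.
have [j hj] : exists j, sq (y + (x j - mu)) <= sq y + D.
  apply: (exists_le_mean p0 p1).
  have -> : \sum_j p j * sq (y + (x j - mu)) = sq y + \sum_j p j * sq (x j) - sq mu.
    have E i : \sum_j p j * (y + (x j - mu)) i 0 ^+ 2 =
        y i 0 ^+ 2 + \sum_j p j * x j i 0 ^+ 2 - mu i 0 ^+ 2.
      have muE : mu i 0 = \sum_j p j * x j i 0.
        by rewrite summxE; apply: eq_bigr => j _; rewrite mxE.
      rewrite (eq_bigr (fun j => p j * x j i 0 ^+ 2 + p j * (y i 0 - mu i 0) ^+ 2
         + (2 * (y i 0 - mu i 0)) * (p j * x j i 0))); last first.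
        by move=> j _; rewrite !mxE; ring.
      rewrite !big_split/= -mulr_suml -mulr_sumr p1 -muE; ring.
    rewrite /sq (eq_bigr (fun j => \sum_i p j * (y + (x j - mu)) i 0 ^+ 2)); last first.
      by move=> j _; rewrite mulr_sumr.
    rewrite exchange_big/= (eq_bigr _ (fun i _ => E i)) sumrB big_split/=.
    congr (_ + _ - _); rewrite exchange_big/=; apply: eq_bigr => j _.
    by rewrite mulr_sumr.
  have : \sum_j p j * sq (x j) <= D.
    rewrite -[leRHS]mul1r -p1 mulr_suml ler_sum// => j _.
    by rewrite ler_wpM2l.
  have := sq_ge0 mu; lra.
exists [tuple of j :: s]; rewrite big_cons.
have E (a b c : 'cV[R]_N) : a + b - m.+1%:R *: c = (b - m%:R *: c) + (a - c).
  by apply/matrixP => i k; rewrite !mxE -natr1; ring.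
rewrite E -/y.
by rewrite (le_trans hj)// -natr1 mulrDl mul1r lerD2r.
Qed.

(* The vectors on which restricted invertibility is tested: entries in S are
   rounded to multiples of 1 / (400 #|S|) in [-1, 1], the rest is a Maurey
   average of 13 #|S| signed basis vectors with l1-norm sqrt (2 #|S|) * 100/97. *)
Definition test_index P (S : {set 'I_P}) : finType :=
  ({ffun {j | j \in S} -> 'I_P} * (13 * #|S|).-tuple ('I_P * bool))%type.

Definition maurey_radius (s : nat) : R := Num.sqrt (2 * s%:R) / (97 / 100).

Definition test_vector P (S : {set 'I_P}) (k : test_index S) : 'cV[R]_P :=
  \col_j (if insub j is Some i then (k.1 i : nat)%:R / (400 * #|S|%:R) - 1
          else maurey_radius #|S| / (13 * #|S|%:R) *
               \sum_(c <- k.2) (c.1 == j)%:R * (-1) ^+ c.2).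

Lemma card_test_index P (S : {set 'I_P}) :
  #|test_index S| = (P ^ #|S| * (2 * P) ^ (13 * #|S|))%N.
Proof.
rewrite /test_index card_prod card_ffun card_ord card_tuple card_prod card_ord card_bool.
by rewrite card_sig mulnC (mulnC P 2) mulnC.
Qed.

(** A kernel vector violating the inequality, normalised to l2-norm 1 on [S], has bounded l1-norm
    off [S]. Rounding it on [S] and replacing it off [S] by a Maurey average gives a test vector
    whose image is too small for the lower bound. *)
Lemma null_space_property N P (A : 'M[R]_(N, P)) (S : {set 'I_P}) (eta : 'cV[R]_P) :
  (0 < N)%N -> (801 * #|S| <= P)%N ->
  (forall j, 7 / 10 * N%:R <= sq (col j A) <= 7 / 5 * N%:R) ->
  (forall k : test_index S, 24 / 100 * N%:R * (\sum_(j in S) test_vector k j 0 ^+ 2)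
     <= sq (A *m test_vector k)) ->
  A *m eta = 0 ->
  \sum_(j in S) l2norm (col j A) * `|eta j 0| <=
  97 / 100 * \sum_(j | j \notin S) l2norm (col j A) * `|eta j 0|.
Proof.
move=> N0 SP colA low Aeta; rewrite leNgt; apply/negP.
set w := fun j => l2norm (col j A).
have N0' : 0 < N%:R :> R by rewrite ltr0n.
wlog a1 : eta Aeta / \sum_(j in S) eta j 0 ^+ 2 = 1.
  move=> hw bad; pose a2 := \sum_(j in S) eta j 0 ^+ 2.
  have a20 : 0 <= a2 by apply: sumr_ge0 => j _; exact: sqr_ge0.
  have [a2_eq0|a2_neq0] := eqVneq a2 0.
    move: bad; rewrite [ltRHS]big1 ?ltNge ?mulr_ge0 ?sumr_ge0//.
      by move=> j _; rewrite mulr_ge0// sqrtr_ge0.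
    move=> j jS; move/eqP : a2_eq0; rewrite psumr_eq0//; last by move=> i _; exact: sqr_ge0.
    by move=> /allP/(_ j (mem_index_enum _)); rewrite jS /= sqrf_eq0 => /eqP ->; rewrite normr0 mulr0.
  have a2_gt0 : 0 < a2 by rewrite lt_neqAle eq_sym a2_neq0.
  pose b := (Num.sqrt a2)^-1.
  have b0 : 0 < b by rewrite invr_gt0 sqrtr_gt0.
  apply: (hw (b *: eta)).
  - by rewrite -scalemxAr Aeta scaler0.
  - rewrite (eq_bigr (fun j => b ^+ 2 * eta j 0 ^+ 2)); last by move=> j _; rewrite mxE exprMn.
    by rewrite -mulr_sumr exprVn sqr_sqrtr// mulVf.
  - have E (Q : pred 'I_P) : \sum_(j | Q j) w j * `|(b *: eta) j 0| = b * \sum_(j | Q j) w j * `|eta j 0|.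
      by rewrite mulr_sumr; apply: eq_bigr => j _; rewrite mxE normrM gtr0_norm//; ring.
    by rewrite !E mulrCA ltr_pM2l.
move=> bad.
set s := #|S| in SP low *.
have w0 j : 0 <= w j by exact: sqrtr_ge0.
have w2 j : w j ^+ 2 = sq (col j A).
  by rewrite /w /l2norm sqr_sqrtr// sq_ge0.
have [j0 j0S] : exists j0, j0 \in S.
  apply/existsP; move: (oner_neq0 R); apply: contraNT => /existsPn S0.
  by rewrite -a1 big1// => j; rewrite (negbTE (S0 j)).
have s_gt0 : (0 < s)%N by rewrite /s card_gt0; apply/set0Pn; exists j0.
have s0 : 0 < s%:R :> R by rewrite ltr0n.
have s_neq0 : s%:R != 0 :> R by rewrite gt_eqF.
have sum_S (c : R) : \sum_(j in S) c = s%:R * c.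
  by rewrite sumr_const -/s mulr_natl.
pose T := maurey_radius s; pose T' := \sum_(j | j \notin S) `|eta j 0|.
have T'0 : 0 <= T' by apply: sumr_ge0.
have T0 : 0 < T by rewrite /T mulr_gt0// ?sqrtr_gt0 ?mulr_gt0.
pose r : R := 97 / 100; rewrite -/r in bad.
have r0 : 0 < r by rewrite divr_gt0.
have T2 : T ^+ 2 = 2 * s%:R / r ^+ 2.
  by rewrite /T expr_div_n sqr_sqrtr// mulr_ge0.
have r2 : (r ^+ 2)^-1 <= 1063 / 1000.
  by rewrite -div1r ler_pdivrMr ?exprn_gt0// /r; lra.
(* Column norms differ by at most a factor sqrt 2, and Cauchy-Schwarz bounds the sum over [S] by
   sqrt (s * 7/5 * N); hence the value of [maurey_radius]. *)
have T'T : T' <= T.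
  rewrite -ler_sqr ?nnegrE ?(ltW T0)// T2.
  pose om := Num.sqrt (7 / 10 * N%:R : R).
  have om2 : om ^+ 2 = 7 / 10 * N%:R by rewrite sqr_sqrtr// mulr_ge0 ?ltW.
  have h1 : r * (om * T') < \sum_(j in S) w j * `|eta j 0|.
    apply: le_lt_trans bad; rewrite ler_pM2l// mulr_sumr ler_sum// => j _.
    rewrite ler_wpM2r// -ler_sqr ?nnegrE ?w0 ?sqrtr_ge0// om2 w2.
    by case/andP: (colA j).
  have h2 : (r * (om * T')) ^+ 2 <= s%:R * (7 / 5 * N%:R).
    rewrite (@le_trans _ _ ((\sum_(j in S) w j * `|eta j 0|) ^+ 2))//.
      have p1 : 0 <= r * (om * T') by rewrite mulr_ge0 ?(ltW r0)// mulr_ge0 ?sqrtr_ge0.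
      have p2 : 0 <= \sum_(j in S) w j * `|eta j 0|.
        by rewrite sumr_ge0// => j _; rewrite mulr_ge0.
      by rewrite ler_sqr ?nnegrE// ltW.
    rewrite (le_trans (sum_CS _ _ _))//.
    rewrite [X in _ * X](eq_bigr (fun j => eta j 0 ^+ 2)); last first.
      by move=> j _; rewrite real_normK// num_real.
    rewrite a1 mulr1 -sum_S ler_sum// => j _; rewrite w2.
    by case/andP: (colA j).
  have h3 : (r * (om * T')) ^+ 2 = N%:R * (7 / 10 * (r ^+ 2 * T' ^+ 2)).
    by rewrite !exprMn om2; ring.
  have h4 : s%:R * (7 / 5 * N%:R) = N%:R * (7 / 5 * s%:R) :> R by ring.
  rewrite h3 h4 ler_pM2l// in h2.
  by rewrite ler_pdivlMr ?exprn_gt0//; lra.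
pose sg (b : bool) : R := (-1) ^+ b.
pose x (c : 'I_P * bool) : 'cV[R]_N := if c.1 \in S then 0 else (T * sg c.2) *: col c.1 A.
(* Each index off [S] splits its mass between two signs, with signed total [eta j 0 / T]; the
   missing mass [1 - T' / T] goes to [(j0, true)], whose vector is 0. *)
pose pr (c : 'I_P * bool) : R :=
  if c.1 \in S then (c == (j0, true))%:R * (1 - T' / T)
  else (`|eta c.1 0| + sg c.2 * eta c.1 0) / (2 * T).
have pr0 c : 0 <= pr c.
  rewrite /pr; case: ifP => _.
    by rewrite mulr_ge0// subr_ge0 ler_pdivrMr// mul1r.
  rewrite divr_ge0 ?mulr_ge0 ?(ltW T0)//.
  have := ler_norm (eta c.1 0); have := ler_norm (- eta c.1 0); rewrite normrN.
  by rewrite /sg; case: c.2; rewrite ?expr1 ?expr0; clear; lra.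
have pr_sum j : pr (j, true) + pr (j, false) =
   if j \in S then (j == j0)%:R * (1 - T' / T) else `|eta j 0| / T.
  rewrite /pr /=; case: ifP => _.
    by rewrite ?xpair_eqE ?eqxx ?andbT ?andbF mul0r addr0.
  by rewrite /sg expr1 expr0; field; rewrite gt_eqF.
have sum_pair (V : nmodType) (F : 'I_P * bool -> V) :
    \sum_c F c = \sum_j (F (j, true) + F (j, false)).
  rewrite -(eq_bigr _ (fun c _ => congr1 F (esym (surjective_pairing c)))).
  rewrite -(pair_big predT predT (fun j b => F (j, b)))/=.
  by apply: eq_bigr => j _; rewrite big_bool.
have pr1 : \sum_c pr c = 1.
  rewrite sum_pair (eq_bigr _ (fun j _ => pr_sum j)) (bigID (mem S))/=.
  rewrite (bigD1 j0)//= j0S eqxx mul1r big1 ?addr0; last first.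
    by move=> j /andP[-> /negbTE ->]; rewrite mul0r.
  rewrite (eq_bigr (fun j => `|eta j 0| / T)); last by move=> j /negbTE ->.
  by rewrite -mulr_suml -/T' subrK.
pose mu := \sum_(j | j \notin S) eta j 0 *: col j A.
have muE : \sum_c pr c *: x c = mu.
  rewrite sum_pair (bigID (mem S))/= big1 ?add0r; last first.
    by move=> j jS; rewrite /x /= jS !scaler0 addr0.
  apply: eq_bigr => j /negbTE jS; rewrite /x /pr /= jS !scalerA -scalerDl.
  by congr (_ *: _); rewrite /sg expr1 expr0; field; rewrite gt_eqF.
pose D := T ^+ 2 * (7 / 5 * N%:R).
have xD c : sq (x c) <= D.
  rewrite /x; case: ifP => _.
    rewrite /sq big1 => [|i _]; last by rewrite mxE expr0n.
    by rewrite mulr_ge0 ?sqr_ge0// mulr_ge0 ?ltW.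
  rewrite sqZ exprMn /sg sqrr_sign mulr1 ler_wpM2l ?sqr_ge0//.
  by case/andP: (colA c.1).
have [t] := @maurey _ N x pr D (13 * s) pr0 pr1 xD.
rewrite muE => ht.
have eta1 j : j \in S -> `|eta j 0| <= 1.
  move=> jS; rewrite -(@ler_pXn2r _ 2)// ?nnegrE// expr1n -a1 (bigD1 j)//=.
  rewrite real_normK ?num_real// lerDl sumr_ge0// => i _; exact: sqr_ge0.
(* Levels [(eta j 0 + 1) * q] are at most 800 s, below 801 s <= P: they fit in ['I_P], so that test
   vectors are counted by powers of [P]. *)
have [q [q0 qE q2]] : exists q : R, [/\ 0 < q, 400 * s%:R = q & 2 * q < (801 * s)%:R].
  exists (400 * s%:R); split; [by rewrite pmulr_rgt0 ?ltr0n | reflexivity |].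
  by rewrite natrM; clear -s0; lra.
have sq_inv : s%:R * q^-1 = 1 / 400 by rewrite -qE; field; rewrite s_neq0.
pose K := q^-1; have K0 : 0 <= K by rewrite invr_ge0 ltW.
have KE : q^-1 = K by [].
pose rd (j : 'I_P) : nat := Num.truncn ((eta j 0 + 1) * q).
have rd_ge0 j : j \in S -> 0 <= (eta j 0 + 1) * q.
  move=> jS; apply: mulr_ge0; last exact: ltW.
  by have := eta1 j jS; rewrite ler_norml => /andP[]; clear; lra.
have rd_lt j : j \in S -> (rd j < P)%N.
  move=> jS; rewrite (leq_trans _ SP)// truncn_lt_nat ?rd_ge0//.
  have := eta1 j jS; rewrite ler_norml => /andP[h1 h2].
  by apply: le_lt_trans q2; rewrite ler_pM2r//; clear -h2; lra.
pose k : test_index S := ([ffun i : {j | j \in S} => insubd j0 (rd (val i))], t).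
pose v := test_vector k.
pose dl j := v j 0 - eta j 0.
have dlS j : j \in S -> `|dl j| <= K.
  move=> jS; have h0 := rd_ge0 j jS; have hP := rd_lt j jS.
  rewrite /dl /v mxE; case: insubP => [i _ ij|]; last by rewrite jS.
  rewrite ffunE /= ij insubdK// -/s qE.
  have := truncn_itv h0; rewrite -/(rd j) -[(rd j).+1%:R]natr1 => /andP[h1 h2].
  have -> : (rd j)%:R / q - 1 - eta j 0 = - ((eta j 0 + 1) * q - (rd j)%:R) * K.
    by rewrite /K; field; rewrite gt_eqF.
  by rewrite normrM normrN (ger0_norm K0) ler_piMl// ger0_norm; clear -h1 h2; lra.
have mulE (c : 'cV[R]_P) : A *m c = \sum_j c j 0 *: col j A.
  apply/matrixP => i l; rewrite ord1 mxE summxE; apply: eq_bigr => j _.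
  by rewrite !mxE mulrC.
have m0 : (13 * s)%:R != 0 :> R by rewrite pnatr_eq0 -lt0n muln_gt0.
have vC : \sum_(j | j \notin S) v j 0 *: col j A = (13 * s)%:R^-1 *: \sum_(c <- t) x c.
  rewrite scaler_sumr.
  rewrite (eq_bigr (fun j => \sum_(c <- t) (T / (13 * s)%:R * ((c.1 == j)%:R * sg c.2)) *: col j A)).
    rewrite exchange_big/=; apply: eq_bigr => c _; rewrite /x.
    case: ifPn => cS.
      rewrite scaler0 big1// => j jS; case: eqP => [cj|_].
        by rewrite cj (negbTE jS) in cS.
      by rewrite mul0r mulr0 scale0r.
    rewrite (bigD1 c.1)//= eqxx big1 ?addr0.
      by rewrite scalerA; congr (_ *: _); rewrite mul1r; ring.
    by move=> j /andP[_ jc]; rewrite eq_sym (negbTE jc) mul0r mulr0 scale0r.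
  move=> j jS; rewrite -scaler_suml; congr (_ *: _).
  rewrite /v mxE; case: insubP => [i ij _|_]; first by rewrite ij in jS.
  by rewrite -mulr_sumr natrM.
pose u := \sum_(j in S) dl j *: col j A.
pose z := (13 * s)%:R^-1 *: (\sum_(c <- t) x c - (13 * s)%:R *: mu).
have uE : u = \sum_(j in S) v j 0 *: col j A - \sum_(j in S) eta j 0 *: col j A.
  by rewrite -sumrB; apply: eq_bigr => j _; rewrite scalerBl.
have Av : A *m v = u + z.
  have eta0 : \sum_(j in S) eta j 0 *: col j A + mu = 0.
    by rewrite -[RHS]Aeta mulE [RHS](bigID (mem S)).
  rewrite /z scalerBr scalerA mulVf// scale1r -vC mulE (bigID (mem S))/=.
  by rewrite uE addrACA -opprD eta0 subr0.
have zD : sq z <= 1063 / 1000 * (2 * (7 / 5 * N%:R) / 13).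
  rewrite /z sqZ (le_trans (ler_wpM2l _ ht)) ?sqr_ge0//.
  have -> : (13 * s)%:R^-1 ^+ 2 * ((13 * s)%:R * D) = (r ^+ 2)^-1 * (2 * (7 / 5 * N%:R) / 13).
    by rewrite /D T2 natrM; field; rewrite s_neq0 gt_eqF.
  by rewrite ler_wpM2r// divr_ge0// mulr_ge0// mulr_ge0.
have uD : sq u <= 7 / 5 * N%:R / (400 * 400).
  have sumdl : \sum_(j in S) dl j ^+ 2 <= s%:R * K ^+ 2.
    rewrite -sum_S ler_sum// => j jS; rewrite -real_normK ?num_real//.
    by rewrite ler_sqr ?nnegrE ?dlS.
  have sumcol : \sum_(j in S) sq (col j A) <= s%:R * (7 / 5 * N%:R).
    by rewrite -sum_S ler_sum// => j _; case/andP: (colA j).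
  rewrite (@le_trans _ _ ((\sum_(j in S) dl j ^+ 2) * \sum_(j in S) sq (col j A)))//.
    rewrite /sq [X in _ * X]exchange_big/= mulr_sumr ler_sum// => i _.
    rewrite /u summxE (eq_bigr (fun j => dl j * A i j)); last by move=> j _; rewrite !mxE.
    rewrite (le_trans (sum_CS _ _ _))// ler_wpM2l ?sumr_ge0// => [j _|].
      exact: sqr_ge0.
    by rewrite le_eqVlt; apply/orP; left; apply/eqP; apply: eq_bigr => j _; rewrite mxE.
  rewrite (le_trans (ler_pM _ _ sumdl sumcol)) ?sumr_ge0// => [j _|j _|].
  - exact: sqr_ge0.
  - exact: sq_ge0.
  have -> : s%:R * K ^+ 2 * (s%:R * (7 / 5 * N%:R)) = (s%:R * K) ^+ 2 * (7 / 5 * N%:R) by ring.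
  rewrite -[s%:R * K]/(s%:R * q^-1) sq_inv.
  by rewrite le_eqVlt; apply/orP; left; apply/eqP; field.
have vS : 1 - 1 / 200 <= \sum_(j in S) v j 0 ^+ 2.
  have -> : 1 - 1 / 200 = \sum_(j in S) (eta j 0 ^+ 2 - 2 * K).
    by rewrite sumrB a1 sum_S mulrCA -[s%:R * K]/(s%:R * q^-1) sq_inv; congr (_ - _); field.
  apply: ler_sum => j jS.
  have -> : v j 0 = eta j 0 + dl j by rewrite /dl addrC subrK.
  have : `|eta j 0 * dl j| <= K.
    by rewrite normrM -[leRHS]mul1r ler_pM// ?eta1 ?dlS.
  rewrite ler_norml => /andP[h3 _].
  have -> : (eta j 0 + dl j) ^+ 2 = eta j 0 ^+ 2 + 2 * (eta j 0 * dl j) + dl j ^+ 2 by ring.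
  by have := sqr_ge0 (dl j); clear -h3; lra.
(* [sq (u + z)] is at most about 0.2322 N, against a lower bound 0.2388 N; in this estimate 13 is
   the least multiple of s that makes them clash. *)
have := low k; rewrite -/v Av => hlow.
have := sqD_le u z.
have : 24 / 100 * N%:R * (1 - 1 / 200) <= 24 / 100 * N%:R * (\sum_(j in S) v j 0 ^+ 2) :> R.
  by rewrite ler_wpM2l// mulr_ge0 ?ltW.
clear -hlow zD uD N0'; lra.
Qed.

End NullSpace.

(** * Stability of the minimizers *)

Section DeterministicRecovery.
Context {R : realType}.

Lemma l2norm_sqr N (v : 'cV[R]_N) : l2norm v ^+ 2 = sq v.
Proof. by rewrite sqr_sqrtr// sq_ge0. Qed.

Lemma coord_le_l2norm N (v : 'cV[R]_N) i : `|v i 0| <= l2norm v.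
Proof.
rewrite -ler_sqr ?nnegrE ?sqrtr_ge0// l2norm_sqr real_normK ?num_real//.
by rewrite /sq (bigD1 i)//= lerDl sumr_ge0// => j _; exact: sqr_ge0.
Qed.

Lemma det_bound n (M : 'M[R]_n) (C : R) : (forall i j, `|M i j| <= C) ->
  `|\det M| <= n`!%:R * C ^+ n.
Proof.
move=> MC; rewrite /determinant (le_trans (ler_norm_sum _ _ _))//.
rewrite -card_Sn mulr_natl -sumr_const ler_sum// => s _.
rewrite normrM normrX normrN1 expr1n mul1r normr_prod -[X in C ^+ X]card_ord.
by rewrite -prodr_const ler_prod// => i _; rewrite normr_ge0 MC.
Qed.

(** Cramer's rule: the entries of the adjugate are minors, bounded by (n - 1)! C^(n - 1). [K] is
    uniform over the matrices, since it must serve all samples in the good cells. *)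
Lemma solve_bound n (C k : R) : 0 <= C -> 0 < k ->
  exists2 K : R, 0 <= K & forall (M : 'M[R]_n) (x : 'cV[R]_n) (E : R),
    (forall i j, `|M i j| <= C) -> k <= `|\det M| ->
    (forall i, `|(M *m x) i 0| <= E) -> forall j, `|x j 0| <= K * E.
Proof.
move=> C0 k0; pose D : R := n.-1`!%:R * C ^+ n.-1.
have D0 : 0 <= D by rewrite mulr_ge0// exprn_ge0.
exists (k^-1 * (n%:R * D)); first by rewrite mulr_ge0 ?invr_ge0 ?(ltW k0)// mulr_ge0.
move=> M x E MC kM ME j.
have dM : \det M != 0 by rewrite -normr_gt0 (lt_le_trans k0).
have Mu : M \in unitmx by rewrite unitmxE unitfE.
have -> : x = invmx M *m (M *m x) by rewrite mulKmx.
rewrite mxE (le_trans (ler_norm_sum _ _ _))// -mulrA mulrCA -mulrA mulr_natl.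
rewrite -[X in _ *+ X]card_ord -sumr_const ler_sum// => i _.
rewrite normrM mulrA [D * _]mulrC ler_pM// /invmx Mu !mxE normrM.
rewrite ler_pM// ?normfV ?lef_pV2 ?posrE ?normr_gt0//.
rewrite /cofactor normrM normrX normrN1 expr1n mul1r det_bound// => a b.
by rewrite !mxE.
Qed.

Section Recovery.
Variables (N P : nat) (A : 'M[R]_(N, P)) (u : 'cV[R]_N) (delta eps : R).
Variables (c c0 : 'cV[R]_P).
Hypothesis (u_c0 : forall i, `|u i 0 - (A *m c0) i 0| <= eps).
Hypothesis (sol : l1_solution A u delta c).

Lemma residual_coord i : `|(A *m (c - c0)) i 0| <= delta + eps.
Proof.
have -> : (A *m (c - c0)) i 0 = (A *m c - u) i 0 + (u i 0 - (A *m c0) i 0).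
  by rewrite mulmxBr !mxE; ring.
rewrite (le_trans (ler_normD _ _))// lerD//.
exact: le_trans (coord_le_l2norm _ _) sol.1.
Qed.

Lemma recovery_tall (f : 'I_P -> 'I_N) (K : R) :
  (forall (x : 'cV[R]_P) E, (forall i, `|(rowsub f A *m x) i 0| <= E) ->
     forall j, `|x j 0| <= K * E) ->
  forall j, `|c j 0 - c0 j 0| <= K * (delta + eps).
Proof.
move=> solve j; have := solve (c - c0) (delta + eps) _ j; rewrite !mxE; apply.
by move=> i; rewrite mul_rowsub_mx mxE; exact: residual_coord.
Qed.

Lemma l1norm_column_weights (x : 'cV[R]_P) :
  l1norm (column_weights A *m x) = \sum_j l2norm (col j A) * `|x j 0|.
Proof.
rewrite /l1norm; apply: eq_bigr => j _.
by rewrite /column_weights mul_diag_mx !mxE normrM ger0_norm ?sqrtr_ge0.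
Qed.

(** Residuals are cancelled exactly: [solve] yields [h1], making [c0 + h1] fit the data, and [h2],
    moving [c - c0] into the kernel. The usual cone argument then applies to a kernel vector, with
    errors of size K E per coordinate. *)
Lemma recovery_sparse (S : {set 'I_P}) (K b : R) :
  0 <= K -> 0 <= delta -> 0 < b ->
  (forall j, b <= l2norm (col j A) <= 2 * b) ->
  (forall (e : 'cV[R]_N) E, (forall i, `|e i 0| <= E) ->
     exists2 h : 'cV[R]_P, A *m h = e & forall j, `|h j 0| <= K * E) ->
  (forall eta : 'cV[R]_P, A *m eta = 0 ->
     \sum_(j in S) l2norm (col j A) * `|eta j 0| <=
     97 / 100 * \sum_(j | j \notin S) l2norm (col j A) * `|eta j 0|) ->
  (forall j, j \notin S -> c0 j 0 = 0) -> 0 <= eps ->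
  forall j, `|c j 0 - c0 j 0| <= (1 + 300 * P%:R) * K * (delta + eps).
Proof.
move=> K0 delta0 b0 wb solve nsp c0S eps0 j1.
pose w j := l2norm (col j A); pose E := delta + eps.
have E0 : 0 <= E by rewrite addr_ge0.
have w0 j : 0 <= w j by exact: sqrtr_ge0.
have small (h : 'cV[R]_P) (Q : pred 'I_P) : (forall j, `|h j 0| <= K * E) ->
    \sum_(j | Q j) w j * `|h j 0| <= \sum_(j | Q j) (2 * b) * (K * E).
  by move=> hK; apply: ler_sum => j _; rewrite ler_pM//; case/andP: (wb j).
pose QS := \sum_(j in S) (2 * b) * (K * E).
pose QC := \sum_(j | j \notin S) (2 * b) * (K * E).
have QE : QS + QC = P%:R * (2 * b * (K * E)).
  by rewrite /QS /QC -(bigID (mem S) predT)/= sumr_const card_ord -[_ *+ P]mulr_natl.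
have triS (Q : pred 'I_P) (x y : 'cV[R]_P) :
    \sum_(j | Q j) w j * `|(x + y) j 0| <=
    \sum_(j | Q j) w j * `|x j 0| + \sum_(j | Q j) w j * `|y j 0|.
  by rewrite -big_split/= ler_sum// => j _; rewrite mxE -mulrDr ler_wpM2l// ler_normD.
have [h1 Ah1 h1K] : exists2 h : 'cV[R]_P, A *m h = u - A *m c0 & forall j, `|h j 0| <= K * E.
  apply: solve => i; have -> : (u - A *m c0) i 0 = u i 0 - (A *m c0) i 0.
    by rewrite [LHS]mxE [X in _ + X]mxE.
  by rewrite (le_trans (u_c0 i))// lerDr.
have [h2 Ah2 h2K] : exists2 h : 'cV[R]_P, A *m h = A *m (c - c0) & forall j, `|h j 0| <= K * E.
  by apply: solve => i; exact: residual_coord.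
pose eta := (c - c0) - h2.
have Aeta : A *m eta = 0 by rewrite /eta mulmxBr Ah2 subrr.
have feas : feasible A u delta (c0 + h1).
  rewrite /feasible mulmxDr Ah1 addrCA subrr addr0 subrr.
  by rewrite /l2norm big1 ?sqrtr0// => i _; rewrite mxE expr0n.
have := sol.2 _ feas; rewrite !l1norm_column_weights -/w => opt.
have {}opt : \sum_j w j * `|c j 0| <=
    \sum_j w j * `|c0 j 0| + (QS + QC).
  rewrite (le_trans opt)// (le_trans (triS predT _ _))// lerD2l.
  by rewrite (le_trans (small _ predT h1K))// QE sumr_const card_ord -[_ *+ P]mulr_natl.
have c0E : \sum_j w j * `|c0 j 0| = \sum_(j in S) w j * `|c0 j 0|.
  rewrite (bigID (mem S))/= [X in _ + X]big1 ?addr0// => j jS.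
  by rewrite c0S// normr0 mulr0.
have cE : \sum_j w j * `|c j 0| = \sum_(j in S) w j * `|c j 0| + \sum_(j | j \notin S) w j * `|(c - c0) j 0|.
  rewrite (bigID (mem S))/=; congr (_ + _); apply: eq_bigr => j jS.
  by rewrite !mxE (c0S j jS) subr0.
have cS : \sum_(j in S) w j * `|c0 j 0| <= \sum_(j in S) w j * `|c j 0| + \sum_(j in S) w j * `|(c - c0) j 0|.
  by rewrite -big_split/= ler_sum// => j _; rewrite -mulrDr ler_wpM2l// !mxE; have := ler_normB (c j 0) (c j 0 - c0 j 0); rewrite opprB addrCA subrr addr0.
have dS : \sum_(j in S) w j * `|(c - c0) j 0| <= \sum_(j in S) w j * `|eta j 0| + QS.
  have -> : c - c0 = eta + h2 by rewrite /eta subrK.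
  by rewrite (le_trans (triS _ _ _))// lerD2l small.
have dC : \sum_(j | j \notin S) w j * `|eta j 0| <= \sum_(j | j \notin S) w j * `|(c - c0) j 0| + QC.
  rewrite /eta (le_trans (triS _ _ _))// lerD2l small// => j.
  by rewrite mxE normrN.
have ns := nsp _ Aeta; rewrite -/w in ns.
set X := \sum_(j | j \notin S) w j * `|eta j 0| in dC ns.
set Y := \sum_(j in S) w j * `|eta j 0| in dS ns.
have Xle : 3 / 100 * X <= 2 * (QS + QC).
  by move: opt cS dS dC ns; rewrite c0E cE; clear; lra.
have tot : b * `|eta j1 0| <= X + Y.
  rewrite addrC /X /Y -(bigID (mem S) predT)/= (bigD1 j1)//= -[leLHS]addr0.
  rewrite lerD ?sumr_ge0// => [|j _]; last by rewrite mulr_ge0.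
  by rewrite ler_wpM2r//; case/andP: (wb j1).
have X0 : 0 <= X by apply: sumr_ge0 => j _; rewrite mulr_ge0.
(* With Q = QS + QC: X + Y <= 1.97 X <= 1.97 * (200 / 3) Q <= 150 Q, and Q = 2 b P K E. *)
have etaj : b * `|eta j1 0| <= b * (300 * (P%:R * (K * E))).
  have -> : b * (300 * (P%:R * (K * E))) = 150 * (QS + QC) by rewrite QE; ring.
  have PKE : 0 <= QS + QC.
    by rewrite QE mulr_ge0// mulr_ge0 ?mulr_ge0// ltW.
  by move: tot ns Xle PKE; clear; lra.
rewrite ler_pM2l// in etaj.
have -> : c j1 0 - c0 j1 0 = eta j1 0 + h2 j1 0 by rewrite /eta !mxE; ring.
rewrite (le_trans (ler_normD _ _))// -/E.
have -> : (1 + 300 * P%:R) * K * E = 300 * (P%:R * (K * E)) + K * E by ring.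
exact: lerD.
Qed.

(** Both coefficient vectors fit the data, so the triangle inequality gives N x_j^2 <= 50 (delta^2 +
    N eps^2) for x = c - c0, and 50 <= 8^2. *)
Lemma recovery_net :
  (0 < N)%N -> 0 <= delta -> 0 <= eps ->
  (forall j (x : 'cV[R]_P), N%:R * x j 0 ^+ 2 <= 25 * sq (A *m x)) ->
  forall j, `|c j 0 - c0 j 0| <= 8 * (eps + delta / Num.sqrt N%:R).
Proof.
move=> N0 delta0 eps0 inv j.
have N0' : 0 < N%:R :> R by rewrite ltr0n.
set r := Num.sqrt N%:R; have r0 : 0 < r by rewrite sqrtr_gt0.
have r2 : r ^+ 2 = N%:R by rewrite sqr_sqrtr// ltW.
have := inv j (c - c0); rewrite !mxE => h.
have h2 : sq (A *m (c - c0)) <= 2 * delta ^+ 2 + 2 * (N%:R * eps ^+ 2).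
  have -> : A *m (c - c0) = (A *m c - u) + (u - A *m c0) by rewrite addrA subrK mulmxBr.
  apply: (@le_trans _ _ (2 * sq (A *m c - u) + 2 * sq (u - A *m c0))).
    move: (A *m c - u) (u - A *m c0) => v w.
    rewrite /sq !mulr_sumr -big_split/= ler_sum// => i _; rewrite mxE.
    by move: (v i 0) (w i 0) => a b; have := sqr_ge0 (a - b); nra.
  rewrite lerD// ler_wpM2l//.
    by rewrite -l2norm_sqr ler_sqr ?nnegrE ?sqrtr_ge0//; exact: sol.1.
  rewrite /sq mulr_natl -[X in _ *+ X]card_ord -sumr_const ler_sum// => i _.
  rewrite -real_normK ?num_real// ler_sqr ?nnegrE//.
  by have := u_c0 i; rewrite !mxE.
rewrite -ler_sqr ?nnegrE ?mulr_ge0 ?addr_ge0 ?divr_ge0 ?(ltW r0)//.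
rewrite real_normK ?num_real// -(ler_pM2l N0').
have {}h2 : 25 * sq (A *m (c - c0)) <= 25 * (2 * delta ^+ 2 + 2 * (N%:R * eps ^+ 2)) by rewrite ler_pM2l.
rewrite (le_trans h)// (le_trans h2)//.
have -> : N%:R * (8 * (eps + delta / r)) ^+ 2 = 64 * (r * eps + delta) ^+ 2.
  by rewrite -r2; field; rewrite gt_eqF.
have re0 : 0 <= r * eps by rewrite mulr_ge0 ?(ltW r0).
have -> : 25 * (2 * delta ^+ 2 + 2 * (N%:R * eps ^+ 2)) =
    50 * delta ^+ 2 + 50 * (r * eps) ^+ 2 by rewrite -r2; ring.
by have := mulr_ge0 re0 delta0; have := sqr_ge0 (r * eps); have := sqr_ge0 delta; nra.
Qed.

End Recovery.
End DeterministicRecovery.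

(** * Random measurement matrices on the grid *)

Section GridEvents.
Context {R : realType} (p d : nat).
Let P := #|Lambda p d|.

Definition phi_mx N (z : 'I_N -> 'I_d -> R) : 'M[R]_(N, P) :=
  \matrix_(i, j) phi j (z i).

Definition pc (v : 'cV[R]_P) (x : 'I_d -> R) : R := \sum_j v j 0 * phi j x.

Lemma phi_mx_mul N (z : 'I_N -> 'I_d -> R) v i :
  (phi_mx z *m v) i 0 = pc v (z i).
Proof. by rewrite mxE; apply: eq_bigr => j _; rewrite mxE mulrC. Qed.

Lemma sq_phi_mx N (z : 'I_N -> 'I_d -> R) v :
  sq (phi_mx z *m v) = \sum_i pc v (z i) ^+ 2.
Proof. by apply: eq_bigr => i _; rewrite phi_mx_mul. Qed.

Lemma polyfun_pc v : polyfun p (pc v).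
Proof. by apply: polyfun_sum => j _; apply: polyfun_scale; exact: polyfun_phi. Qed.

Lemma sum_norm_sqr_le (v : 'cV[R]_P) : (\sum_j `|v j 0|) ^+ 2 <= P%:R * sq v.
Proof.
rewrite (eq_bigr (fun j => 1 * `|v j 0|)); last by move=> j _; rewrite mul1r.
rewrite (le_trans (sum_CS _ _ _))// le_eqVlt; apply/orP; left; apply/eqP.
congr (_ * _); last by apply: eq_bigr => j _; rewrite real_normK// num_real.
by rewrite (eq_bigr (fun=> 1)) => [|j _]; rewrite ?expr1n// sumr_const card_ord.
Qed.

Lemma avg_pc_sqr (e : R) : 0 < e -> \forall n \near \oo, forall v,
  `|avg (fun g : {ffun 'I_d -> 'I_(2 ^ n)} => pc v (gpt g) ^+ 2) - sq v| <= e * sq v.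
Proof.
move=> e0; have e1 : 0 < e / (P%:R + 1) by rewrite divr_gt0// ltr_wpDl.
apply: filterS (@phi_gram R p d _ e1) => n hn v.
have -> : avg (fun g : {ffun 'I_d -> 'I_(2 ^ n)} => pc v (gpt g) ^+ 2) =
  \sum_j \sum_k (v j 0 * v k 0) *
     avg (fun g : {ffun 'I_d -> 'I_(2 ^ n)} => phi j (gpt g) * phi k (gpt g)).
  rewrite (@eq_avg _ _ _ (fun g => \sum_j \sum_k (v j 0 * v k 0) * (phi j (gpt g) * phi k (gpt g)))).
    rewrite avg_sum; apply: eq_bigr => j _; rewrite avg_sum; apply: eq_bigr => k _.
    by rewrite avgZ.
  move=> g; rewrite expr2 mulr_suml; apply: eq_bigr => j _.
  by rewrite mulr_sumr; apply: eq_bigr => k _; ring.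
have -> : sq v = \sum_j \sum_k (v j 0 * v k 0) * (j == k)%:R.
  apply: eq_bigr => j _; rewrite (bigD1 j)//= eqxx mulr1 big1 ?addr0// => k kj.
  by rewrite eq_sym (negbTE kj) mulr0.
rewrite -sumrB; under eq_bigr => j _ do rewrite -sumrB.
rewrite (le_trans (ler_norm_sum _ _ _))//.
rewrite (@le_trans _ _ (\sum_j \sum_k `|v j 0| * `|v k 0| * (e / (P%:R + 1))))//.
  apply: ler_sum => j _; rewrite (le_trans (ler_norm_sum _ _ _))// ler_sum// => k _.
  by rewrite -mulrBr !normrM ler_wpM2l// mulr_ge0.
rewrite (eq_bigr (fun j => `|v j 0| * ((\sum_k `|v k 0|) * (e / (P%:R + 1))))); last first.
  by move=> j _; rewrite mulr_suml mulr_sumr; apply: eq_bigr => k _; rewrite mulrA.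
rewrite -mulr_suml mulrA -expr2.
have -> : \sum_j \sum_k v j 0 * v k 0 * (j == k)%:R = sq v.
  apply: eq_bigr => j _; rewrite (bigD1 j)//= eqxx mulr1 big1 ?addr0// => k kj.
  by rewrite eq_sym (negbTE kj) mulr0.
rewrite (le_trans (ler_wpM2r (ltW e1) (sum_norm_sqr_le v)))//.
rewrite mulrAC ler_wpM2r ?sq_ge0// mulrCA ger_pMr// ler_pdivrMr ?ltr_wpDl//.
by rewrite mul1r lerDl.
Qed.

Lemma avg_exists (T J : finType) (b : J -> pred T) :
  avg (fun x => [exists j, b j x]%:R : R) <= \sum_j avg (fun x => (b j x)%:R).
Proof.
rewrite -avg_sum; apply: avg_le => x.
have [/existsP[j bj]|_] := boolP [exists j, b j x]; last exact: sumr_ge0.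
by rewrite (bigD1 j)//= bj lerDl sumr_ge0.
Qed.

(** A union bound over [lower_tail] for the squares of [pc (v k)], whose second moments Bonami
    controls. The factor 99 / 100 absorbs the inexact orthonormality on the grid. *)
Lemma lower_event : \forall n \near \oo, forall N (J : finType) (v : J -> 'cV[R]_P) (t : R),
  0 <= t <= 1 ->
  avg (fun g : {ffun 'I_N -> {ffun 'I_d -> 'I_(2 ^ n)}} =>
    [exists k, sq (phi_mx (fun i => gpt (g i)) *m v k)
               < N%:R * ((1 - t) * (99 / 100 * sq (v k)))]%R%:R : R)
  <= #|J|%:R * expR (- (N%:R * t ^+ 2 / (2 * 9 ^+ p))).
Proof.
have e0 : 0 < 1 / 100 :> R by rewrite divr_gt0.
apply: filterS (avg_pc_sqr e0) => n hn N J v t t01.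
rewrite (le_trans (@avg_exists _ _ _))// [leRHS]mulr_natl -sumr_const ler_sum// => k _.
have [vk0|vk0] := eqVneq (sq (v k)) 0.
  rewrite [leLHS](_ : _ = 0) ?expR_ge0// /avg big1 ?mulr0// => g _.
  by rewrite vk0 !mulr0 ltNge sq_ge0.
have vk_gt0 : 0 < sq (v k) by rewrite lt_neqAle eq_sym vk0 sq_ge0.
have m0 : 0 < 99 / 100 * sq (v k) by rewrite mulr_gt0// divr_gt0.
have := @lower_tail R _ N (fun g : {ffun 'I_d -> 'I_(2 ^ n)} => pc (v k) (gpt g) ^+ 2)
  _ (9 ^+ p) t (grid_gt0 _ _) (fun g => sqr_ge0 _) m0.
move=> /(_ (exprn_gt0 _ (ltr0Sn R 8)) t01) tail.
apply: le_trans (tail _ _); last 2 first.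
- by have := hn (v k); rewrite ler_norml => /andP[]; lra.
- rewrite (le_trans _ (bonami_grid n (polyfun_pc (v k))))//.
  rewrite le_eqVlt; apply/orP; left; apply/eqP; apply: eq_avg => g.
  by rewrite -exprM.
apply: avg_le => g; rewrite sq_phi_mx ler_nat.
by case: ltP => // /ltW ->.
Qed.

Lemma upper_event : \forall n \near \oo, forall N,
  avg (fun g : {ffun 'I_N -> {ffun 'I_d -> 'I_(2 ^ n)}} =>
    [exists j : 'I_P, N%:R * (277 / 200) <= \sum_i phi j (gpt (g i)) ^+ 2 :> R]%R%:R : R)
  <= P%:R * expR (- (N%:R / (32 * 9 ^+ p))).
Proof.
have e0 : 0 < 1 / 100 :> R by rewrite divr_gt0.
apply: filterS (@phi_gram R p d _ e0) => n hn N.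
rewrite (le_trans (@avg_exists _ _ _))//.
rewrite (_ : P%:R * _ = \sum_(j < P) expR (- (N%:R / (32 * 9 ^+ p)))); last first.
  by rewrite sumr_const card_ord [LHS]mulr_natl.
apply: ler_sum => j _.
apply: (@upper_tail R _ N (fun g : {ffun 'I_d -> 'I_(2 ^ n)} => phi j (gpt g) ^+ 2)).
- exact: grid_gt0.
- by move=> g; exact: sqr_ge0.
- by move=> g; apply: phi_sqr_bound => i; exact: pt_bound.
- by rewrite exprn_gt0.
- have := hn j j; rewrite eqxx mulr1n ler_norml => /andP[_].
  set a := avg _; rewrite -[X in _ -> X <= _]/a; move: a => a; lra.
- rewrite (le_trans _ (bonami_grid n (polyfun_phi j)))//.
  rewrite le_eqVlt; apply/orP; left; apply/eqP; apply: eq_avg => g.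
  by rewrite -exprM.
Qed.

(** The only link between samples and grid: good sets are described by [g], recovery is proved for
    every [z] so related to it. *)
Definition near_grid N n (g : {ffun 'I_N -> {ffun 'I_d -> 'I_(2 ^ n)}})
    (z : 'I_N -> 'I_d -> R) : Prop :=
  forall i j, `|z i j| <= 1 /\ `|z i j - gpt (g i) j| <= (2 ^+ n)^-1.

Lemma phi_close (h : R) : 0 < h -> \forall n \near \oo,
  forall N (g : {ffun 'I_N -> {ffun 'I_d -> 'I_(2 ^ n)}}) z, near_grid g z ->
  forall i (j : 'I_P), `|phi j (z i) - phi j (gpt (g i))| <= h.
Proof.
move=> h0; suff H : \forall n \near \oo, forall (j : 'I_P)
    (x y : 'I_d -> R), (forall i, `|x i| <= 1) -> (forall i, `|y i| <= 1) ->
     (forall i, `|x i - y i| <= (2 ^+ n)^-1) -> `|phi j x - phi j y| <= h.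
  apply: filterS H => n hn N g z gz i j; apply: hn => k.
  - by case: (gz i k).
  - exact: pt_bound.
  - by case: (gz i k).
apply: filter_forall => j; have [C C0 Cphi] := polyfun_lipschitz (@polyfun_phi R p d j).
have [n0 hn0] := @pow2_inv_small R (h / (C + 1)) (divr_gt0 h0 (ltr_wpDl C0 ltr01)).
exists n0 => // n /= nn x y x1 y1 xy.
rewrite (le_trans (Cphi x y _ x1 y1 xy))// (le_trans (ler_wpM2l C0 (hn0 n nn)))//.
by rewrite mulrCA ger_pMr// ler_pdivrMr ?mul1r ?lerDl ?ltr_wpDl.
Qed.

(** An entrywise error h changes [pc v] by at most h times the l1-norm of [v], whose square is at
    most P h^2 [sq v]. Young's inequality multiplies this by 101; h = 1 / (400 (P + 1)) keeps the
    product below 1 / 1000. *)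
Lemma transfer : \forall n \near \oo,
  forall N (g : {ffun 'I_N -> {ffun 'I_d -> 'I_(2 ^ n)}}) z, near_grid g z ->
  forall v : 'cV[R]_P,
  sq (phi_mx (fun i => gpt (g i)) *m v) <=
    101 / 100 * sq (phi_mx z *m v) + 1 / 1000 * (N%:R * sq v) /\
  sq (phi_mx z *m v) <=
    101 / 100 * sq (phi_mx (fun i => gpt (g i)) *m v) + 1 / 1000 * (N%:R * sq v).
Proof.
pose q : R := P%:R + 1; have q1 : 1 <= q by rewrite lerDr.
have q0 : 0 < q by exact: lt_le_trans q1.
have k0 : 0 < 1 / 400 :> R by lra.
pose h : R := 1 / 400 / q; have h0 : 0 < h by rewrite divr_gt0.
have hq : h * q = 1 / 400 by rewrite /h mulfVK// gt_eqF.
apply: filterS (phi_close h0) => n hn N g z gz v.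
have ph : 101 * (P%:R * h ^+ 2) <= 1 / 1000.
  have hP : P%:R * h <= 1 / 400.
    by rewrite -hq mulrC ler_wpM2l ?(ltW h0)// lerDl.
  have h1 : h <= 1 / 400 by rewrite -hq ler_peMr// ltW.
  have : P%:R * h * h <= 1 / 400 * (1 / 400).
    by rewrite ler_pM// ?(ltW h0)// mulr_ge0// ltW.
  by rewrite expr2 mulrA; clear; lra.
have pcle i : (pc v (z i) - pc v (gpt (g i))) ^+ 2 <= (P%:R * h ^+ 2) * sq v.
  have le1 : `|pc v (z i) - pc v (gpt (g i))| <= (\sum_j `|v j 0|) * h.
    rewrite -sumrB (le_trans (ler_norm_sum _ _ _))// mulr_suml ler_sum// => j _.
    by rewrite -mulrBr normrM ler_wpM2l// hn.
  rewrite -real_normK ?num_real// (@le_trans _ _ (((\sum_j `|v j 0|) * h) ^+ 2))//.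
    by rewrite lerXn2r ?nnegrE// (le_trans _ le1).
  by rewrite exprMn [leRHS]mulrAC ler_wpM2r ?sqr_ge0// sum_norm_sqr_le.
have gen (x y : 'I_N -> 'I_d -> R) :
    (forall i, (pc v (x i) - pc v (y i)) ^+ 2 <= (P%:R * h ^+ 2) * sq v) ->
    sq (phi_mx x *m v) <= 101 / 100 * sq (phi_mx y *m v) + 1 / 1000 * (N%:R * sq v).
  move=> xy.
  have -> : phi_mx x *m v = (phi_mx x *m v - phi_mx y *m v) + phi_mx y *m v by rewrite subrK.
  rewrite (le_trans (sqD_le _ _))// addrC lerD2l.
  apply: (@le_trans _ _ (101 * (N%:R * ((P%:R * h ^+ 2) * sq v)))).
    rewrite ler_wpM2l// [leRHS]mulr_natl -[X in _ *+ X]card_ord -sumr_const ler_sum// => i _.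
    by rewrite mxE [X in _ + X]mxE !phi_mx_mul.
  have -> : 101 * (N%:R * (P%:R * h ^+ 2 * sq v)) = 101 * (P%:R * h ^+ 2) * (N%:R * sq v) by ring.
  by rewrite ler_wpM2r// mulr_ge0// sq_ge0.
split; apply: gen => i; last exact: pcle.
by rewrite -sqrrN opprB.
Qed.

End GridEvents.

(** * Determinants of blocks of the measurement matrix *)

Section DeterminantEvents.
Context {R : realType} (p d : nat).
Let P := #|Lambda p d|.

(** On a fine grid the mean square of [pc v] is at least [sq v / 2], so the chosen basis functions
    are independent there; the evaluation matrix has full column rank, and [k] of its rows form an
    invertible block. *)
Lemma phi_points k (c : 'I_k -> 'I_P) : injective c ->
  exists z : 'I_k -> 'I_d -> R, \det (\matrix_(i, j) phi (c j) (z i)) != 0.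
Proof.
move=> c_inj; have e0 : 0 < 1 / 2 :> R by lra.
have [n _ hn] := @avg_pc_sqr R p d _ e0.
have {}hn := hn n (leqnn n).
pose G := {ffun 'I_d -> 'I_(2 ^ n)}.
pose A : 'M[R]_(#|G|, k) := \matrix_(g, j) phi (c j) (gpt (enum_val g : G)).
have Ainj (x : 'cV[R]_k) : A *m x = 0 -> x = 0.
  move=> Ax; pose v : 'cV[R]_P := \sum_j x j 0 *: delta_mx (c j) 0.
  have vE j : v j 0 = \sum_(a | c a == j) x a 0.
    rewrite summxE (bigID (fun a => c a == j))/= addrC big1 ?add0r => [|a /negbTE ca].
      by apply: eq_bigr => a /eqP ->; rewrite !mxE !eqxx mulr1.
    by rewrite !mxE eq_sym ca mulr0.
  have pcv g : pc v (gpt (g : G)) = 0.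
    have -> : pc v (gpt (g : G)) = (A *m x) (enum_rank g) 0.
      rewrite mxE /pc (eq_bigr (fun j => \sum_(a | c a == j) x a 0 * phi (c a) (gpt g))).
        rewrite [RHS](partition_big c xpredT)//=; apply: eq_bigr => j _.
        by apply: eq_bigr => a _; rewrite mxE enum_rankK mulrC.
      by move=> j _; rewrite vE mulr_suml; apply: eq_bigr => a /eqP ->.
    by rewrite Ax mxE.
  have := hn v; rewrite (@eq_avg _ _ _ (fun=> 0)) => [|g]; last by rewrite pcv expr0n.
  rewrite avg_cst ?grid_gt0// sub0r normrN ger0_norm ?sq_ge0// => vle.
  have /eqP : sq v = 0 by have := sq_ge0 v; lra.
  rewrite psumr_eq0 => [/allP v0|j _]; last exact: sqr_ge0.
  apply/matrixP => a b; rewrite ord1 mxE.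
  have := v0 (c a) (mem_index_enum _); rewrite /= sqrf_eq0 vE (big_pred1 a) => [/eqP//|].
  by move=> b'; rewrite (inj_eq c_inj).
have rfA : row_full A.
  rewrite /row_full -mxrank_tr -/(row_free _); apply: inj_row_free => v vA.
  apply: trmx_inj; rewrite trmx0; apply: Ainj.
  by rewrite -[A]trmxK -trmx_mul vA trmx0.
exists (fun i => gpt (enum_val (fullrankfun rfA i) : G)).
have := fullrowsub_unit rfA; rewrite unitmxE unitfE.
congr (\det _ != 0); apply/matrixP => i j; by rewrite !mxE.
Qed.

Lemma polyfun_det (I : eqType) k (a : nat) (f : 'I_k -> 'I_k -> (I -> R) -> R) :
  (forall i j, polyfun a (f i j)) ->
  polyfun (\sum_(i < k) a) (fun x => \det (\matrix_(i, j) f i j x)).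
Proof.
move=> pf; apply: polyfun_sum => s _; apply: polyfun_scale.
have := @polyfun_prod R I _ (index_enum 'I_k) (fun=> a) _ (fun i => pf i (s i)).
by apply: polyfun_ext => x; apply: eq_bigr => i _; rewrite mxE.
Qed.

(** The level [h] depends on [N] and [e] but not on the mesh, so the Lipschitz bound lets half of it
    survive throughout a sufficiently fine cell. *)
Lemma det_event N k (r : 'I_k -> 'I_N) (c : 'I_k -> 'I_P) (e : R) :
  injective r -> injective c -> 0 < e ->
  exists2 h : R, 0 < h & \forall n \near \oo,
    avg (fun g : {ffun 'I_N -> {ffun 'I_d -> 'I_(2 ^ n)}} =>
      (`|\det (mxsub r c (phi_mx p (fun i => gpt (g i))))| <= h)%R%:R : R) <= e /\
    forall (g : {ffun 'I_N -> {ffun 'I_d -> 'I_(2 ^ n)}}) z, near_grid g z ->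
      h < `|\det (mxsub r c (phi_mx p (fun i => gpt (g i))))| ->
      h / 2 <= `|\det (mxsub r c (phi_mx p z))|.
Proof.
move=> r_inj c_inj e0.
pose F (x : 'I_N * 'I_d -> R) := \det (\matrix_(i, j) phi (c j) (fun l => x (r i, l))).
have FE (z : 'I_N -> 'I_d -> R) :
    \det (mxsub r c (phi_mx p z)) = F (fun il => z il.1 il.2).
  by congr (\det _); apply/matrixP => i j; rewrite !mxE.
have pF : polyfun (\sum_(i < k) p) F.
  apply: polyfun_det => i j.
  exact: (polyfun_reindex (fun l => (r i, l)) (polyfun_phi (c j))).
have F0 : exists x, F x != 0.
  have [z zdet] := phi_points c_inj.
  (* Samples outside the image of [r] do not enter the determinant; they are set to 0. *)
  exists (fun il => if [pick i | r i == il.1] is Some i then z i il.2 else 0).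
  apply: contraNneq zdet => <-; apply/eqP; congr (\det _); apply/matrixP => i j.
  rewrite !mxE; congr phi; apply/funext => l /=.
  case: pickP => [i' /eqP/r_inj -> //|/(_ i)]; by rewrite eqxx.
have [h h0 [n0 hn0]] := polyfun_small_values pF F0 e0.
have [C C0 CF] := polyfun_lipschitz pF.
have [n1 hn1] := @pow2_inv_small R (h / 2 / (C + 1)) (divr_gt0 (divr_gt0 h0 (ltr0Sn R 1)) (ltr_wpDl C0 ltr01)).
exists h => //; exists (maxn n0 n1) => // n /=; rewrite geq_max => /andP[nn0 nn1]; split.
  pose nest (g : {ffun 'I_N * 'I_d -> 'I_(2 ^ n)}) : {ffun 'I_N -> {ffun 'I_d -> 'I_(2 ^ n)}} :=
    [ffun i => [ffun l => g (i, l)]].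
  have bn : bijective nest.
    exists (fun g : {ffun 'I_N -> {ffun 'I_d -> 'I_(2 ^ n)}} => [ffun il => g il.1 il.2]).
      by move=> g; apply/ffunP => -[i l]; rewrite !ffunE.
    by move=> g; apply/ffunP => i; apply/ffunP => l; rewrite !ffunE.
  rewrite (avg_bij _ bn) (le_trans _ (hn0 n nn0))// le_eqVlt; apply/orP; left; apply/eqP.
  apply: eq_avg => g /=; rewrite FE; congr ((`|F _| <= h)%R%:R).
  by apply/funext => -[i l]; rewrite /gpt /nest !ffunE.
move=> g z gz; rewrite !FE => hF.
have := CF (fun il => z il.1 il.2) (fun il => gpt (g il.1) il.2) (2 ^+ n)^-1.
move=> /(_ (fun il => (gz il.1 il.2).1) (fun il => pt_bound _) (fun il => (gz il.1 il.2).2)).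
have : C * (2 ^+ n)^-1 <= h / 2.
  rewrite (le_trans (ler_wpM2l C0 (hn1 n nn1)))// mulrCA ger_pMr ?divr_gt0//.
  by rewrite ler_pdivrMr ?mul1r ?lerDl ?ltr_wpDl.
move: hF; set a := F _; set b := F _ => hF h1 h2.
by have := ler_normB b (b - a); rewrite opprB addrC subrK; lra.
Qed.

End DeterminantEvents.

(** * Uniform recovery *)

Section SuccessBound.
Context {R : realType} (p d : nat) (hd : (0 < d)%N) (hp : (0 < p)%N).
Let P := num_pc p d.

Lemma num_pc_ge2 : (2 <= P)%N.
Proof.
have -> : P = 'C(p + d, p).
  rewrite /P /num_pc -(@bin_fact (p + d) p) ?leq_addr// addKn mulnK//.
  by rewrite muln_gt0 !fact_gt0.
case: p hp => // p' _; case: d hd => // d' _.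
by rewrite addSn binS -[2%N]/(1 + 1)%N leq_add// bin_gt0 ?leq_addr// addnS ltnS leq_addr.
Qed.

Let P0 : 0 < P%:R :> R.
Proof. by rewrite ltr0n (leq_trans _ num_pc_ge2). Qed.

Lemma ln_num_pc_gt0 : 0 < ln P%:R :> R.
Proof. by rewrite ln_gt0// ltr1n num_pc_ge2. Qed.

Lemma num_pc_powR (x : R) : P%:R `^ x = expR (x * ln P%:R).
Proof. by rewrite /powR gt_eqF. Qed.

Lemma num_pc_powR_c : P%:R `^ (4 * c_pd R p d) = 9 ^+ p.
Proof.
rewrite num_pc_powR /c_pd -/P.
have -> : 4 * (ln 3 / 2 * (p%:R / ln P%:R)) * ln P%:R = p%:R * (2%:R * ln 3) :> R.
  by field; rewrite gt_eqF// ln_num_pc_gt0.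
by rewrite !expRM_natl lnK ?posrE// -natrX.
Qed.

Lemma S_maxE N : S_max R p d N = N%:R / (64 * 9 ^+ p * ln P%:R).
Proof. by rewrite /S_max -/P num_pc_powR_c. Qed.

(** In base e the first and last terms become exact exponentials in [N]; the inequality is the
    positivity of the middle one. *)
Lemma success_bound_le N :
  success_bound R p d N <=
  1 - 4 * P%:R ^+ 2 * expR (- (N%:R / (32 * 9 ^+ p))) - expR (- (N%:R / 8)).
Proof.
have B0 : 9 ^+ p != 0 :> R by rewrite expf_neq0.
have L0 : ln P%:R != 0 :> R by rewrite gt_eqF// ln_num_pc_gt0.
rewrite /success_bound -/P num_pc_powR_c S_maxE !num_pc_powR.
have -> : (2 - 2 * (N%:R / (64 * 9 ^+ p * ln P%:R))) * ln P%:R =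
    2%:R * ln P%:R + - (N%:R / (32 * 9 ^+ p)) :> R by field; rewrite B0 L0.
have -> : - 8 * (N%:R / (64 * 9 ^+ p * ln P%:R)) * 9 ^+ p * ln P%:R = - (N%:R / 8) :> R.
  by field; rewrite B0 L0.
rewrite expRD expRM_natl lnK ?posrE// mulrA lerD2r lerBlDr lerDl.
exact: expR_ge0.
Qed.

End SuccessBound.

(** * At least as many samples as basis functions *)

Section Regimes.
Context {R : realType} (p d : nat) (hd : (0 < d)%N) (hp : (0 < p)%N).
Let P := #|Lambda p d|.
Let PE : P = num_pc p d. Proof. exact: card_Lambda. Qed.
Let B : R := 9 ^+ p.

(** The good set may depend on [S] but not on the data, the noise level or the minimizer, which are
    quantified after it. *)
Definition recoverable (N : nat) (K : R) : Prop :=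
  forall S : {set 'I_P}, #|S|%:R < S_max R p d N ->
  exists n (good : pred {ffun 'I_N -> {ffun 'I_d -> 'I_(2 ^ n)}}),
    success_bound R p d N <= avg (fun g => (good g)%:R) /\
    forall g, good g -> forall z, near_grid g z ->
    forall (u : 'cV[R]_N) (c0 c : 'cV[R]_P) (delta eps : R),
      0 <= delta -> 0 <= eps -> (forall j, j \notin S -> c0 j 0 = 0) ->
      (forall i, `|u i 0 - (phi_mx p z *m c0) i 0| <= eps) ->
      l1_solution (phi_mx p z) u delta c ->
      forall j, `|c j 0 - c0 j 0| <= K * (eps + delta / Num.sqrt N%:R).

Lemma recoverableW N K K' : K <= K' -> recoverable N K -> recoverable N K'.
Proof.
move=> KK' rK S SN; have [n [good [h1 h2]]] := rK S SN.
exists n, good; split=> // g gg z gz u c0 c delta eps d0 e0 S0 ue sol j.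
rewrite (le_trans (h2 _ gg _ gz _ _ _ _ _ d0 e0 S0 ue sol j))//.
by rewrite ler_wpM2r// addr_ge0// divr_ge0// sqrtr_ge0.
Qed.

Lemma avg_predC (T : finType) (b : pred T) : (0 < #|T|)%N ->
  avg (fun x => (~~ b x)%:R : R) = 1 - avg (fun x => (b x)%:R).
Proof.
move=> T0; apply/eqP; rewrite -subr_eq opprK -avgD -[X in _ == X](@avg_cst R T)//.
by apply/eqP; apply: eq_avg => x; case: (b x); rewrite ?addr0 ?add0r.
Qed.

Lemma avg_orb (T : finType) (b1 b2 : pred T) :
  avg (fun x => (b1 x || b2 x)%:R : R) <=
  avg (fun x => (b1 x)%:R) + avg (fun x => (b2 x)%:R).
Proof.
by rewrite -avgD; apply: avg_le => x; case: (b1 x) => /=; rewrite ?lerDl ?add0r.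
Qed.

Lemma samples_gt0 N n : (0 < #|{ffun 'I_N -> {ffun 'I_d -> 'I_(2 ^ n)}}|)%N.
Proof. by rewrite card_ffun expn_gt0 grid_gt0. Qed.

Lemma phi_mx_bound N n (g : {ffun 'I_N -> {ffun 'I_d -> 'I_(2 ^ n)}}) z :
  near_grid g z -> forall i (j : 'I_P), `|phi_mx p z i j| <= 3 ^+ p :> R.
Proof.
move=> gz i j; rewrite mxE -ler_sqr ?nnegrE ?exprn_ge0//.
rewrite real_normK ?num_real// -exprM mulnC exprM -natrX.
by apply: phi_sqr_bound => l; case: (gz i l).
Qed.

(** Residuals are bounded coordinatewise by delta + eps, which loses a factor sqrt N against the
    target; the loss goes into [K], here allowed to depend on [N]. *)
Lemma recoverable_tall N : (0 < N)%N -> (P <= N)%N ->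
  exists2 K : R, 0 <= K & recoverable N K.
Proof.
move=> N0 PN; pose f (j : 'I_P) : 'I_N := widen_ord PN j.
have f_inj : injective f by move=> i j /(congr1 val) /= /val_inj.
have e0 : 0 < expR (- (N%:R / 8)) :> R by exact: expR_gt0.
have [h h0 ev] := @det_event R p d N P f id _ f_inj (@inj_id _) e0.
have [K K0 solve] := @solve_bound R P (3 ^+ p) (h / 2) (exprn_ge0 _ (ler0n _ 3)) (divr_gt0 h0 (ltr0Sn R 1)).
have rN0 : 0 < Num.sqrt N%:R :> R by rewrite sqrtr_gt0 ltr0n.
exists (K * (1 + Num.sqrt N%:R)); first by rewrite mulr_ge0// addr_ge0// ltW.
move=> S _; case: ev => n _ /(_ n (leqnn n)) [ev1 ev2].
exists n, (fun g => ~~ (`|\det (mxsub f id (phi_mx p (fun i => gpt (g i))))| <= h)); split.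
  rewrite avg_predC ?samples_gt0//.
  by rewrite (le_trans (@success_bound_le R p d hd hp N))// lerB.
move=> g; rewrite -ltNge => gh z gz u c0 c delta eps d0 eps0 S0 ue sol j.
have := @recovery_tall R N P _ u delta eps c c0 ue sol f K.
move=> /(_ _ j) rec; rewrite (le_trans (rec _))//.
  move=> x E; apply: solve; last exact: ev2 gz gh.
  by move=> i k; rewrite mxE (phi_mx_bound gz).
rewrite -mulrA ler_wpM2l//.
have -> : (1 + Num.sqrt N%:R) * (eps + delta / Num.sqrt N%:R) =
  delta + eps + (Num.sqrt N%:R * eps + delta / Num.sqrt N%:R).
  by field; rewrite gt_eqF.
by rewrite lerDl addr_ge0// ?mulr_ge0 ?divr_ge0 ?sqrtr_ge0.
Qed.

(** Amounts to 0.99 a - 0.001 >= 1.01 * 0.976 a, true for a >= 1 / 4. *)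
Lemma lower_transfer (x y a N : R) (s : R) : 0 <= s -> 0 <= N -> 1 / 4 <= a -> a <= 1 ->
  N * (a * (99 / 100 * s)) <= x -> x <= 101 / 100 * y + 1 / 1000 * (N * s) ->
  (976 / 1000 * a) * (N * s) <= y.
Proof.
move=> s0 N0 a1 a2; have Ns := mulr_ge0 N0 s0.
have -> : N * (a * (99 / 100 * s)) = 99 / 100 * (a * (N * s)) by ring.
have -> : 976 / 1000 * a * (N * s) = 976 / 1000 * (a * (N * s)) by ring.
have : 1 / 4 * (N * s) <= a * (N * s) by rewrite ler_wpM2r.
by set b := a * _; lra.
Qed.

Lemma col_lower_transfer (x y N : R) : 0 <= N -> N * ((1 - 1 / 4) * (99 / 100)) <= x ->
  x <= 101 / 100 * y + 1 / 1000 * N -> 7 / 10 * N <= y.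
Proof. by move=> N0 h1 h2; lra. Qed.

(** The threshold 277 / 200 is chosen for this: 1.01 * 1.385 + 0.001 < 1.4. *)
Lemma col_upper_transfer (x y N : R) : 0 <= N -> x < N * (277 / 200) ->
  y <= 101 / 100 * x + 1 / 1000 * N -> y <= 7 / 5 * N.
Proof. by move=> N0 h1 h2; lra. Qed.

Section Net.
Let C : R := 3 ^+ p.
(** A coordinate error 1 / [H] moves each entry of [A *m v] by at most P C / H = 1 / 100. *)
Let H : nat := (100 * P * 3 ^ p)%N.
Let H0 : (0 < H)%N.
Proof. by rewrite !muln_gt0/= expn_gt0 andbT PE (leq_trans _ (num_pc_ge2 hd hp)). Qed.

Definition net_vector (k : {ffun 'I_P -> 'I_(2 * H).+1}) : 'cV[R]_P :=
  \col_j ((k j)%:R / H%:R - 1).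

(** Divided by its largest coordinate in absolute value, [x] lies in the cube covered by the net;
    its rounding has [sq v >= 98 / 100], and the image of the rounding error is negligible. The
    sup-norm fits, as single coordinates are to be bounded. *)
Lemma net_invertible N (A : 'M[R]_(N, P)) :
  (forall i j, `|A i j| <= C) ->
  (forall k, 1 / 4 * (N%:R * sq (net_vector k)) <= sq (A *m net_vector k)) ->
  forall j (x : 'cV[R]_P), N%:R * x j 0 ^+ 2 <= 25 * sq (A *m x).
Proof.
move=> AC low j x.
have [i0 _ imax] := @arg_maxP _ _ _ j predT (fun i => `|x i 0|) isT.
have {}imax i : `|x i 0| <= `|x i0 0| by exact: imax.
set a := `|x i0 0| in imax.
have [a_eq0|a_neq0] := eqVneq a 0.
  have : `|x j 0| <= 0 by rewrite -a_eq0; exact: imax.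
  by rewrite normr_le0 => /eqP ->; rewrite expr0n mulr0 mulr_ge0// sq_ge0.
have a0 : 0 < a by rewrite lt_neqAle eq_sym a_neq0 normr_ge0.
have HR : 0 < H%:R :> R by rewrite ltr0n.
have N0 : 0 <= N%:R :> R by [].
pose y := a^-1 *: x.
have y1 i : `|y i 0| <= 1.
  by rewrite mxE normrM normfV (gtr0_norm a0) mulrC ler_pdivrMr// mul1r imax.
have yi0 : `|y i0 0| = 1 by rewrite mxE normrM normfV (gtr0_norm a0) mulVf.
have r0 i : 0 <= (y i 0 + 1) * H%:R.
  rewrite mulr_ge0 ?(ltW HR)//.
  by have := y1 i; rewrite ler_norml => /andP[+ _]; lra.
pose k : {ffun 'I_P -> 'I_(2 * H).+1} := [ffun i => inord (Num.truncn ((y i 0 + 1) * H%:R))].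
pose v := net_vector k.
have vy i : `|v i 0 - y i 0| <= H%:R^-1.
  rewrite /v [net_vector k i 0]mxE ffunE inordK; last first.
    rewrite ltnS -(ler_nat R) (le_trans (_ : _ <= (y i 0 + 1) * H%:R)) ?truncn_le//.
    rewrite natrM ler_pM2r//.
    by have := y1 i; rewrite ler_norml => /andP[_]; lra.
  have := truncn_itv (r0 i); set T := Num.truncn _; rewrite -[T.+1%:R]natr1 => /andP[h1 h2].
  have -> : T%:R / H%:R - 1 - y i 0 = - ((y i 0 + 1) * H%:R - T%:R) / H%:R.
    by field; rewrite gt_eqF.
  rewrite normrM normrN (ger0_norm (_ : 0 <= H%:R^-1)) ?invr_ge0 ?(ltW HR)//.
  by rewrite ler_piMl ?invr_ge0 ?(ltW HR)// ger0_norm; lra.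
have PCH : P%:R * C * H%:R^-1 = 1 / 100.
  have HE : H%:R = 100 * (P%:R * C) by rewrite /H /C -mulnA !natrM natrX.
  have q0 : P%:R * C != 0 by move: HR; rewrite HE; apply: contraTneq => ->; rewrite mulr0 ltxx.
  by rewrite HE; move: (P%:R * C) q0 => q q0; field.
have H1 : H%:R^-1 <= 1 / 100 :> R.
  rewrite -PCH ler_peMl ?invr_ge0 ?(ltW HR)//.
  rewrite mulr_ege1 ?exprn_ege1 ?ler1n//.
  by rewrite PE (leq_trans _ (num_pc_ge2 hd hp)).
have sqv : 98 / 100 <= sq v.
  rewrite /sq (bigD1 i0)//= (@le_trans _ _ (v i0 0 ^+ 2))//; last first.
    by rewrite lerDl sumr_ge0// => i _; exact: sqr_ge0.
  have : 99 / 100 <= `|v i0 0|.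
    have := ler_normB (v i0 0) (v i0 0 - y i0 0); rewrite opprB addrCA subrr addr0 yi0.
    by have := vy i0; lra.
  by rewrite -[v i0 0 ^+ 2]real_normK ?num_real//; nra.
have small : sq (A *m (v - y)) <= N%:R * (1 / 100) ^+ 2.
  rewrite /sq [leRHS]mulr_natl -[X in _ *+ X]card_ord -sumr_const ler_sum// => i _.
  rewrite -real_normK ?num_real// lerXn2r ?nnegrE//.
  rewrite mxE (le_trans (ler_norm_sum _ _ _))// -PCH -mulrA [leRHS]mulr_natl.
  rewrite -[X in _ *+ X]card_ord -sumr_const ler_sum// => l _.
  by rewrite normrM ler_pM// !mxE; have := vy l; rewrite !mxE.
have := low k; rewrite -/v => lowv.
have : sq (A *m v) <= 101 * sq (A *m (v - y)) + 101 / 100 * sq (A *m y).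
  by rewrite (le_trans _ (sqD_le _ _))// -mulmxDr subrK.
have : 98 / 100 * N%:R <= N%:R * sq v by rewrite mulrC ler_wpM2l.
have -> : sq (A *m y) = sq (A *m x) / a ^+ 2.
  by rewrite /y -scalemxAr sqZ exprVn mulrC.
move: small lowv; set z := sq (A *m x) / a ^+ 2 => h1 h2 h3 h4.
have {h1 h2 h3 h4} : N%:R <= 25 * z by clear -h1 h2 h3 h4 N0; rewrite expr2 in h1; lra.
rewrite /z mulrA ler_pdivlMr ?exprn_gt0// => h.
rewrite (le_trans _ h)// ler_wpM2l//.
by rewrite -[x j 0 ^+ 2]real_normK ?num_real// ler_sqr ?nnegrE// ltW.
Qed.

Lemma recoverable_net : exists N0, forall N, (0 < N)%N -> (N0 <= N)%N -> recoverable N 8.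
Proof.
pose J := {ffun 'I_P -> 'I_(2 * H).+1}.
have B0 : 0 < B by rewrite exprn_gt0.
exists (Num.truncn (32 * B * #|J|%:R)).+1 => N N0 NN S _.
have [n _ ev] := filterI (@lower_event R p d) (@transfer R p d).
have {ev} [lowe trans] := ev n (leqnn n).
have t01 : 0 <= (1 / 2 : R) <= 1 by apply/andP; split; lra.
exists n, (fun g => ~~ [exists k : J, sq (phi_mx p (fun i => gpt (g i)) *m net_vector k)
   < N%:R * ((1 - 1 / 2) * (99 / 100 * sq (net_vector k)))]); split.
  rewrite avg_predC ?samples_gt0// (le_trans (@success_bound_le R p d hd hp N))//.
  rewrite -addrA lerD2l -opprD lerN2 (le_trans (lowe N J net_vector _ t01))//.
  rewrite (le_trans (y := 4 * (num_pc p d)%:R ^+ 2 * expR (- (N%:R / (32 * 9 ^+ p)))))//; last first.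
    by rewrite lerDl expR_ge0.
  (* Deviation 1 / 2 has exponent N / (8 B) = N / (32 B) + 3 N / (32 B); the surplus beats the size
     of the net once [N] exceeds 32 B times that size. *)
  have -> : - (N%:R * (1 / 2) ^+ 2 / (2 * 9 ^+ p)) =
     - (N%:R / (32 * B)) + - (3 * (N%:R / (32 * B))) :> R.
    by rewrite -/B; field; rewrite gt_eqF.
  rewrite expRD mulrCA mulrC -/B ler_wpM2r ?expR_ge0//.
  rewrite (@le_trans _ _ 1)//; last first.
    have : 1 <= (num_pc p d)%:R :> R by rewrite ler1n (leq_trans _ (num_pc_ge2 hd hp)).
    by move: (_%:R) => q; nra.
  rewrite expRN ler_pdivrMr ?expR_gt0// mul1r (le_trans _ (expR_ge1Dx _))//.
  have : #|J|%:R <= N%:R / (32 * B).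
    rewrite ler_pdivlMr ?mulr_gt0// mulrC (le_trans (ltW (truncnS_gt _)))//.
    by rewrite ler_nat.
  have : 0 <= N%:R / (32 * B) by rewrite divr_ge0// mulr_ge0// ltW.
  by lra.
move=> g; rewrite negb_exists => /forallP good z gz u c0 c delta eps d0 e0 _ ue sol.
apply: (recovery_net ue sol N0 d0 e0).
apply: net_invertible; first exact: phi_mx_bound gz.
move=> k; have := good k; rewrite -leNgt => gk.
have [tr _] := trans N g z gz (net_vector k).
have := lower_transfer (sq_ge0 _) (ler0n R N) _ _ gk tr.
have Nk : 0 <= N%:R * sq (net_vector k) by rewrite mulr_ge0// sq_ge0.
by move: Nk; set q := N%:R * sq _ => q0 h; have {}h := h ltac:(lra) ltac:(lra); lra.
Qed.

End Net.

End Regimes.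

(** * Fewer samples than basis functions, and synthesis of the regimes *)

Section SparseRegime.
Context {R : realType} (p d : nat) (hd : (0 < d)%N) (hp : (0 < p)%N).
Let P := #|Lambda p d|.
Let PE : P = num_pc p d. Proof. exact: card_Lambda. Qed.
Let B : R := 9 ^+ p.
Let L : R := ln P%:R.

Let B0 : 0 < B. Proof. by rewrite exprn_gt0. Qed.
Let P2 : (2 <= P)%N. Proof. by rewrite PE num_pc_ge2. Qed.
Let L0 : 0 < L. Proof. by rewrite /L PE ln_num_pc_gt0. Qed.
Let PL : P%:R = expR L. Proof. by rewrite lnK// posrE ltr0n (leq_trans _ P2). Qed.
Let tau N : R := expR (- (N%:R / (32 * B))).

Lemma sample_lower_bound N : 0 < success_bound R p d N -> 64 * B * L < N%:R.
Proof.
move=> /lt_le_trans/(_ (@success_bound_le R p d hd hp N)) h.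
have {}h : P%:R ^+ 2 * tau N < 1.
  have e1 : 0 < expR (- (N%:R / 8)) :> R by exact: expR_gt0.
  have t0 : 0 <= P%:R ^+ 2 * tau N by rewrite mulr_ge0 ?expR_ge0// sqr_ge0.
  by move: h; rewrite -PE -mulrA -/(tau N); move: t0 e1; set a := _ * tau N; lra.
move: h; rewrite PL -expRM_natl -expRD expR_lt1 subr_lt0.
by rewrite ltr_pdivlMr ?mulr_gt0//; set n := N%:R; lra.
Qed.

(** With N < P the sample bound gives P > 576 ln P; starting from ln P >= 1 / 2 this means P > 288,
    hence ln P >= 2. *)
Lemma large_num_pc N : 0 < success_bound R p d N -> (N < P)%N ->
  2 <= L /\ (2 ^ 7 <= P)%N.
Proof.
move=> /sample_lower_bound NL NP.
have h9 : 9 <= B.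
  by rewrite -[leLHS]expr1 ler_eXn2l// ltr1n.
have PB : 576 * L < P%:R.
  apply: lt_trans (_ : N%:R < _); last by rewrite ltr_nat.
  apply: le_lt_trans NL; rewrite ler_pM2r//; lra.
have L1 : 1 / 2 <= L.
  have := expR_ge1Dx (- L); rewrite expRN -PL.
  have : (P%:R)^-1 <= 2^-1 :> R.
    by rewrite lef_pV2 ?posrE// ?ler_nat// ltr0n (leq_trans _ P2).
  lra.
have P288 : 288 < P%:R :> R by lra.
have P128 : (2 ^ 7 <= P)%N by rewrite -(ler_nat R) natrX; lra.
split=> //; rewrite -ler_expR -PL.
have h1 : expR (3^-1) <= 13 / 9 :> R.
  by have := @expR_le_quadratic R (3^-1); rewrite invr_ge0 lexx ler0n => /(_ isT isT); lra.
have -> : 2 = 6%:R * 3^-1 :> R by field.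
rewrite expRM_natl (@le_trans _ _ ((13 / 9) ^+ 6))//; last by lra.
by rewrite lerXn2r ?nnegrE ?expR_ge0// divr_ge0.
Qed.

Lemma sparsity_bound N (s : nat) : 0 < success_bound R p d N -> (N < P)%N ->
  s%:R < S_max R p d N -> (801 * s <= P)%N /\ 64 * B * L * s%:R <= N%:R.
Proof.
move=> sb NP; have [L2 _] := large_num_pc sb NP.
rewrite (S_maxE hd hp) -PE -/B -/L ltr_pdivlMr ?mulr_gt0// mulrC => sN.
split; last exact: ltW.
have h9 : 9 <= B by rewrite -[leLHS]expr1 ler_eXn2l// ltr1n.
have NP' : N%:R < P%:R :> R by rewrite ltr_nat.
(* Then 64 * 18 = 1152 leaves room for the factor 801. *)
have BL : 18 <= B * L by nra.
rewrite -(ler_nat R) natrM; have s0 : 0 <= s%:R :> R by [].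
have : 18 * s%:R <= B * L * s%:R by rewrite ler_wpM2r.
have : 64 * (B * L * s%:R) < N%:R by rewrite !mulrA in sN *.
by lra.
Qed.

(** There are at most P^(16 s) test vectors, as 2^13 <= P^2, and 64 B L s <= N bounds this by exp(N
    / (4 B)). Finally 9 / 32 - 1 / 4 = 1 / 32. *)
Lemma test_index_count N (S : {set 'I_P}) : 0 < success_bound R p d N -> (N < P)%N ->
  #|S|%:R < S_max R p d N ->
  #|test_index S|%:R * expR (- (N%:R * (3 / 4) ^+ 2 / (2 * B))) <= tau N.
Proof.
move=> sb NP SN; have [L2 P128] := large_num_pc sb NP.
have [_ sN] := sparsity_bound sb NP SN.
have : #|test_index S|%:R <= expR (N%:R / (4 * B)).
  apply: (@le_trans _ _ ((P ^ (16 * #|S|))%:R)).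
    rewrite ler_nat card_test_index !expnM -expnMn.
    have base : (P * (2 * P) ^ 13 <= P ^ 16)%N.
      rewrite expnMn mulnCA -expnS (leq_trans (leq_mul (_ : 2 ^ 13 <= P ^ 2)%N (leqnn _)))//.
        by rewrite (leq_trans (n := (2 ^ 7) ^ 2)%N) ?leq_exp2r// -expnM leq_exp2l.
      by rewrite -expnD.
    case: #|S| => // s; by rewrite leq_exp2r.
  rewrite natrX PL -expRM_natl ler_expR ler_pdivlMr ?mulr_gt0//.
  rewrite natrM; apply: le_trans sN; rewrite le_eqVlt; apply/orP; left; apply/eqP; ring.
move=> /(ler_wpM2r (expR_ge0 (- (N%:R * (3 / 4) ^+ 2 / (2 * B))))) /le_trans; apply.
rewrite -expRD ler_expR le_eqVlt; apply/orP; left; apply/eqP.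
by field; rewrite gt_eqF.
Qed.

Lemma sq_delta (j : 'I_P) : sq (delta_mx j 0 : 'cV[R]_P) = 1.
Proof.
rewrite /sq (bigD1 j)//= !mxE !eqxx expr1n big1 ?addr0// => i /negbTE ij.
by rewrite mxE ij expr0n.
Qed.

Lemma sq_col_phi_mx N (z : 'I_N -> 'I_d -> R) (j : 'I_P) :
  sq (phi_mx p z *m delta_mx j 0) = \sum_i phi j (z i) ^+ 2.
Proof. by apply: eq_bigr => i _; rewrite -colE !mxE. Qed.

(** The solution is supported on the selected columns; the entries of the padding matrix are at most
    1, whence the factor [N]. *)
Lemma colsub_solve N (A : 'M[R]_(N, P)) (c : 'I_N -> 'I_P) (K : R) :
  0 <= K -> colsub c A \in unitmx ->
  (forall (x : 'cV[R]_N) E, (forall i, `|(colsub c A *m x) i 0| <= E) ->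
     forall j, `|x j 0| <= K * E) ->
  forall (e : 'cV[R]_N) E, (forall i, `|e i 0| <= E) ->
    exists2 h : 'cV[R]_P, A *m h = e & forall j, `|h j 0| <= N%:R * K * E.
Proof.
move=> K0 Au solve e E eE; pose x := invmx (colsub c A) *m e.
have Ax : colsub c A *m x = e by rewrite mulKVmx.
have xK j : `|x j 0| <= K * E by apply: solve => i; rewrite Ax.
exists (colsub c 1%:M *m x) => [|j].
  by rewrite mulmxA mulmx_colsub mulmx1.
rewrite mxE (le_trans (ler_norm_sum _ _ _))// -mulrA [leRHS]mulr_natl.
rewrite -[X in _ *+ X]card_ord -sumr_const ler_sum// => i _.
rewrite normrM -[leRHS]mul1r ler_pM// !mxE.
by case: eqP => _; rewrite ?normr1 ?normr0.
Qed.

Lemma recoverable_sparse N : (0 < N)%N -> (N < P)%N ->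
  exists2 K : R, 0 <= K & recoverable p d N K.
Proof.
move=> N0 NP; pose f (i : 'I_N) : 'I_P := widen_ord (ltnW NP) i.
have t1 : 0 <= (3 / 4 : R) <= 1 by apply/andP; split; lra.
have t2 : 0 <= (1 / 4 : R) <= 1 by apply/andP; split; lra.
have q1 : 1 / 4 <= 1 - 3 / 4 :> R by lra.
have q2 : 1 - 3 / 4 <= 1 :> R by lra.
have q24 : 24 / 100 <= 976 / 1000 * (1 - 3 / 4) :> R by lra.
have prefactor : 1 + P%:R + P%:R <= 4 * P%:R ^+ 2 :> R.
  have : 2 <= P%:R :> R by rewrite ler_nat.
  by move: (P%:R) => q q2'; nra.
have f_inj : injective f by move=> i j /(congr1 val) /= /val_inj.
have e0 : 0 < expR (- (N%:R / 8)) :> R by exact: expR_gt0.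
have N0' : 0 < N%:R :> R by rewrite ltr0n.
have [h h0 ev4] := @det_event R p d N N id f _ (@inj_id _) f_inj e0.
have [K K0 solve] := @solve_bound R N (3 ^+ p) (h / 2) (exprn_ge0 _ (ler0n _ 3)) (divr_gt0 h0 (ltr0Sn R 1)).
have rN0 : 0 < Num.sqrt N%:R :> R by rewrite sqrtr_gt0.
have q75 : 7 / 5 <= 2 ^+ 2 * (7 / 10) :> R by lra.
have P300 : 0 <= 1 + 300 * P%:R :> R by have := ler0n R P; lra.
exists ((1 + 300 * P%:R) * (N%:R * K) * (1 + Num.sqrt N%:R)).
  by rewrite (mulr_ge0 (mulr_ge0 P300 (mulr_ge0 (ltW N0') K0)))// addr_ge0// ltW.
move=> S SN.
(* A nonpositive bound is met by the empty event; otherwise the counting estimates are available. *)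
have [sb|sb] := leP (success_bound R p d N) 0.
  exists 0%N, pred0; split=> //.
  by rewrite (le_trans sb)// avg_ge0.
have [n _ ev] := filterI (filterI (@lower_event R p d) (@upper_event R p d))
  (filterI (@transfer R p d) ev4).
have {ev ev4} [[lowe uppe] [trans [dete detz]]] := ev n (leqnn n).
pose G := {ffun 'I_N -> {ffun 'I_d -> 'I_(2 ^ n)}}.
pose M (g : G) : 'M[R]_(N, P) := phi_mx p (fun i => gpt (g i)).
pose bad1 (g : G) := [exists k : test_index S, sq (M g *m test_vector k)
   < N%:R * ((1 - 3 / 4) * (99 / 100 * sq (test_vector k)))].
pose bad2 (g : G) := [exists j : 'I_P, sq (M g *m delta_mx j 0)
   < N%:R * ((1 - 1 / 4) * (99 / 100 * sq (delta_mx j 0 : 'cV[R]_P)))].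
pose bad3 (g : G) := [exists j : 'I_P, N%:R * (277 / 200) <= \sum_i phi j (gpt (g i)) ^+ 2 :> R].
pose bad4 (g : G) := `|\det (mxsub id f (M g))| <= h.
exists n, (fun g => ~~ ((bad1 g || bad2 g) || (bad3 g || bad4 g))); split.
  rewrite avg_predC ?samples_gt0// (le_trans (@success_bound_le R p d hd hp N))//.
  rewrite -addrA lerD2l -opprD lerN2 (le_trans (@avg_orb _ _ _ _))//.
  rewrite (le_trans (lerD (@avg_orb R _ _ _) (@avg_orb R _ _ _)))//.
  have b1 := le_trans (lowe N _ (@test_vector R P S) _ t1) (test_index_count sb NP SN).
  have b2 := lowe N 'I_P (fun j => delta_mx j 0) _ t2.
  have b3 := uppe N.
  rewrite -/(tau N) in b3.
  have tE : expR (- (N%:R * (1 / 4) ^+ 2 / (2 * 9 ^+ p))) = tau N.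
    by congr expR; rewrite -/B; field; rewrite gt_eqF.
  rewrite tE card_ord in b2.
  rewrite addrA lerD// -/B -/(tau N) -PE.
  (* The three tail events cost 1, [P] and [P] times [tau N]; the determinant event has been matched
     with exp(-N / 8). *)
  rewrite (le_trans (lerD (lerD b1 b2) b3))//.
  have -> : tau N + #|Lambda p d|%:R * tau N + P%:R * tau N = (1 + P%:R + P%:R) * tau N.
    by rewrite /P; ring.
  by rewrite ler_wpM2r ?expR_ge0//.
move=> g; rewrite !negb_or => /andP[/andP[g1 g2] /andP[g3 g4]] z gz.
move=> u c0 c delta eps d0 eps0 S0 ue sol j.
have [NSP _] := sparsity_bound sb NP SN.
have colz i : 7 / 10 * N%:R <= sq (col i (phi_mx p z)) <= 7 / 5 * N%:R.
  rewrite colE; have [tr1 tr2] := trans N g z gz (delta_mx i 0).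
  rewrite sq_delta mulr1 in tr1 tr2; apply/andP; split.
    move: g2; rewrite negb_exists => /forallP/(_ i); rewrite -leNgt sq_delta mulr1 -/(M g) => lo.
    exact: col_lower_transfer (ltW N0') lo tr1.
  move: g3; rewrite negb_exists => /forallP/(_ i); rewrite -ltNge -sq_col_phi_mx -/(M g) => up.
  exact: col_upper_transfer (ltW N0') up tr2.
have nsp (eta : 'cV[R]_P) : phi_mx p z *m eta = 0 ->
   \sum_(j in S) l2norm (col j (phi_mx p z)) * `|eta j 0| <=
   97 / 100 * \sum_(j | j \notin S) l2norm (col j (phi_mx p z)) * `|eta j 0|.
  move=> eta0; have := @null_space_property R N P (phi_mx p z) S eta N0 NSP colz _ eta0.
  apply=> k.
  have [tr _] := trans N g z gz (test_vector k).
  move: g1; rewrite negb_exists => /forallP/(_ k); rewrite -leNgt => lo.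
  have := lower_transfer (sq_ge0 _) (ler0n R N) _ _ lo tr.
  have Nk : 0 <= N%:R * sq (@test_vector R P S k) by rewrite mulr_ge0// sq_ge0.
  move=> /(_ q1 q2); apply: le_trans; rewrite -mulrA.
  apply: le_trans (ler_wpM2r Nk q24); rewrite ler_wpM2l// ?divr_ge0// ler_wpM2l// /sq [leRHS](bigID (mem S))/=.
  by rewrite lerDl sumr_ge0// => i _; exact: sqr_ge0.
have dz : h / 2 <= `|\det (mxsub id f (phi_mx p z))| by apply: detz gz _; rewrite ltNge.
have fu : colsub f (phi_mx p z) \in unitmx.
  rewrite unitmxE unitfE -normr_gt0 (lt_le_trans _ dz)// divr_gt0//.
have fs := @colsub_solve N (phi_mx p z) f K K0 fu.
pose b : R := Num.sqrt (7 / 10 * N%:R).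
have b2 : b ^+ 2 = 7 / 10 * N%:R by rewrite sqr_sqrtr// mulr_ge0// divr_ge0.
have b0 : 0 < b by rewrite sqrtr_gt0 mulr_gt0// divr_gt0.
have wb i : b <= l2norm (col i (phi_mx p z)) <= 2 * b.
  have /andP[c1 c2] := colz i; rewrite -l2norm_sqr in c1 c2.
  have w0 : 0 <= l2norm (col i (phi_mx p z)) by exact: sqrtr_ge0.
  have b20 : 0 <= 2 * b by rewrite mulr_ge0// ltW.
  apply/andP; split; rewrite -ler_sqr ?nnegrE ?(ltW b0)//.
    by rewrite b2.
  by rewrite (le_trans c2)// exprMn b2 mulrA; apply: ler_wpM2r q75; exact: ltW.
have := @recovery_sparse R N P (phi_mx p z) u delta eps c c0 ue sol S (N%:R * K) b.
move=> /(_ (mulr_ge0 (ltW N0') K0) d0 b0 wb) rec.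
rewrite (le_trans (rec _ nsp S0 eps0 j))//.
  apply: fs => x E; apply: solve; last exact: dz.
  by move=> i k; rewrite mxE (phi_mx_bound gz).
rewrite -[leRHS]mulrA; apply: ler_wpM2l.
  exact: (mulr_ge0 P300 (mulr_ge0 (ltW N0') K0)).
have -> : (1 + Num.sqrt N%:R) * (eps + delta / Num.sqrt N%:R) =
  delta + eps + (Num.sqrt N%:R * eps + delta / Num.sqrt N%:R).
  by field; rewrite gt_eqF.
by rewrite lerDl addr_ge0// ?mulr_ge0 ?divr_ge0 ?sqrtr_ge0.
Qed.

(** Below the threshold of the net regime, each [N] has its own constant; the finite sum dominates
    them all. *)
Theorem uniform_recovery :
  exists2 K : R, 0 <= K & forall N, (0 < N)%N -> recoverable p d N K.
Proof.
have [N0 hN0] := @recoverable_net R p d hd hp.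
have ex N : exists K : R, 0 <= K /\ ((0 < N)%N -> recoverable p d N K).
  have [->|N_gt0] := posnP N; first by exists 0.
  have [PN|NP] := leqP P N.
    by have [K K0 rK] := @recoverable_tall R p d hd hp N N_gt0 PN; exists K.
  by have [K K0 rK] := recoverable_sparse N_gt0 NP; exists K.
have [Kf hK] := choice ex.
have K0 : 0 <= \sum_(i < N0) Kf i by apply: sumr_ge0 => i _; case: (hK i).
exists (8 + \sum_(i < N0) Kf i); first by rewrite addr_ge0.
move=> N N_gt0; have [NN|NN] := leqP N0 N.
  apply: (@recoverableW R p d N 8 _ _ (hN0 N N_gt0 NN)); by rewrite lerDl.
apply: (@recoverableW R p d N (Kf N) _ _ ((hK N).2 N_gt0)).
rewrite (bigD1 (Ordinal NN))//= addrCA lerDl addr_ge0// sumr_ge0// => i _.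
by case: (hK i).
Qed.

End SparseRegime.

(** * From the grid to the uniform law *)

Section Cells.
Context {R : realType}.

(** Half-open, so that the cells of one level are disjoint and a sample determines its indices. *)
Definition cell n (k : nat) : set R :=
  `[pt n k - (2 ^+ n)^-1, pt n k + (2 ^+ n)^-1[%classic.

Lemma measurable_cell n k : measurable (cell n k : set (measurableTypeR R)).
Proof. exact: measurable_itv. Qed.

Lemma cellE n k (t : R) :
  cell n k t = (pt n k - (2 ^+ n)^-1 <= t < pt n k + (2 ^+ n)^-1) :> Prop.
Proof. by rewrite /cell /= in_itv. Qed.

Lemma cell_bounds n (k : 'I_(2 ^ n)) :
  -1 <= (pt n k - (2 ^+ n)^-1 : R) /\ (pt n k + (2 ^+ n)^-1 : R) <= 1.
Proof.
have p2 : 0 < 2 ^+ n :> R by rewrite exprn_gt0.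
have eN : (2 * k + 1)%:R = 2 * k%:R + 1 :> R by rewrite natrD natrM.
have E1 : pt n k - (2 ^+ n)^-1 = 2 * k%:R / 2 ^+ n - 1 :> R.
  by rewrite /pt eN; field; rewrite gt_eqF.
have E2 : pt n k + (2 ^+ n)^-1 = 2 * (k%:R + 1) / 2 ^+ n - 1 :> R.
  by rewrite /pt eN; field; rewrite gt_eqF.
rewrite E1 E2; split.
  by rewrite lerDr divr_ge0 ?mulr_ge0// ltW.
by rewrite lerBlDr ler_pdivrMr// -[1 + 1]/(2 : R) ler_pM2l// natr1 -natrX ler_nat.
Qed.

Lemma cell_near n (k : 'I_(2 ^ n)) (t : R) : cell n k t ->
  `|t| <= 1 /\ `|t - pt n k| <= (2 ^+ n)^-1.
Proof.
rewrite cellE => /andP[t1 t2]; have [b1 b2] := cell_bounds k.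
by split; rewrite ler_norml; apply/andP; split; lra.
Qed.

Lemma cell_disjoint n (j k : nat) (t : R) : cell n j t -> cell n k t -> j = k.
Proof.
have p2 : 0 < (2 ^+ n)^-1 :> R by rewrite invr_gt0 exprn_gt0.
have eN m : (2 * m + 1)%:R = 2 * m%:R + 1 :> R by rewrite natrD natrM.
have lt_succ a b : cell n a t -> cell n b t -> (a < b.+1)%N.
  rewrite !cellE => /andP[a1 _] /andP[_ b2].
  rewrite -(ltr_nat R) -natr1 -(ltr_pM2r p2).
  by move: (le_lt_trans a1 b2); rewrite /pt !eN; lra.
move=> jt kt; apply/eqP; rewrite eqn_leq.
by apply/andP; split; rewrite -ltnS; apply: lt_succ.
Qed.

Lemma uniform_sub (A : set R) : measurable (A : set (measurableTypeR R)) ->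
  A `<=` `[-1, 1] ->
  uniform_prob (ltN11 R) A = ((2^-1)%:E * lebesgue_measure A)%E.
Proof.
move=> mA A1; rewrite /uniform_prob integral_uniform_pdf setIidl//.
rewrite (eq_integral (cst (2^-1)%:E)) ?integral_cst// => x; rewrite inE => Ax.
have := A1 x Ax; rewrite /= in_itv /= => x1; rewrite /uniform_pdf x1.
by congr (_%:E); rewrite opprK.
Qed.

Lemma uniform_cell n (k : 'I_(2 ^ n)) :
  uniform_prob (ltN11 R) (cell n k) = ((2 ^+ n)^-1)%:E.
Proof.
have p2 : 0 < (2 ^+ n)^-1 :> R by rewrite invr_gt0 exprn_gt0.
have [b1 b2] := cell_bounds k.
rewrite uniform_sub; [|exact: measurable_cell|]; last first.
  move=> t; rewrite cellE => /andP[t1 t2]; rewrite /= in_itv /=.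
  by apply/andP; split; lra.
rewrite /cell lebesgue_measure_itv /= lte_fin ifT; last lra.
by rewrite -EFinD -EFinM; congr (_%:E); lra.
Qed.

Lemma uniform_box : uniform_prob (ltN11 R) `[-1, 1]%classic = 1%E.
Proof. by rewrite /uniform_prob integral_uniform_pdf1. Qed.

End Cells.

Section Sampling.
Context {R : realType} (d : nat) (disp0 : measure_display) (T0 : measurableType disp0)
  (Pr0 : probability T0 R) (y : {RV Pr0 >-> d.-tuple R}).
Hypothesis y_unif : iid_uniform Pr0 y.

Definition cube n (g : {ffun 'I_d -> 'I_(2 ^ n)}) : set (d.-tuple R) :=
  [set t | forall j, cell n (g j) (tnth t j)].

Lemma measurable_tnth_preimage (A : 'I_d -> set R) :
  (forall j, measurable (A j : set (measurableTypeR R))) ->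
  measurable [set t : d.-tuple R | forall j, A j (tnth t j)].
Proof.
move=> mA.
have -> : [set t : d.-tuple R | forall j, A j (tnth t j)] =
    \bigcap_(j in [set: 'I_d]) ((fun t : d.-tuple R => tnth t j) @^-1` A j).
  by apply/seteqP; split => t /= h j; [move=> _; exact: h | exact: h].
apply: fin_bigcap_measurable => // j _.
by have := @measurable_tnth _ R d j measurableT _ (mA j); rewrite setTI.
Qed.

Lemma measurable_cube n (g : {ffun 'I_d -> 'I_(2 ^ n)}) : measurable (cube g).
Proof.
apply: (@measurable_tnth_preimage (fun j => cell n (g j))) => j.
exact: measurable_cell.
Qed.

Lemma prob_cube n (g : {ffun 'I_d -> 'I_(2 ^ n)}) :
  Pr0 (y @^-1` cube g) = (#|{ffun 'I_d -> 'I_(2 ^ n)}|%:R^-1)%:E.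
Proof.
have [indep unif] := y_unif.
have := indep [set: 'I_d]%SET (fun j => cell n (g j)) (fun j => @measurable_cell R n (g j)).
have -> : \bigcap_(i in [set i | i \in [set: 'I_d]%SET]) ((fun w => tnth (y w) i) @^-1` cell n (g i))
   = y @^-1` cube g.
  by apply/seteqP; split => w /= h j; [apply: h; rewrite /= inE | move=> _; exact: h].
move=> ->.
rewrite (eq_bigr (fun=> ((2 ^+ n)^-1)%:E)) => [|j _]; last first.
  by rewrite unif ?uniform_cell//; exact: measurable_cell.
rewrite prodEFin prodr_const cardsT card_ord card_ffun !card_ord exprVn.
by rewrite natrX natrX.
Qed.

End Sampling.

Section SampleEvents.
Context {R : realType} (d N : nat) (disp0 disp : measure_display)
  (T0 : measurableType disp0) (T : measurableType disp)
  (Pr0 : probability T0 R) (Pr : probability T R)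
  (y : {RV Pr0 >-> d.-tuple R}) (Y : 'I_N -> {RV Pr >-> d.-tuple R}).
Hypothesis y_unif : iid_uniform Pr0 y.
Hypothesis Y_iid : iid_samples Pr0 y Pr Y.

Definition sample_cube n (g : {ffun 'I_N -> {ffun 'I_d -> 'I_(2 ^ n)}}) : set T :=
  [set w | forall i, cube (g i) (Y i w)].

Lemma sample_cubeE n (g : {ffun 'I_N -> {ffun 'I_d -> 'I_(2 ^ n)}}) :
  sample_cube g = \bigcap_(i in [set i | i \in [set: 'I_N]%SET]) (Y i @^-1` cube (g i)).
Proof.
apply/seteqP; split => w /= h i; first by move=> _; exact: h.
by apply: h; rewrite /= inE.
Qed.

Lemma measurable_sample_preimage i (A : set (d.-tuple R)) : measurable A ->
  measurable (Y i @^-1` A).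
Proof. by move=> mA; have := measurable_funPT (Y i) measurableT _ mA; rewrite setTI. Qed.

Lemma measurable_sample_cube n (g : {ffun 'I_N -> {ffun 'I_d -> 'I_(2 ^ n)}}) :
  measurable (sample_cube g).
Proof.
rewrite sample_cubeE; apply: fin_bigcap_measurable => [|i _].
  exact: finite_finset.
by apply: measurable_sample_preimage; exact: measurable_cube.
Qed.

Lemma prob_sample_cube n (g : {ffun 'I_N -> {ffun 'I_d -> 'I_(2 ^ n)}}) :
  Pr (sample_cube g) = (#|{ffun 'I_N -> {ffun 'I_d -> 'I_(2 ^ n)}}|%:R^-1)%:E.
Proof.
have [indep law] := Y_iid.
rewrite sample_cubeE indep; last by move=> i; exact: measurable_cube.
rewrite (eq_bigr (fun=> (#|{ffun 'I_d -> 'I_(2 ^ n)}|%:R^-1)%:E)) => [|i _]; last first.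
  by rewrite law ?prob_cube//; exact: measurable_cube.
by rewrite prodEFin prodr_const cardsT card_ord [in RHS]card_ffun card_ord exprVn -natrX.
Qed.

Lemma sample_cube_disjoint n (g g' : {ffun 'I_N -> {ffun 'I_d -> 'I_(2 ^ n)}}) w :
  sample_cube g w -> sample_cube g' w -> g = g'.
Proof.
move=> gw g'w; apply/ffunP => i; apply/ffunP => j; apply: val_inj.
exact: cell_disjoint (gw i j) (g'w i j).
Qed.

Definition sample_event n (good : pred {ffun 'I_N -> {ffun 'I_d -> 'I_(2 ^ n)}}) : set T :=
  \bigcup_(g in [set g | good g]) sample_cube g.

Lemma measurable_sample_event n (good : pred {ffun 'I_N -> {ffun 'I_d -> 'I_(2 ^ n)}}) :
  measurable (sample_event good).
Proof.
apply: fin_bigcup_measurable => [|g _]; first exact: finite_finset.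
exact: measurable_sample_cube.
Qed.

Lemma prob_sample_event n (good : pred {ffun 'I_N -> {ffun 'I_d -> 'I_(2 ^ n)}}) :
  Pr (sample_event good) = (avg (fun g => (good g)%:R))%:E.
Proof.
rewrite measure_fin_bigcup.
- have -> : [set g | good g] = [set` enum good].
    by apply/seteqP; split => g /=; rewrite mem_enum.
  rewrite -fsbig_seq ?enum_uniq//.
  rewrite (eq_bigr (fun=> (#|{ffun 'I_N -> {ffun 'I_d -> 'I_(2 ^ n)}}|%:R^-1)%:E)); last first.
    by move=> g _; exact: prob_sample_cube.
  rewrite sumEFin big_const_seq count_predT iter_addr_0 -cardE avg_bool.
  by rewrite mulrC mulr_natr.
- exact: finite_finset.
- move=> g g' _ _ [w [gw g'w]]; exact: sample_cube_disjoint gw g'w.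
- by move=> g _; exact: measurable_sample_cube.
Qed.

(** Each sample has the law of [y], and a finite union of null sets is null: an almost sure property
    can be imposed on all samples at no cost in probability. *)
Lemma sample_as (A : set (d.-tuple R)) : measurable A ->
  distribution Pr0 y (~` A) = 0%E -> forall E : set T, measurable E ->
  let E' := E `&` [set w | forall i, A (Y i w)] in
  measurable E' /\ (Pr E <= Pr E')%E.
Proof.
move=> mA A0 E mE; have [_ law] := Y_iid.
pose Z := \bigcup_(i in [set: 'I_N]) (Y i @^-1` (~` A)).
have mZi i : measurable (Y i @^-1` (~` A)).
  by apply: measurable_sample_preimage; exact: measurableC.
have mZ : measurable Z by apply: fin_bigcup_measurable => //; exact: finite_finset.
have Z0 : Pr Z = 0%E.
  apply/eqP; rewrite eq_le measure_ge0 andbT.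
  rewrite (le_trans (@content_sub_fsum _ _ _ Pr _ setT Z (fun i => Y i @^-1` (~` A)) _ _ _ (@subset_refl _ _)))//.
    exact: finite_finset.
  rewrite fsbig1// => i _; rewrite /= law; last exact: measurableC.
  exact: A0.
have E'E : E `&` [set w | forall i, A (Y i w)] = E `\` Z.
  apply/seteqP; split=> w [Ew h]; split=> //=.
    by move=> [i _]; apply; exact: h.
  by move=> i; apply: contrapT => nA; apply: h; exists i.
rewrite E'E; split; first exact: measurableD.
rewrite (measureDI Pr mE mZ) -[leRHS]adde0 leeD2l// -Z0.
rewrite le_measure ?inE//; exact: measurableI.
Qed.

End SampleEvents.

Section LinftyL2.
Context {R : realType} (d : nat) (disp0 : measure_display) (T0 : measurableType disp0)
  (Pr0 : probability T0 R) (y : {RV Pr0 >-> d.-tuple R}).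

Lemma Linfty_bound (f : d.-tuple R -> R) (e : R) : measurable_fun setT f ->
  ('N[distribution Pr0 y]_+oo [EFin \o f] <= e%:E)%E ->
  [/\ 0 <= e, measurable [set t | `|f t| <= e] &
      distribution Pr0 y (~` [set t | `|f t| <= e]) = 0%E].
Proof.
move=> mf.
have mA : measurable [set t | `|f t| <= e].
  have mn : measurable_fun setT (fun t => `|f t|) by exact: measurableT_comp.
  have := mn measurableT `]-oo, e]%classic (measurable_itv _); rewrite setTI.
  by congr measurable; apply/seteqP; split=> t; rewrite /= in_itv.
rewrite unlock /= probability_setT lte01 => /ess_supP [A [mA' A0 subA]].
have A0' : distribution Pr0 y (~` [set t | `|f t| <= e]) = 0%E.
  apply/eqP; rewrite eq_le measure_ge0 andbT -[leRHS]A0 le_measure ?inE//.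
  exact: measurableC.
(* For [e < 0] the set is empty, so its null complement would be the whole space. *)
split=> //; rewrite leNgt; apply/negP => e0.
have : distribution Pr0 y setT = 0%E.
  rewrite -A0'; congr (distribution Pr0 y _); apply/seteqP; split => t //= _.
  by apply/negP; rewrite -ltNge (lt_le_trans e0).
by rewrite probability_setT => -[] /eqP; rewrite oner_eq0.
Qed.

Lemma L2_bound (f : d.-tuple R -> R) (A : set (d.-tuple R)) (M : R) :
  measurable_fun setT f -> measurable A -> distribution Pr0 y (~` A) = 0%E ->
  0 <= M -> (forall t, A t -> `|f t| <= M) ->
  ('N[distribution Pr0 y]_2 [EFin \o f] <= M%:E)%E.
Proof.
move=> mf mA A0 M0 fM; rewrite unlock /=.
rewrite [leRHS](_ : _ = (((M ^+ 2)%:E `^ 2^-1))%E); last first.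
  by rewrite poweR_EFin powR12_sqrt ?sqr_ge0// sqrtr_sqr ger0_norm.
apply: gt0_ler_poweR; rewrite ?invr_ge0 ?in_itv//= ?lee_fin ?leey ?andbT ?sqr_ge0//.
  by apply: integral_ge0 => x _; rewrite lee_fin powR_ge0.
rewrite [leRHS](_ : _ = (\int[distribution Pr0 y]_x (cst (M ^+ 2)%:E x))%E); last first.
  rewrite integral_cst// -[LHS]mule1; congr (_ * _)%E.
  by apply/esym; exact: (probability_setT (distribution Pr0 y)).
have mf2 : measurable_fun setT (fun x => (`|f x| `^ 2)%:E).
  rewrite (_ : (fun x => _) = (fun x => (f x ^+ 2)%:E)).
    by apply/measurable_EFinP; exact: measurable_funX.
  by apply/funext => x; rewrite powR_mulrn// real_normK ?num_real.
apply: (@ae_ge0_le_integral _ _ _ (distribution Pr0 y)) => //.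
- by move=> x _; rewrite lee_fin sqr_ge0.
- exists (~` A); split=> //; first exact: measurableC.
  move=> t /=; apply: contra_not => At _.
  by rewrite lee_fin powR_mulrn// lerXn2r ?nnegrE// fM.
Qed.

End LinftyL2.

Section Assembly.
Context {R : realType} (p d : nat).

Lemma measurable_pc (v : 'cV[R]_#|Lambda p d|) :
  measurable_fun [set: d.-tuple R] (fun t => pc v (tnth t)).
Proof.
rewrite /pc; apply: measurable_sum => j; apply: measurable_funM => //.
rewrite /phi; apply: measurable_prod => i _.
apply: measurableT_comp (measurable_tnth i).
by apply: continuous_measurable_fun; exact: continuous_horner.
Qed.

Lemma pc_expansionE (v : 'cV[R]_#|Lambda p d|) (t : d.-tuple R) :
  pc_expansion v t = pc v (tnth t).
Proof. by []. Qed.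

Lemma measurement_matrixE N (z : 'I_N -> d.-tuple R) :
  measurement_matrix p z = phi_mx p (fun i => tnth (z i)).
Proof. by apply/matrixP => i j; rewrite !mxE. Qed.

Definition coefs_on (L : {set multi_index p d}) (c : multi_index p d -> R) :
    'cV[R]_#|Lambda p d| :=
  \col_j if enum_val j \in L then c (enum_val j) else 0.

Lemma pc_expansion_onE (L : {set multi_index p d}) c (t : d.-tuple R) :
  L \subset Lambda p d -> pc_expansion_on L c t = pc (coefs_on L c) (tnth t).
Proof.
move=> LL; rewrite /pc_expansion_on /pc.
rewrite (eq_bigr (fun j => if enum_val j \in L
    then c (enum_val j) * Psi_alpha (enum_val j : multi_index p d) t else 0)); last first.
  by move=> j _; rewrite mxE; case: ifP => _; rewrite ?mul0r.
rewrite -(@big_enum_val _ _ _ _ _ (fun a => if a \in L then c a * Psi_alpha a t else 0)).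
rewrite -big_mkcondr; apply: eq_bigl => a; rewrite andb_idl//.
by move=> /(fintype.subsetP LL).
Qed.

Lemma pc_diff_bound (v w : 'cV[R]_#|Lambda p d|) (x : 'I_d -> R) (b : R) :
  (forall i, `|x i| <= 1) -> (forall j, `|v j 0 - w j 0| <= b) ->
  `|pc v x - pc w x| <= #|Lambda p d|%:R * (b * 3 ^+ p).
Proof.
move=> x1 vw; rewrite /pc -sumrB (le_trans (ler_norm_sum _ _ _))//.
rewrite [leRHS]mulr_natl -[X in _ *+ X]card_ord -sumr_const ler_sum// => j _.
rewrite -mulrBl normrM ler_pM// -ler_sqr ?nnegrE ?exprn_ge0//.
rewrite real_normK ?num_real// -exprM mulnC exprM -natrX.
exact: phi_sqr_bound.
Qed.

Lemma box_full_law (disp0 : measure_display) (T0 : measurableType disp0)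
    (Pr0 : probability T0 R) (y : {RV Pr0 >-> d.-tuple R}) :
  iid_uniform Pr0 y ->
  let box := [set t : d.-tuple R | forall j, `[-1, 1]%classic (tnth t j)] in
  measurable box /\ distribution Pr0 y (~` box) = 0%E.
Proof.
move=> [indep unif] box.
have mbox : measurable box.
  by apply: (@measurable_tnth_preimage R d (fun=> `[-1, 1]%classic)) => j; exact: measurable_itv.
split=> //; rewrite probability_setC//.
have := indep [set: 'I_d]%SET (fun=> `[-1, 1]%classic) (fun=> measurable_itv _).
have -> : \bigcap_(i in [set i | i \in [set: 'I_d]%SET]) ((fun w => tnth (y w) i) @^-1` `[-1, 1]%classic)
   = y @^-1` box.
  by apply/seteqP; split => w /= h j; [apply: h; rewrite /= inE | move=> _; exact: h].
rewrite big1 => [h|j _]; last by rewrite unif ?uniform_box//; exact: measurable_itv.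
by rewrite [X in (1 - X)%E]h subee.
Qed.

End Assembly.

Theorem theorem3p1 (R : realType) (d p : nat) (hd : (0 < d)%N) (hp : (0 < p)%N) :
  exists c1 c2 : R,
  forall (disp0 : measure_display) (T0 : measurableType disp0)
         (Pr0 : probability T0 R) (y : {RV Pr0 >-> d.-tuple R})
         (u : d.-tuple R -> R),
  iid_uniform Pr0 y ->
  measurable_fun [set: d.-tuple R] u ->
  ('N[distribution Pr0 y]_+oo [EFin \o u] < +oo)%E ->
  forall (N : nat) (disp : measure_display) (T : measurableType disp)
         (Pr : probability T R) (Y : 'I_N -> {RV Pr >-> d.-tuple R}),
  (0 < N)%N ->
  iid_samples Pr0 y Pr Y ->
  forall (delta eps : R) (Leps : {set multi_index p d})
         (c0 : multi_index p d -> R),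
  0 <= delta ->
  Leps \subset Lambda p d ->
  ('N[distribution Pr0 y]_+oo [EFin \o (u \- pc_expansion_on Leps c0)%R] <= eps%:E)%E ->
  #|Leps|%:R < S_max R p d N ->
  exists E : set T,
    [/\ measurable E,
        ((success_bound R p d N)%:E <= Pr E)%E &
        forall w : T, E w ->
        forall c : 'cV[R]_#|Lambda p d|,
        l1_solution (measurement_matrix p (fun i => Y i w))
                    (\col_i u (Y i w)) delta c ->
        ('N[distribution Pr0 y]_2 [EFin \o (u \- pc_expansion c)%R]
           <= (c1 * eps + c2 * (delta / Num.sqrt N%:R))%:E)%E].
Proof.
have [K K0 rec] := @uniform_recovery R p d hd hp.
pose C : R := #|Lambda p d|%:R * (K * 3 ^+ p).
(* Coefficients are recovered up to K (eps + delta / sqrt N), and each of the [P] basis functions is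
   at most 3^p on the box; the extra 1 accounts for [u] minus its given expansion. *)
exists (1 + C), C.
move=> disp0 T0 Pr0 y u y_unif mu _ N disp T Pr Y N_gt0 Y_iid delta eps L c0.
move=> delta0 LL; set v := coefs_on L c0.
have fE : u \- pc_expansion_on L c0 = u \- (fun t => pc v (tnth t)).
  by apply/funext => t /=; rewrite pc_expansion_onE.
have mf (w : 'cV[R]_#|Lambda p d|) :
    measurable_fun [set: d.-tuple R] (u \- (fun t => pc w (tnth t))).
  by apply: measurable_funB => //; exact: measurable_pc.
rewrite fE => /(Linfty_bound (mf v)); set A := [set t | _] => -[eps0 mA A0] sparse.
pose S := [set j : 'I_#|Lambda p d| | enum_val j \in L]%SET.
have SL : (#|S| <= #|L|)%N.
  rewrite -(card_imset _ (@enum_val_inj _ (mem (Lambda p d)))).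
  by apply/subset_leq_card/fintype.subsetP => a /imsetP[j]; rewrite inE => jL ->.
have [|n [good [gE goodP]]] := rec N N_gt0 S.
  by apply: le_lt_trans sparse; rewrite ler_nat.
have mE := measurable_sample_event Y good.
(* The bound on [u] minus its expansion is known only almost everywhere, so it is imposed at the
   samples separately. *)
have [mE' leE'] := sample_as Y_iid mA A0 mE.
eexists; split; [exact: mE'|..].
  by rewrite (le_trans _ leE')// (prob_sample_event y_unif Y_iid) lee_fin.
move=> w [[g /= gg wg] Aw] c sol.
pose z (i : 'I_N) (j : 'I_d) : R := tnth (Y i w) j.
have gz : near_grid g z by move=> i j; exact: cell_near (wg i j).
have cv j : `|c j 0 - v j 0| <= K * (eps + delta / Num.sqrt N%:R).
  rewrite measurement_matrixE in sol.
  apply: (goodP g gg z gz _ v c delta eps delta0 eps0 _ _ sol) => [k|i].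
    by rewrite inE mxE => /negbTE ->.
  by rewrite mxE phi_mx_mul; exact: Aw.
have [mbox box0] := box_full_law y_unif.
have dN0 : 0 <= delta / Num.sqrt N%:R by rewrite divr_ge0.
have C0 : 0 <= C by rewrite !mulr_ge0.
(* The approximation error is controlled on [A], the polynomials on the box; both have full
   measure. *)
apply: (@L2_bound _ _ _ _ _ _ _ (A `&` [set t : d.-tuple R | forall j, `[-1, 1]%classic (tnth t j)])).
- exact: mf.
- exact: measurableI.
- apply/eqP; rewrite eq_le measure_ge0 andbT setCI.
  rewrite (le_trans (measureU2 _ _ _))//; try exact: measurableC.
  by rewrite [X in (X + _)%E]A0 [X in (_ + X)%E]box0 adde0.
- by rewrite addr_ge0 ?mulr_ge0 ?addr_ge0.
- move=> t [/= At bt].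
  have t1 i : `|tnth t i| <= 1 by rewrite ler_norml; have := bt i; rewrite in_itv.
  have -> : u t - pc_expansion c t = (u t - pc v (tnth t)) - (pc c (tnth t) - pc v (tnth t)).
    by rewrite pc_expansionE; ring.
  rewrite (le_trans (ler_normB _ _))//.
  rewrite (le_trans (lerD At (pc_diff_bound t1 cv)))// le_eqVlt; apply/orP; left.
  by apply/eqP; rewrite /C; ring.
Qed.
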